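(* Let $b\ge 1$ and $l\ge 0$ be integers, and let $X$ be either $C^k(S)$ for an integer $k\ge 2$, or $C^\omega_\delta(S)$ for some $\delta>0$. Then for a Baire generic $C^l$ family $f:I^b\to X$, $t\mapsto f_t$, it holds that for every parameter $t\in I^b$ the infinitesimal cyclicity of the corresponding family $x\mapsto x+2\pi r+a f_t(x) \pmod{2\pi}$ is infinite.
   Context: Let $S=\mathbb{R}/2\pi\mathbb{Z}$. $C^k(S)$ is the Banach space of real-valued $2\pi$-periodic $C^k$ functions with the usual $C^k$ norm. $C^\omega_\delta(S)$ is the space of real analytic (real-valued on $\mathbb{R}$) $2\pi$-periodic functions $f$ which can be analytically continued to the strip $\{z\in\mathbb{C}:|\mathrm{Im}\, z|<\delta\}$ with finite norm $\|f\|_{C^\omega_\delta(S)}=\sup_{|\mathrm{Im}\, z|<\delta}|f(z)|$. $I^b$ is the (closed) unit cube in $\mathbb{R}^b$. A $C^l$ family is a $C^l$ map $f:I^b\to X$; the space of $C^l$ families carries the usual $C^l$ norm (supremum over $t\in I^b$ and over multi-indices $|m|\le l$ of the $X$-norm of the partial derivatives $\partial_t^m f_t$). A property holds for a Baire generic family if it holds for all families in a residual subset (complement of a countable union of nowhere dense sets) of this space. For a function $f$ on $S$, the corresponding family is $F_{r,a}:S\to S$, $x\mapsto x+2\pi r+a f(x) \pmod{2\pi}$, where $r\in\mathbb{R}$ and $a$ ranges over a small interval $[-a_0,a_0]$ on which these maps are circle diffeomorphisms. For a circle diffeomorphism $g$, $N(g)$ is the number of attracting periodic trajectories of $g$ and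 $\rho(g)$ is the rotation number of $g$ (normalized so that $x\mapsto x+2\pi r$ has rotation number $r$). Define $$B(F,\rho_0)=\limsup_{a_1\to 0+}\ \sup_{\rho(F_{r,a})=\rho_0,\ |a|<a_1} N(F_{r,a}).$$ The infinitesimal cyclicity of $F$ is finite if $B(F,\rho)$ is uniformly bounded over all $\rho\in\mathbb{R}$; otherwise it is infinite. *)

(* Defs.v *)
From HB Require Import structures.
From mathcomp Require Import all_boot all_order all_algebra.
From mathcomp Require Import all_classical all_reals all_analysis.
From mathcomp Require Import complex ring lra.

(* MathComp-Analysis.  Real-valued functions on the circle S = R/2piZ are
   2pi-periodic functions R -> R, circle maps are given by their lifts to R,
   and subsets of S are 2piZ-invariant subsets of R. *)

Set Implicit Arguments.
Unset Strict Implicit.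
Unset Printing Implicit Defensive.

Import Order.TTheory GRing.Theory Num.Theory.
Import numFieldNormedType.Exports Normc.

Local Open Scope classical_set_scope.
Local Open Scope complex_scope.
Local Open Scope ring_scope.

Section SupNorm.
Context {R : realType} {I : Type} (D : set I).
Implicit Types p q : I -> R.

Lemma sup_norm_ub p i : has_ubound (p @` D) -> D i -> p i <= sup (p @` D).
Proof. by move=> pD Di; apply: ub_le_sup => //; exists i. Qed.

Lemma sup_norm_le p M : 0 <= M -> (forall i, D i -> p i <= M) ->
  sup (p @` D) <= M.
Proof.
move=> M0 pM; have [->|D0] := eqVneq D set0; first by rewrite image_set0 sup0.
apply: ge_sup; last by move=> _ [i Di <-]; exact: pM.
by move/set0P: D0 => [i Di]; exists (p i), i.
Qed.

Lemma sup_norm_ge0 p : (forall i, 0 <= p i) -> 0 <= sup (p @` D).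
Proof.
move=> p0; have [[[_ [i Di _]] ub]|no] := pselect (has_sup (p @` D)); last first.
  by rewrite sup_out.
exact: le_trans (p0 i) (sup_norm_ub ub Di).
Qed.

Lemma sup_normD p q pq : (forall i, 0 <= p i) -> (forall i, 0 <= q i) ->
  has_ubound (p @` D) -> has_ubound (q @` D) ->
  (forall i, D i -> pq i <= p i + q i) ->
  sup (pq @` D) <= sup (p @` D) + sup (q @` D).
Proof.
move=> p0 q0 pD qD pqD; apply: sup_norm_le => [|i Di].
  by rewrite addr_ge0// sup_norm_ge0.
by apply: le_trans (pqD _ Di) _; rewrite lerD// sup_norm_ub.
Qed.

Lemma sup_normZ_le p q c : 0 <= c -> (forall i, 0 <= p i) ->
  has_ubound (p @` D) -> (forall i, D i -> q i <= c * p i) ->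
  sup (q @` D) <= c * sup (p @` D).
Proof.
move=> c0 p0 pD qp; apply: sup_norm_le => [|i Di].
  by rewrite mulr_ge0// sup_norm_ge0.
by apply: le_trans (qp _ Di) _; rewrite ler_wpM2l// sup_norm_ub.
Qed.

Lemma sup_normZ p q (c : R) : (forall i, 0 <= p i) -> (forall i, 0 <= q i) ->
  has_ubound (p @` D) -> (forall i, D i -> q i = `|c| * p i) ->
  sup (q @` D) = `|c| * sup (p @` D).
Proof.
move=> p0 q0 pD qp; apply/eqP; rewrite eq_le; apply/andP; split.
  by apply: sup_normZ_le => // i Di; rewrite qp.
have [->|c0] := eqVneq c 0; first by rewrite normr0 mul0r sup_norm_ge0.
rewrite -ler_pdivlMl ?normr_gt0//; apply: sup_normZ_le => //.
- by case: pD => M ub; exists (`|c| * M) => _ [i Di <-]; rewrite qp// ler_wpM2l//; apply: ub; exists i.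
- by move=> i Di; rewrite qp// mulKf// normr_eq0.
Qed.

End SupNorm.

Section Circle.
Context {R : realType}.

Definition periodic2pi (T : Type) (f : R -> T) :=
  forall x, f (x + pi *+ 2) = f x.

Lemma periodic2pi_int (T : Type) (f : R -> T) : periodic2pi f ->
  forall (n : int) x, f (x + pi *+ 2 * n%:~R) = f x.
Proof.
move=> pf.
have pn (n : nat) x : f (x + pi *+ 2 * n%:R) = f x.
  elim: n x => [|n IH] x; first by rewrite mulr0 addr0.
  by rewrite -natr1 mulrDr mulr1 addrA pf.
case=> n x; first exact: pn.
by rewrite NegzE mulrNz mulrN -(pn n.+1) subrK.
Qed.

Lemma periodic2pi_bounded (f : R -> R^o) : periodic2pi f -> continuous f ->
  exists M, forall x, `|f x| <= M.
Proof.
move=> pf cf.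
have cfI : {within `[0, pi *+ 2], continuous f} by exact: continuous_subspaceT.
have /compact_bounded[M [_ /(_ (M + 1))]] :=
  continuous_compact cfI (@segment_compact R 0 (pi *+ 2)).
rewrite ltrDl => /(_ ltr01) fM; exists (M + 1) => x.
have pi2 : 0 < pi *+ 2 :> R by rewrite mulrn_wgt0// pi_gt0.
rewrite -(periodic2pi_int pf (- Num.floor (x / (pi *+ 2)))).
apply: fM => /=; eexists; last reflexivity.
rewrite /= in_itv/= mulrNz mulrN subr_ge0 lerBlDr.
rewrite mulrC -ler_pdivlMr// ge_floor /=.
rewrite -[X in _ <= X + _]mul1r -mulrDl -ler_pdivrMr//.
by rewrite addrC (le_trans (ltW (floorD1_gt _)))// intrD.
Qed.

End Circle.

Section Ck.
Context {R : realType} (k : nat).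

Definition Ck_set : {pred R -> R^o} := mem [set f : R -> R^o |
  [/\ periodic2pi f,
      forall i x, (i < k)%N -> derivable (derive1n i f) x 1 &
      continuous (derive1n k f : R -> R^o)]].

Record Ck := MkCk { Ck_fun :> R -> R^o; CkP : Ck_fun \in Ck_set }.
HB.instance Definition _ := [isSub for Ck_fun].
HB.instance Definition _ := [Choice of Ck by <:].

Lemma Ck_continuous (f : R -> R^o) i : f \in Ck_set -> (i <= k)%N ->
  continuous (derive1n i f : R -> R^o).
Proof.
rewrite inE => -[_ df cf]; rewrite leq_eqVlt => /predU1P[->//|ik] x.
apply: differentiable_continuous; apply/derivable1_diffP; exact: df.
Qed.

Lemma Ck_periodic (f : R -> R^o) i : f \in Ck_set -> periodic2pi (derive1n i f).
Proof.
rewrite inE => -[pf _ _]; elim: i => [//|i IH] x.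
rewrite /derive1n /= -/(derive1n i f) /derive1.
under eq_fun do rewrite addrA !IH.
by [].
Qed.

Lemma Ck_deriv_lin a (f g : R -> R^o) i : f \in Ck_set -> g \in Ck_set ->
  (i <= k)%N -> derive1n i (a *: f + g) = a *: derive1n i f + derive1n i g.
Proof.
move=> fk gk; elim: i => [//|i IH ik].
rewrite /derive1n /= -!/(derive1n i _) IH; last exact: ltnW.
move: fk gk; rewrite !inE => -[_ df _] [_ dg _].
apply/funext => x; rewrite !derive1E fctE.
rewrite deriveD; [|apply: derivableZ; exact: df|exact: dg].
by rewrite deriveZ; [|exact: df]; rewrite -!derive1E.
Qed.

Lemma Ck_submod_closed : submod_closed Ck_set.
Proof.
split.
  have e i : derive1n i (0 : R -> R^o) = 0.
    elim: i => [//|i IH]; rewrite /derive1n /= -/(derive1n i _) IH.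
    by apply/funext => x; rewrite derive1_cst.
  rewrite inE; split=> [x //|i x _|]; rewrite e; first exact: derivable_cst.
  by move=> x; exact: cvg_cst.
move=> a f g fk gk; have lin := Ck_deriv_lin a fk gk.
rewrite inE; split.
- move: fk gk; rewrite !inE => -[pf _ _] [pg _ _] x.
  by rewrite !fctE pf pg.
- move: fk gk; rewrite !inE => -[_ df _] [_ dg _] i x ik.
  rewrite lin; last exact: ltnW.
  by apply: derivableD; [apply: derivableZ; exact: df|exact: dg].
- rewrite lin// => x; apply: cvgD; first (apply: cvgZr).
    exact: (Ck_continuous fk).
  exact: (Ck_continuous gk).
Qed.

HB.instance Definition _ :=
  GRing.isSubmodClosed.Build _ _ Ck_set Ck_submod_closed.
HB.instance Definition _ := [SubChoice_isSubLmodule of Ck by <:].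

(* max_(i <= k) sup_x |f^(i)(x)| *)
Definition Ck_norm (f : Ck) : R :=
  sup [set `|derive1n ix.1 f ix.2| | ix in [set ix : nat * R | (ix.1 <= k)%N]].

Lemma Ck_norm_ubound (f : Ck) :
  has_ubound [set `|derive1n ix.1 f ix.2| |
              ix in [set ix : nat * R | (ix.1 <= k)%N]].
Proof.
have /choice[M fM] : forall i, exists M,
    (i <= k)%N -> forall x, `|derive1n i f x| <= M.
  move=> i; have [ik|_] := boolP (i <= k)%N; last by exists 0.
  have [M fM] := periodic2pi_bounded (@Ck_periodic f i (CkP f))
    (Ck_continuous (CkP f) ik).
  by exists M.
exists (\sum_(i < k.+1) `|M i|) => _ [[i x] /= ik <-].
have := ik; rewrite -ltnS => ik1; rewrite (bigD1 (Ordinal ik1)) //=.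
rewrite -[leLHS]addr0 lerD ?sumr_ge0//.
by rewrite (le_trans (fM _ ik x))// ler_norm.
Qed.

Lemma Ck_normD (f g : Ck) : Ck_norm (f + g) <= Ck_norm f + Ck_norm g.
Proof.
apply: sup_normD; rewrite //=; try exact: Ck_norm_ubound.
move=> [i x] /= ik; rewrite -[Ck_fun f]scale1r.
rewrite (Ck_deriv_lin _ (CkP f) (CkP g) ik) !scale1r.
exact: ler_normD.
Qed.

Lemma Ck_normZ (c : R) (f : Ck) : Ck_norm (c *: f) = `|c| * Ck_norm f.
Proof.
apply: sup_normZ; rewrite //=; try exact: Ck_norm_ubound.
move=> [i x] /= ik; rewrite -[_ *: Ck_fun f]addr0.
have z0 : derive1n i (0 : R -> R^o) = 0.
  elim: {x ik} i => [//|i IH]; rewrite /derive1n /= -/(derive1n i _) IH.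
  by apply/funext => x; rewrite derive1_cst.
rewrite (Ck_deriv_lin _ (CkP f) _ ik) ?z0 ?addr0 ?normrZ//.
exact: rpred0.
Qed.

Lemma Ck_norm_eq0 (f : Ck) : Ck_norm f = 0 -> f = 0.
Proof.
move=> f0; apply/val_inj/funext => x /=; apply/eqP; rewrite -normr_le0.
rewrite -f0; apply: (sup_norm_ub (i := (0%N, x)) (Ck_norm_ubound f)).
by [].
Qed.

HB.instance Definition _ :=
  @Lmodule_isNormed.Build R Ck Ck_norm Ck_normD Ck_normZ Ck_norm_eq0.

End Ck.
Arguments Ck R k : clear implicits.

Section Analytic.
Context {R : realType}.
Local Notation C := (R[i]^o).

Definition analytic_on (U : set R[i]) (F : R[i] -> C) :=
  forall z0, U z0 -> exists a : nat -> C, exists2 r : R, 0 < r &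
    forall z, normc (z - z0) < r ->
      series (fun n => a n * (z - z0) ^+ n) @ \oo --> F z.

Lemma normc_ge0 (z : R[i]) : 0 <= normc z.
Proof. by case: z => x y; exact: sqrtr_ge0. Qed.

Lemma normcB (x y : R[i]) : normc (x - y) = normc (y - x).
Proof. by rewrite -[LHS]normcN opprB. Qed.

Lemma normc_real (x : R) : normc x%:C = `|x|.
Proof. by rewrite /= expr0n /= addr0 sqrtr_sqr. Qed.

Lemma normcX (z : R[i]) n : normc (z ^+ n) = normc z ^+ n.
Proof.
by elim: n => [|n IH]; rewrite ?expr0 ?normc1// !exprS normcM IH.
Qed.

Lemma normcE (z : C) : `|z| = (normc z)%:C.
Proof. by rewrite normc_def; case: z. Qed.

Lemma normc_sum n (u : nat -> R[i]) :
  normc (\sum_(0 <= i < n) u i) <= \sum_(0 <= i < n) normc (u i).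
Proof.
elim: n => [|n IH]; first by rewrite !big_geq// normc0.
by rewrite !big_nat_recr//=; apply: le_trans (le_normcD _ _) _; rewrite lerD.
Qed.

Lemma cvg_normcP (u : nat -> C) (l : C) : u @ \oo --> l <->
  forall e : R, 0 < e -> \forall n \near \oo, normc (u n - l) < e.
Proof.
split=> [/cvgrPdist_lt ul e e0|ul].
  have e0C : 0 < e%:C by rewrite ltcR.
  by apply: filterS (ul _ e0C) => n; rewrite normcE ltcR normcB.
apply/cvgrPdist_lt => e e0; have eE : e = (complex.Re e)%:C.
  by rewrite RRe_real// gtr0_real.
move: e0; rewrite eE ltcR => e0.
by apply: filterS (ul _ e0) => n; rewrite normcE ltcR normcB.
Qed.

Lemma pseries_bounded (a : nat -> C) (z l : C) :
  series (fun n => a n * z ^+ n) @ \oo --> l ->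
  exists2 B : R, 0 <= B & forall n, normc (a n) * normc z ^+ n <= B.
Proof.
move=> /cvg_normcP /(_ _ ltr01) [N _ Nl].
exists (\sum_(0 <= i < N) normc (a i * z ^+ i) + 2) => [|n].
  by rewrite addr_ge0// sumr_ge0// => i _; exact: normc_ge0.
rewrite -normcX -normcM; have [Nn|nN] := leqP N n; last first.
  rewrite (bigD1_seq n) ?mem_index_iota ?iota_uniq//=.
  rewrite -[leLHS]addr0 -addrA lerD// addr_ge0// sumr_ge0// => i _.
  exact: normc_ge0.
have -> : a n * z ^+ n = (series (fun n => a n * z ^+ n) n.+1 - l) +
    (l - series (fun n => a n * z ^+ n) n).
  by rewrite addrA subrK seriesSB.
apply: le_trans (le_normcD _ _) _; rewrite [X in _ + X]normcB.
rewrite -[leLHS]add0r lerD ?sumr_ge0// => [i _|]; first exact: normc_ge0.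
by rewrite (_ : 2 = 1 + 1)// lerD// ltW// Nl//= leqW.
Qed.

Lemma geometric_le2 n (q : R) : 0 <= q <= 2^-1 ->
  \sum_(0 <= i < n) q ^+ i <= 2.
Proof.
move=> /andP[q0 q2].
have le2 : \sum_(0 <= i < n) q ^+ i <= \sum_(0 <= i < n) (2^-1 : R) ^+ i.
  by apply: ler_sum => i _; rewrite lerXn2r// nnegrE.
apply: le_trans le2 _.
suff -> : \sum_(0 <= i < n) (2^-1 : R) ^+ i = 2 - 2 * 2^-1 ^+ n.
  by rewrite gerBl mulr_ge0// exprn_ge0.
elim: n => [|n IH]; first by rewrite big_geq// expr0 mulr1 subrr.
by rewrite big_nat_recr//= IH exprS mulrA divff// mul1r; ring.
Qed.

Lemma pseries_zero (a : nat -> C) (r : R) (H : R[i] -> C) : 0 < r ->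
  (forall z, normc z < r -> series (fun n => a n * z ^+ n) @ \oo --> H z) ->
  (forall e : R, 0 < e -> exists w, [/\ w != 0, normc w < e & H w = 0]) ->
  forall n, a n = 0.
Proof.
move=> r0 aH H0; pose rho := r / 2.
have rho0 : 0 < rho by rewrite divr_gt0.
have nrho : normc rho%:C = rho by rewrite normc_real gtr0_norm.
have [|B B0 aB] := @pseries_bounded a rho%:C (H rho%:C).
  by apply: aH; rewrite nrho ltr_pdivrMr// ltr_pMr// ltr1n.
rewrite nrho in aB.
have {}aB n : normc (a n) <= B * rho^-1 ^+ n.
  by rewrite exprVn ler_pdivlMr ?exprn_gt0.
elim/ltn_ind => n IH; apply: eq0_normc; apply/eqP; rewrite eq_le normc_ge0.
rewrite andbT; apply/ler_addgt0Pr => e e0; rewrite add0r.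
pose K := B * rho^-1 ^+ n * rho^-1 * 2.
have K0 : 0 <= K by rewrite !mulr_ge0// ?exprn_ge0// invr_ge0 ltW.
have eK : 0 < e / (K + 1) by rewrite divr_gt0// ltr_pwDr.
have [w [w0 we Hw]] : exists w, [/\ w != 0,
    normc w < Num.min (rho / 2) (e / (K + 1)) & H w = 0].
  by apply: H0; rewrite lt_min eK divr_gt0.
move: we; rewrite lt_min => /andP[wrho we].
have nw0 : 0 < normc w.
  rewrite lt_neqAle normc_ge0 andbT eq_sym; apply: contra_neq w0.
  exact: eq0_normc.
have q12 : 0 <= normc w / rho <= 2^-1.
  apply/andP; split; first by rewrite divr_ge0// ltW.
  by rewrite ler_pdivrMr// mulrC ltW.
suff : normc (a n) <= K * normc w.
  move/le_trans; apply; apply: le_trans (_ : (K + 1) * normc w <= _).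
    by rewrite ler_wpM2r ?ltW// ltrDl.
  by rewrite mulrC -ler_pdivlMr ?ltr_pwDr// ltW.
rewrite -(ler_pM2r (exprn_gt0 n nw0)); apply/ler_addgt0Pr => e1 e10.
have /cvg_normcP/(_ _ e10)[N _ Nw] : series (fun n => a n * w ^+ n) @ \oo --> H w.
  apply: aH; apply: lt_trans wrho _.
  by rewrite /rho; move: r0; lra.
have {}Nw := Nw (n.+1 + N)%N (leq_addl _ _).
rewrite /= Hw subr0 in Nw.
have Es : series (fun n => a n * w ^+ n) (n.+1 + N)%N = a n * w ^+ n +
    \sum_(0 <= i < N) a (n.+1 + i)%N * w ^+ (n.+1 + i)%N.
  rewrite /series /= (big_cat_nat (n := n.+1))//= ?leq_addr//.
  congr (_ + _).
    rewrite big_nat_recr//= big_nat big1 ?add0r// => i /andP[_ ni].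
    by rewrite IH// mul0r.
  by rewrite -{1}[n.+1]add0n big_addn addKn; apply: eq_bigr => i _; rewrite addnC.
have -> : normc (a n) * normc w ^+ n =
    normc (series (fun n => a n * w ^+ n) (n.+1 + N)%N -
    \sum_(0 <= i < N) a (n.+1 + i)%N * w ^+ (n.+1 + i)%N).
  by rewrite Es addrK normcM normcX.
apply: le_trans (le_normcD _ _) _; rewrite addrC lerD ?(ltW Nw)//.
rewrite normcN; apply: le_trans (normc_sum _ _) _.
apply: le_trans (_ : \sum_(0 <= i < N)
    (B * rho^-1 ^+ n * rho^-1 * normc w * normc w ^+ n) * (normc w / rho) ^+ i <= _).
  apply: ler_sum => i _; rewrite normcM normcX.
  apply: le_trans (ler_wpM2r _ (aB _)) _; first by rewrite exprn_ge0// ltW.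
  rewrite exprMn le_eqVlt; apply/orP; left; apply/eqP.
  by rewrite !exprD !exprS; ring.
rewrite -mulr_sumr.
have -> : K * normc w * normc w ^+ n =
  (B * rho^-1 ^+ n * rho^-1 * normc w * normc w ^+ n) * 2 by rewrite /K; ring.
apply: ler_wpM2l; last exact: geometric_le2.
by rewrite !mulr_ge0// ?exprn_ge0// ?normc_ge0// invr_ge0 ltW.
Qed.

Lemma analytic_lin U (c : C) F G : analytic_on U F -> analytic_on U G ->
  analytic_on U (fun z => c * F z + G z).
Proof.
move=> aF aG z0 Uz0.
have [a [r r0 ar]] := aF _ Uz0; have [b [s s0 bs]] := aG _ Uz0.
exists (fun n => c * a n + b n), (Num.min r s); first by rewrite lt_min r0 s0.
move=> z; rewrite lt_min => /andP[zr zs].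
have -> : series (fun n => (c * a n + b n) * (z - z0) ^+ n) =
    (fun n => c * series (fun n => a n * (z - z0) ^+ n) n) +
    series (fun n => b n * (z - z0) ^+ n).
  apply/funext => n; rewrite fctE /series /= mulr_sumr -big_split/=.
  by apply: eq_bigr => i _; rewrite mulrDl mulrA.
by apply: cvgD; [apply: cvgMr; exact: ar|exact: bs].
Qed.

Lemma analytic_zero_near U (H : R[i] -> C) z0 : analytic_on U H -> U z0 ->
  (forall e : R, 0 < e ->
     exists w, [/\ w != z0, normc (w - z0) < e & H w = 0]) ->
  exists2 r : R, 0 < r & forall z, normc (z - z0) < r -> H z = 0.
Proof.
move=> aH Uz0 H0; have [a [r r0 ar]] := aH _ Uz0; exists r => // z zr.
have a0 : forall n, a n = 0.
  apply: (@pseries_zero a r (fun w => H (w + z0)) r0) => [w wr|e e0].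
    by have := ar (w + z0); rewrite addrK; apply.
  have [w [w0 we Hw]] := H0 e e0.
  by exists (w - z0); split; rewrite ?subr_eq0 ?subrK.
have := ar _ zr.
have -> : series (fun n => a n * (z - z0) ^+ n) = (fun=> 0).
  by apply/funext => n; rewrite /series /= big1// => i _; rewrite a0 mul0r.
by move=> /cvg_lim <- //; rewrite lim_cst.
Qed.

Definition strip (delta : R) : set R[i] := [set z | `|complex.Im z| < delta].

(* Identity theorem: makes the norm of C^omega_delta(S) below well defined. *)
Lemma analytic_strip_eq0 (delta : R) (H : R[i] -> C) :
  analytic_on (strip delta) H -> (forall x : R, H x%:C = 0) ->
  forall z, strip delta z -> H z = 0.
Proof.
move=> aH Hr [x y] /= xy.
have d0 : 0 < delta by exact: le_lt_trans xy.
pose p (t : R) : R[i] := x +i* (t * y).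
have np t t' : normc (p t - p t') = `|t - t'| * `|y|.
  have -> : p t - p t' = 0 +i* ((t - t') * y).
    by apply/eqP; rewrite eq_complex /= subrr mulrBl !eqxx.
  by rewrite /= expr0n add0r sqrtr_sqr normrM.
pose P := [set t : R | exists2 r : R, 0 < r &
  forall z, normc (z - p t) < r -> H z = 0].
have pS t : t \in `[0, 1] -> strip delta (p t).
  rewrite in_itv /= => /andP[t0 t1]; rewrite /strip /= normrM ger0_norm//.
  by apply: le_lt_trans xy; rewrite ler_piMl.
suff [r r0 Hz] : P 1.
  by have := Hz (x +i* y); rewrite /p mul1r subrr normc0; apply.
have I1 : `[0, 1]%classic (1 : R) by rewrite /= in_itv/= ler01 lexx.
have I0 : `[0, 1]%classic (0 : R) by rewrite /= in_itv/= ler01 lexx.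
suff PI : `[0, 1]%classic `&` P = `[0, 1]%classic :> set R.
  by have : `[0, 1]%classic (1 : R) := I1; rewrite -PI => -[].
have shift z (eta : R) : 0 < eta -> z + eta%:C != z /\ normc (z + eta%:C - z) = eta.
  move=> eta0; rewrite addrAC subrr add0r normc_real gtr0_norm//; split=> //.
  by rewrite -subr_eq0 addrAC subrr add0r -[0]/(0%:C) (inj_eq (@complexI _)) gt_eqF.
have cI : connected (`[0, 1]%classic : set R) by exact: segment_connected.
apply: cI.
- exists 0; split=> //; apply: (analytic_zero_near aH) => [|e e0].
    exact: pS.
  have e20 : 0 < e / 2 by rewrite divr_gt0.
  have [n1 n2] := shift (p 0) _ e20.
  exists (p 0 + (e / 2)%:C); split=> //.
    by rewrite n2 ltr_pdivrMr// ltr_pMr// ltr1n.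
  by rewrite /p mul0r complexr0 -rmorphD Hr.
- exists P => //; rewrite openE => t [r r0 Hz].
  pose e := r / 2 / (`|y| + 1).
  have e0 : 0 < e by rewrite !divr_gt0// ltr_wpDl.
  apply/nbhs_ballP; exists e => //= t'; rewrite /ball /= => tt'.
  exists (r / 2) => [|z zt']; first by rewrite divr_gt0.
  apply: Hz; rewrite (splitr r) -(subrK (p t') z) -addrA.
  apply: le_lt_trans (le_normcD _ _) _; apply: ltr_leD => //.
  rewrite np distrC; apply: le_trans (_ : e * `|y| <= _).
    by rewrite ler_wpM2r// ltW.
  rewrite /e mulrAC ler_pdivrMr ?ltr_wpDl//.
  by rewrite ler_wpM2l ?divr_ge0 ?ltW// ltrDl.
- exists (closure P); first exact: closed_closure.
  apply/seteqP; split=> t [It]; first by move=> Pt; split=> //; exact: subset_closure.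
  move=> cPt; split=> //; apply: (analytic_zero_near aH) => [|e e0].
    exact: pS.
  pose e' := e / 2 / (`|y| + 1).
  have e'0 : 0 < e' by rewrite !divr_gt0// ltr_wpDl.
  have [t' [[r r0 Hz] tt']] := cPt _ (nbhsx_ballx t e' e'0).
  pose eta := Num.min (r / 2) (e / 2).
  have eta0 : 0 < eta by rewrite lt_min !divr_gt0.
  have [n1 n2] := shift (p t') _ eta0.
  exists (p t' + eta%:C); split.
  + apply/eqP => /(congr1 (@complex.Re R)) /= /eqP.
    by rewrite -subr_eq0 addrC addKr gt_eqF.
  + rewrite (splitr e) -addrA (addrC eta%:C) addrA.
    apply: le_lt_trans (le_normcD _ _) _; apply: ltr_leD.
      rewrite np distrC; apply: le_lt_trans (_ : e' * `|y| < _).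
        by rewrite ler_wpM2r// ltW.
      rewrite /e' mulrAC ltr_pdivrMr ?ltr_wpDl//.
      by rewrite ltr_pM2l ?divr_gt0// ltrDl.
    by rewrite normc_real gtr0_norm// ge_min lexx orbT.
  + apply: Hz; rewrite n2; apply: le_lt_trans (_ : r / 2 < _).
      by rewrite ge_min lexx.
    by rewrite ltr_pdivrMr// ltr_pMr// ltr1n.
Qed.

End Analytic.

Section Comega.
Context {R : realType} (delta : {posnum R}).
Local Notation C := (R[i]^o).
Local Notation D := (strip delta%:num).

Definition continuation (f : R -> R) (F : R[i] -> C) :=
  analytic_on D F /\ forall x : R, F x%:C = (f x)%:C.

(* The continuation is defined on C but constrained only on the strip. *)
Definition Comega_set : {pred R -> R^o} := mem [set f : R -> R^o |
  periodic2pi f /\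
  exists2 F, continuation f F & exists M : R, forall z, D z -> normc (F z) <= M].

Record Comega := MkComega { Comega_fun :> R -> R^o;
                            ComegaP : Comega_fun \in Comega_set }.
HB.instance Definition _ := [isSub for Comega_fun].
HB.instance Definition _ := [Choice of Comega by <:].

Lemma continuation_lin (a : R) (f g : R -> R^o) F G :
  continuation f F -> continuation g G ->
  continuation (a *: f + g) (fun z => a%:C * F z + G z).
Proof.
move=> [aF Ff] [aG Gg]; split=> [|x]; first exact: analytic_lin.
by rewrite Ff Gg -rmorphM -rmorphD.
Qed.

Lemma continuation_unique f F G :
  continuation f F -> continuation f G -> forall z, D z -> F z = G z.
Proof.
move=> [aF Ff] [aG Gf] z Dz; apply/eqP; rewrite eq_sym -subr_eq0 -mulN1r addrC.
apply/eqP; apply: (analytic_strip_eq0 (analytic_lin (-1) aF aG)) Dz => x.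
by rewrite Ff Gf mulN1r addNr.
Qed.

Lemma Comega_submod_closed : submod_closed Comega_set.
Proof.
split.
  rewrite inE; split=> //; exists (fun=> 0).
    split=> // z0 _; exists (fun=> 0), 1 => // z _.
    have -> : series (fun n => 0 * (z - z0) ^+ n) = (fun=> 0 : C).
      by apply/funext => n; rewrite /series /= big1// => i _; rewrite mul0r.
    exact: cvg_cst.
  by exists 0 => z _; rewrite normc0.
move=> a f g; rewrite !inE => -[pf [F cF [M FM]]] [pg [G cG [N GN]]]; split.
  by move=> x; rewrite !fctE pf pg.
exists (fun z => a%:C * F z + G z); first exact: continuation_lin.
exists (`|a| * M + N) => z Dz; apply: le_trans (le_normcD _ _) _.
by rewrite lerD ?GN// normcM normc_real ler_wpM2l// FM.
Qed.

HB.instance Definition _ :=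
  GRing.isSubmodClosed.Build _ _ Comega_set Comega_submod_closed.
HB.instance Definition _ := [SubChoice_isSubLmodule of Comega by <:].

(* By continuation_unique the value on the strip does not depend on the choice
   made by get; see the_continuationE. *)
Definition the_continuation (f : R -> R) : R[i] -> C := get (continuation f).

Lemma the_continuationP (f : Comega) : continuation f (the_continuation f).
Proof.
have := ComegaP f; rewrite inE => -[_ [F cF _]].
exact: (@getPex _ (continuation f) (ex_intro _ F cF)).
Qed.

Lemma the_continuationE f F z : continuation f F -> D z ->
  the_continuation f z = F z.
Proof.
move=> cF; apply: (@continuation_unique f) => //.
exact: (@getPex _ (continuation f) (ex_intro _ F cF)).
Qed.

Definition Comega_norm (f : Comega) : R :=
  sup [set normc (the_continuation f z) | z in D].

Lemma Comega_norm_ubound (f : Comega) :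
  has_ubound [set normc (the_continuation f z) | z in D].
Proof.
have := ComegaP f; rewrite inE => -[_ [F cF [M FM]]].
by exists M => _ [z Dz <-]; rewrite (the_continuationE cF Dz) FM.
Qed.

Lemma Comega_normD (f g : Comega) :
  Comega_norm (f + g) <= Comega_norm f + Comega_norm g.
Proof.
apply: sup_normD; try by move=> z; exact: normc_ge0.
- exact: Comega_norm_ubound.
- exact: Comega_norm_ubound.
move=> z Dz; have := continuation_lin 1 (the_continuationP f) (the_continuationP g).
rewrite scale1r => /the_continuationE /(_ Dz) ->.
by rewrite mul1r; exact: le_normcD.
Qed.

Lemma Comega_normZ (c : R) (f : Comega) :
  Comega_norm (c *: f) = `|c| * Comega_norm f.
Proof.
apply: sup_normZ; try by move=> z; exact: normc_ge0.
  exact: Comega_norm_ubound.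
move=> z Dz; have := continuation_lin c (the_continuationP f) (the_continuationP 0).
rewrite addr0 => /the_continuationE /(_ Dz) ->.
have c0 : continuation (0 : R -> R^o) (fun=> 0).
  split=> // z0 _; exists (fun=> 0), 1 => // w _.
  have -> : series (fun n => 0 * (w - z0) ^+ n) = (fun=> 0 : C).
    by apply/funext => n; rewrite /series /= big1// => i _; rewrite mul0r.
  exact: cvg_cst.
by rewrite (the_continuationE c0 Dz) addr0 normcM normc_real.
Qed.

Lemma Comega_norm_eq0 (f : Comega) : Comega_norm f = 0 -> f = 0.
Proof.
move=> f0; apply/val_inj/funext => x /=; apply/eqP; rewrite -normr_le0.
rewrite -f0 -normc_real -(the_continuationP f).2.
by apply: (sup_norm_ub (Comega_norm_ubound f)); rewrite /strip /= normr0.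
Qed.

HB.instance Definition _ := @Lmodule_isNormed.Build R Comega
  Comega_norm Comega_normD Comega_normZ Comega_norm_eq0.

End Comega.

Section ClFamily.
Context {R : realType} (b l : nat) (V : normedModType R).
Implicit Types (f g : 'rV[R]_b -> V) (t : 'rV[R]_b) (i : 'I_b).

Definition cube : set 'rV[R]_b := [set t | forall i, 0 <= t ord0 i <= 1].

(* C^l maps on the closed cube: partial derivatives are limits of difference
   quotients along increments that stay in the cube, hence one-sided at the
   boundary. *)
Definition difference_quotient i f t (h : R) : V :=
  h^-1 *: (f (h *: delta_mx ord0 i + t) - f t).

Definition cube_dir i t : set_system R :=
  within [set h | cube (h *: delta_mx ord0 i + t)] 0^'.

Definition partially_derivable i f t :=
  cvg (difference_quotient i f t @ cube_dir i t).

Definition partial i f t : V := lim (difference_quotient i f t @ cube_dir i t).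

(* Iterated partial derivatives, indexed by words of directions.  For f in
   Cl_set they do not depend on the order of the letters (Schwarz), so words of
   size <= l give exactly the derivatives d^m f with |m| <= l. *)
Definition partials (s : seq 'I_b) f : 'rV[R]_b -> V := foldr partial f s.

(* A map on the cube is encoded by its extension by 0. *)
Definition Cl_set : {pred 'rV[R]_b -> V} := mem [set f |
  [/\ forall t, ~ cube t -> f t = 0,
      forall s i t, (size s < l)%N -> cube t ->
        partially_derivable i (partials s f) t &
      forall s, (size s <= l)%N -> {within cube, continuous (partials s f)}]].

Record Cl_family := MkClFamily { Cl_fun :> 'rV[R]_b -> V;
                                 Cl_familyP : Cl_fun \in Cl_set }.
HB.instance Definition _ := [isSub for Cl_fun].
HB.instance Definition _ := [Choice of Cl_family by <:].

#[local] Instance cube_dir_proper i t : cube t -> ProperFilter (cube_dir i t).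
Proof.
move=> ct; apply: Build_ProperFilter_ex => [P].
rewrite /cube_dir /within /= => /nbhs_ballP[e /= e0 eP].
have /andP[ti0 ti1] := ct i.
pose m := Num.min (e / 2) (2^-1).
have m0 : 0 < m by rewrite lt_min divr_gt0//= invr_gt0.
have me : m < e.
  by apply: le_lt_trans (_ : e / 2 < _); [rewrite ge_min lexx|move: e0; lra].
have m2 : m <= 2^-1 by rewrite ge_min lexx orbT.
have coord (h : R) j : (h *: delta_mx ord0 i + t) ord0 j =
    (if j == i then h else 0) + t ord0 j.
  by rewrite !mxE eqxx /= eq_sym; case: eqP => _; rewrite ?mulr1 ?mulr0.
pose h := if t ord0 i <= 2^-1 then m else - m.
have hn : `|h| = m by rewrite /h; case: ifP => _; rewrite ?normrN gtr0_norm.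
exists h; apply: eP.
- by rewrite /ball /= sub0r normrN hn.
- by rewrite -normr_gt0 hn.
- move=> j; rewrite coord; case: eqP => [->|_]; last by rewrite add0r.
  rewrite /h; case: ifPn => [|/negbTE]; first by move: m0 m2 ti0 ti1; lra.
  move=> /negbT; rewrite -ltNge; move: m0 m2 ti0 ti1; lra.
Qed.

Lemma difference_quotient_lin i (a : R) f g t :
  difference_quotient i (a *: f + g) t =
  a *: difference_quotient i f t + difference_quotient i g t.
Proof.
apply/funext => h; rewrite /difference_quotient !fctE scalerA [a * _]mulrC.
rewrite -scalerA -scalerDr; congr (_ *: _).
by rewrite scalerBr opprD addrACA.
Qed.

Lemma partially_derivable_lin i (a : R) f g t :
  partially_derivable i f t -> partially_derivable i g t ->
  partially_derivable i (a *: f + g) t.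
Proof.
rewrite /partially_derivable difference_quotient_lin => df dg.
by apply: is_cvgD => //; exact: is_cvgZr.
Qed.

Lemma partial_lin i (a : R) f g t : cube t ->
  partially_derivable i f t -> partially_derivable i g t ->
  partial i (a *: f + g) t = a *: partial i f t + partial i g t.
Proof.
move=> ct df dg; have := cube_dir_proper i ct => FF.
rewrite /partial difference_quotient_lin; apply: cvg_lim => //.
by apply: cvgD => //; exact: cvgZr.
Qed.

Lemma difference_quotient_eq i f g t : cube t ->
  (forall u, cube u -> f u = g u) ->
  {near cube_dir i t, difference_quotient i f t =1 difference_quotient i g t}.
Proof.
move=> ct fg; rewrite /cube_dir; near=> h.
have ch : cube (h *: delta_mx ord0 i + t) by near: h; exact: withinT.
by rewrite /difference_quotient !fg.
Unshelve. all: by end_near. Qed.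

Lemma partially_derivable_eq i f g t : cube t ->
  (forall u, cube u -> f u = g u) ->
  partially_derivable i f t -> partially_derivable i g t.
Proof.
move=> ct fg df; apply: cvgP; apply: cvg_trans df.
by apply: near_eq_cvg; exact: difference_quotient_eq.
Qed.

Lemma partial_eq i f g t : cube t -> (forall u, cube u -> f u = g u) ->
  partially_derivable i f t -> partial i f t = partial i g t.
Proof.
move=> ct fg df; have := cube_dir_proper i ct => FF.
apply/esym/cvg_lim => //; apply: cvg_trans df.
by apply: near_eq_cvg; exact: difference_quotient_eq.
Qed.

Lemma partials_lin (a : R) f g s : f \in Cl_set -> g \in Cl_set ->
  (size s <= l)%N -> forall t, cube t ->
  partials s (a *: f + g) t = a *: partials s f t + partials s g t.
Proof.
rewrite !inE => -[_ df _] [_ dg _].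
elim: s => [//|i s IH] sl t ct; rewrite /= -!/(partials s _).
have E u : cube u -> (a *: partials s f + partials s g) u = partials s (a *: f + g) u.
  by move=> cu; rewrite (IH (ltnW sl) u cu).
rewrite -(partial_eq ct E).
  by rewrite partial_lin//; [exact: df|exact: dg].
by apply: partially_derivable_lin; [exact: df|exact: dg].
Qed.

Lemma Cl_submod_closed : submod_closed Cl_set.
Proof.
split.
  have e s : forall t, cube t -> partials s 0 t = 0.
    elim: s => [//|i s IH] t ct; have := cube_dir_proper i ct => FF.
    rewrite /= -/(partials s _).
    have E u : cube u -> (0 : 'rV[R]_b -> V) u = partials s 0 u.
      by move=> cu; rewrite IH.
    have d0 : difference_quotient i (0 : 'rV[R]_b -> V) t = cst 0.
      by apply/funext => h; rewrite /difference_quotient subrr scaler0.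
    rewrite -(partial_eq ct E) /partially_derivable /partial d0.
      exact: lim_cst.
    exact: is_cvg_cst.
  rewrite inE; split=> [//|s i t _ ct|s _].
    apply: (@partially_derivable_eq i 0 _ t ct) => [u cu|]; first by rewrite e.
    have d0 : difference_quotient i (0 : 'rV[R]_b -> V) t = cst 0.
      by apply/funext => h; rewrite /difference_quotient subrr scaler0.
    by rewrite /partially_derivable d0; exact: is_cvg_cst.
  apply: (@subspace_eq_continuous _ _ _ (cst 0)).
    by move=> t; rewrite inE => ct; rewrite /from_subspace e.
  by apply: continuous_subspaceT; exact: cst_continuous.
move=> a f g fl gl; have lin := partials_lin a fl gl.
move: fl gl; rewrite !inE => -[f0 df cf] [g0 dg cg]; split.
- by move=> t ct; rewrite !fctE f0// g0// scaler0 addr0.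
- move=> s i t sl ct.
  apply: (@partially_derivable_eq i (a *: partials s f + partials s g)) => //.
    by move=> u cu; rewrite (lin s (ltnW sl) u cu).
  by apply: partially_derivable_lin; [exact: df|exact: dg].
- move=> s sl.
  apply: (@subspace_eq_continuous _ _ _ (a *: partials s f + partials s g)).
    by move=> t; rewrite inE => ct; rewrite /from_subspace (lin s sl t ct).
  move=> t; apply: cvgD; last exact: cg.
  by apply: cvgZr; exact: cf.
Qed.

HB.instance Definition _ :=
  GRing.isSubmodClosed.Build _ _ Cl_set Cl_submod_closed.
HB.instance Definition _ := [SubChoice_isSubLmodule of Cl_family by <:].

Definition Cl_norm (f : Cl_family) : R :=
  sup [set `|partials st.1 f st.2| |
       st in [set st : l.-bseq 'I_b * 'rV[R]_b | cube st.2]].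

Lemma cube_compact : compact cube.
Proof.
have -> : cube = [set v : 'rV[R]_b | forall i, `[0, 1]%classic (v ord0 i)].
  by apply/seteqP; split=> t ct i; have := ct i; rewrite /= in_itv.
have := @rV_compact R b (fun=> `[0, 1]%classic); apply => i.
exact: segment_compact.
Qed.

Lemma Cl_norm_ubound (f : Cl_family) :
  has_ubound [set `|partials st.1 f st.2| |
       st in [set st : l.-bseq 'I_b * 'rV[R]_b | cube st.2]].
Proof.
have /choice[M fM] : forall s : l.-bseq 'I_b, exists M,
    forall t, cube t -> `|partials s f t| <= M.
  move=> s; have := Cl_familyP f; rewrite inE => -[_ _ /(_ s (size_bseq s)) cf].
  have /compact_bounded[M [_ /(_ (M + 1))]] := continuous_compact cf cube_compact.
  rewrite ltrDl => /(_ ltr01) fM; exists (M + 1) => t ct.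
  by apply: fM; exists t.
exists (\sum_s `|M s|) => _ [[s t] /= ct <-].
rewrite (bigD1 s) //= -[leLHS]addr0 lerD ?sumr_ge0//.
by rewrite (le_trans (fM s t ct))// ler_norm.
Qed.

Lemma Cl_normD (f g : Cl_family) : Cl_norm (f + g) <= Cl_norm f + Cl_norm g.
Proof.
apply: sup_normD; rewrite //=; try exact: Cl_norm_ubound.
move=> [s t] /= ct; rewrite -[Cl_fun f]scale1r.
rewrite (partials_lin _ (Cl_familyP f) (Cl_familyP g) (size_bseq s) ct).
by rewrite !scale1r; exact: ler_normD.
Qed.

Lemma Cl_normZ (c : R) (f : Cl_family) : Cl_norm (c *: f) = `|c| * Cl_norm f.
Proof.
apply: sup_normZ; rewrite //=; try exact: Cl_norm_ubound.
move=> [s t] /= ct; rewrite -[_ *: Cl_fun f]addr0.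
have c0 : (0 : 'rV[R]_b -> V) \in Cl_set by exact: rpred0.
have z0 : partials s (0 : 'rV[R]_b -> V) t = 0.
  have := partials_lin (-1) c0 c0 (size_bseq s) ct.
  by rewrite scaler0 addr0 scaleN1r addNr.
by rewrite (partials_lin _ (Cl_familyP f) c0 (size_bseq s) ct) z0 addr0 normrZ.
Qed.

Lemma Cl_norm_eq0 (f : Cl_family) : Cl_norm f = 0 -> f = 0.
Proof.
move=> f0; apply/val_inj/funext => t /=.
have [ct|nct] := pselect (cube t); last first.
  by have := Cl_familyP f; rewrite inE => -[-> //].
apply/eqP; rewrite -normr_le0 -f0.
by apply: (sup_norm_ub (i := ([bseq], t)) (Cl_norm_ubound f)).
Qed.

HB.instance Definition _ := @Lmodule_isNormed.Build R Cl_family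
  Cl_norm Cl_normD Cl_normZ Cl_norm_eq0.

End ClFamily.

Section Generic.
Context {T : topologicalType}.
Implicit Types A : set T.

Definition nowhere_dense A := interior (closure A) = set0.

Definition residual A :=
  exists2 U : nat -> set T, (forall n, nowhere_dense (U n)) &
    A = ~` \bigcup_n U n.

Definition Baire_generic (P : set T) :=
  exists2 A : set T, residual A & A `<=` P.

End Generic.

Section Cyclicity.
Context {R : realType}.
Implicit Types (f G : R -> R) (r a rho : R) (O : set R).

(* The lift of x |-> x + 2 pi r + a f(x) mod 2 pi. *)
Definition circle_map f r a : R -> R := fun x => x + pi *+ 2 * r + a * f x.

(* Rotation number of the lift; read modulo 1 it is that of the circle map.
   Since circle_map f (r + m) a, m integer, lifts the same circle map as
   circle_map f r a, using R or R/Z as range yields the same B(F, rho). *)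
Definition has_rotation_number G rho :=
  forall x, (iter n G x - x) / (pi *+ 2 * n%:R) @[n --> \oo] --> rho.

Definition periodic_point G x :=
  exists q (p : int), (0 < q)%N /\ iter q G x = x + pi *+ 2 * p%:~R.

(* The preimage in R of the forward orbit on the circle; for a periodic point
   this is the whole trajectory. *)
Definition trajectory G x : set R :=
  [set y | exists n (p : int), y = iter n G x + pi *+ 2 * p%:~R].

Definition neighborhood O (e : R) : set R := \bigcup_(z in O) ball z e.

(* Asymptotic stability: Lyapunov stability and attraction of a neighborhood. *)
Definition attracting G O :=
  (forall e, 0 < e -> exists2 d, 0 < d &
     forall y n, neighborhood O d y -> neighborhood O e (iter n G y)) /\
  (exists2 d, 0 < d & forall y, neighborhood O d y ->
     forall e, 0 < e -> \forall n \near \oo, neighborhood O e (iter n G y)).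

Definition attracting_trajectories G : set (set R) :=
  [set O | (exists2 x, periodic_point G x & O = trajectory G x) /\
           attracting G O].

(* +oo when there are infinitely many *)
Definition num_attracting G : \bar R := counting (attracting_trajectories G).

(* For |a| small circle_map f r a is a circle diffeomorphism, so the limsup is
   not affected by the parameters for which it is not. *)
Definition cyclicity_at f rho : \bar R :=
  limf_esup (fun a1 : R => ereal_sup
    [set num_attracting (circle_map f ra.1 ra.2) | ra in [set ra : R * R |
       has_rotation_number (circle_map f ra.1 ra.2) rho /\ `|ra.2| < a1]])
    0^'+.

Definition finite_infinitesimal_cyclicity f :=
  exists M : R, forall rho, (cyclicity_at f rho <= M%:E)%E.

Definition infinite_infinitesimal_cyclicity f :=
  ~ finite_infinitesimal_cyclicity f.

End Cyclicity.

(* Main.v *)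
(* Let A_q f be the average of f over the rotations by 2 pi j/q.  For small a and
   r chosen so that the rotation number is 1/q, the q-th iterate of
   x + 2 pi r + a f(x) is x + 2 pi + a q (A_q f(x) - c) up to O(a^2); hence if
   A_q f - c changes sign 2K times in a period, this map has at least K
   attracting orbits.  A Sard-type argument on r removes degenerate fixed points.
   For each K, the families f for which some q works for all parameters t, with
   the same sign pattern, form an open set.  It is dense: f is approximated by
   f - T_q f + e cos(N q x), where the bounded operators T_q tend to 0 pointwise
   and A_q (f - T_q f) is constant on a grid.  In C^k, T_q f = A_q f - A_q f(0).
   In the analytic case, which has no uniform bound on A_q f - A_q f(0) in
   C^omega_delta, T_q f is the trigonometric polynomial with frequencies j q,
   0 < j <= N, interpolating A_q f at the points 2 pi i/((2N+1) q); it tends to 0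
   because e^(delta m) times its m-th coefficient is controlled by the
   Fourier coefficients of f on lines Im z = - eta near the boundary of the strip,
   which are square summable by Bessel's inequality. *)

Require Import Defs.
From mathcomp Require Import all_boot all_order all_algebra.
From mathcomp Require Import all_classical all_reals all_analysis.
From mathcomp Require Import complex ring lra zify.
Import Order.TTheory GRing.Theory Num.Theory.
Import numFieldNormedType.Exports Normc.
Local Open Scope classical_set_scope.
Local Open Scope ring_scope.

Set Implicit Arguments.
Unset Strict Implicit.
Unset Printing Implicit Defensive.

(** * Attracting orbits from oscillating averages *)

(** Oscillation of [A_q f] with a margin is a finite set of inequalities, which is why it is an open
    condition and why only a grid of nodes has to be controlled. The correction must be small in the
    C^l norm of the family. This is where linear operators come in: [T_q] applied for each t
    commutes with the derivatives in t, and a bound independent of q makes the convergence uniform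
    on the compact sets of values of these derivatives. The level c may then depend on t, while q,
    the nodes and the margin do not. The norm of C^omega_delta gives the frequency m the weight
    e^(delta m), and the plain coefficient estimate makes the weighted coefficients only bounded.
    They tend to 0 because, for fixed j, the frequencies j q are distinct for distinct q, so that
    Bessel's inequality applies across q. Contour integrals are replaced by means over grids, and
    holomorphy by estimates on second differences. *)

Section TaylorOne.
Context {R : realType}.
Implicit Types (F G D : R -> R) (L C x y z p : R).

(** A quantitative C^(1,1) condition: [D] is the derivative of [F], [L] bounds it and the Lipschitz
    constant, [C] bounds the first-order remainder. It is the only regularity that the dynamical
    part uses, so [Ck] and [Comega] share one argument. *)
Definition taylor1 F D L C := forall x y,
  [/\ `|F y - F x - D x * (y - x)| <= C * (y - x) ^+ 2,
      `|F y - F x| <= L * `|y - x| & `|D x| <= L].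

Lemma taylor1_comp F1 D1 L1 C1 F2 D2 L2 C2 : 0 <= C2 -> 0 <= L2 ->
  taylor1 F1 D1 L1 C1 -> taylor1 F2 D2 L2 C2 ->
  taylor1 (F2 \o F1) (fun x => D2 (F1 x) * D1 x)
    (L2 * L1) (C2 * L1 ^+ 2 + L2 * C1).
Proof.
move=> C20 L20 h1 h2 x y; have [a1 b1 c1] := h1 x y.
have [a2 b2 c2] := h2 (F1 x) (F1 y); split => /=.
- have -> : F2 (F1 y) - F2 (F1 x) - D2 (F1 x) * D1 x * (y - x) =
      (F2 (F1 y) - F2 (F1 x) - D2 (F1 x) * (F1 y - F1 x)) +
      D2 (F1 x) * (F1 y - F1 x - D1 x * (y - x)) by ring.
  apply: le_trans (ler_normD _ _) _; rewrite mulrDl lerD//.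
    apply: le_trans a2 _; rewrite -mulrA ler_wpM2l// -[leRHS]mulr1.
    rewrite -real_normK ?num_real//.
    rewrite -[X in _ <= X * _](_ : (L1 * `|y - x|) ^+ 2 = _); last first.
      by rewrite exprMn real_normK// num_real.
    by rewrite mulr1 lerXn2r// nnegrE// (le_trans _ b1).
  rewrite normrM -mulrA; apply: ler_pM => //.
- by apply: le_trans b2 _; rewrite -mulrA ler_wpM2l.
- by rewrite normrM; apply: ler_pM.
Qed.

Lemma taylor1_id : taylor1 (@id R) (fun=> 1) 1 0.
Proof.
by move=> x y; split; rewrite ?mul0r ?mul1r ?subrr ?normr0 ?normr1.
Qed.

(** [C'] is chosen before [F] and [D]: one constant then serves a whole family of maps, as
    [nondegenerate_level] requires. *)
Lemma taylor1_iter q L C : 0 <= L -> 0 <= C -> exists2 C', 0 <= C' &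
  forall F D, taylor1 F D L C -> exists D', taylor1 (iter q F) D' (L ^+ q) C'.
Proof.
move=> L0 C0; elim: q => [|q [C' C'0 IH]].
  by exists 0 => // F D _; exists (fun=> 1); rewrite expr0; exact: taylor1_id.
exists (C * (L ^+ q) ^+ 2 + L * C').
  by rewrite addr_ge0 ?mulr_ge0 ?exprn_ge0.
move=> F D hF; have [D' hq] := IH _ _ hF.
by exists (fun x => D (iter q F x) * D' x); rewrite exprS; apply: taylor1_comp.
Qed.

(* One-dimensional Sard lemma: two parameters with degenerate fixed points at
   distance d from each other differ by O(d^2). *)
Lemma nondegenerate_level (G D : R -> R -> R) L C a c1 c2 u v :
  0 < a -> c1 < c2 ->
  (forall c, taylor1 (G c) (D c) L C) ->
  (forall c c' x, c <= c' -> G c' x + a * (c' - c) <= G c x) ->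
  exists c, c1 <= c <= c2 /\
    forall x, u <= x <= v -> G c x = x -> D c x <> 1.
Proof.
move=> a0 c12 hG mG; apply: contrapT => /forallNP no.
(* For [v <= u] the window has at most one point. It would be fixed for both [c1] and [c2], against
   strict monotonicity in the parameter. *)
have [uv|vu] := ltP u v; last first.
  have [x [xu Gx Dx]] : exists x, [/\ u <= x <= v, G c1 x = x & D c1 x = 1].
    apply: contrapT => nx; apply: (no c1); rewrite lexx ltW//; split=> // x ux Gx Dx.
    by apply: nx; exists x.
  have [y [yu Gy Dy]] : exists x, [/\ u <= x <= v, G c2 x = x & D c2 x = 1].
    apply: contrapT => nx; apply: (no c2); rewrite lexx ltW//; split=> // y uy Gy Dy.
    by apply: nx; exists y.
  have xy : x = y by move: xu yu vu; lra.
  have := mG _ _ x (ltW c12); rewrite Gx xy Gy gerDl pmulr_rle0// subr_le0.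
  by rewrite leNgt c12.
have /choice[X XP] : forall c, exists x, c1 <= c <= c2 ->
    [/\ u <= x <= v, G c x = x & D c x = 1].
  move=> c; have [cc|] := boolP (c1 <= c <= c2); last by exists 0.
  apply: contrapT => /forallNP nx; apply: (no c); split=> // x ux Gx Dx.
  by apply: (nx x).
pose W := v - u; have W0 : 0 < W by rewrite subr_gt0.
pose E := c2 - c1; have E0 : 0 < E by rewrite subr_gt0.
(* Pigeonhole: n + 2 equally spaced parameters have their degenerate fixed points in n + 1 boxes of
   length W / n, the last of which only serves the endpoint [v]. Two points in one box force
   parameters within C (W / n)^2 / a of each other, less than the spacing E / (n + 1) by the choice
   of n. *)
pose n := (Num.truncn (C * W ^+ 2 * 2 / (a * E))).+1.
have n0 : 0 < n%:R :> R by rewrite ltr0n.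
have nbig : C * W ^+ 2 * 2 / (a * E) < n%:R by rewrite truncnS_gt.
pose r (i : 'I_n.+2) := c1 + E * (i%:R / n.+1%:R).
have n10 : 0 < n.+1%:R :> R by rewrite ltr0n.
have rI i : c1 <= r i <= c2.
  rewrite /r lerDl mulr_ge0 ?divr_ge0 ?ler0n ?(ltW E0)//=.
  rewrite -lerBrDl -/E ler_piMr ?(ltW E0)// ler_pdivrMr// mul1r ler_nat.
  by rewrite -ltnS ltn_ord.
pose k i := Num.truncn ((X (r i) - u) / W * n%:R).
have kn i : (k i < n.+1)%N.
  have [/andP[x1 x2] _ _] := XP _ (rI i).
  rewrite ltnS truncn_le_nat; apply: le_lt_trans (_ : n%:R < _); last by rewrite ltr_nat.
  by rewrite ler_piMl ?(ltW n0)// ler_pdivrMr// mul1r lerD2r.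
pose K i : 'I_n.+1 := Ordinal (kn i).
have /injectivePn[i [j ij /(congr1 val)/= kij]] : ~~ injectiveb K.
  by apply/negP => /injectiveP/leq_card; rewrite !card_ord ltnn.
wlog ltij : i j ij kij / (i < j)%N.
  move=> wl; have := ij; rewrite -val_eqE neq_ltn => /orP[lt|lt].
    exact: (wl i j).
  by apply: (wl j i) => //; rewrite eq_sym.
have [/andP[xi1 xi2] Gi Di] := XP _ (rI i).
have [/andP[xj1 xj2] Gj Dj] := XP _ (rI j).
have rij : E / n.+1%:R <= r j - r i.
  have -> : r j - r i = E * ((j%:R - i%:R) / n.+1%:R).
    by rewrite /r; field; rewrite gt_eqF.
  rewrite mulrA ler_wpM2r ?invr_ge0 ?(ltW n10)// ler_peMr ?(ltW E0)//.
  by rewrite -natrB ?(ltnW ltij)// ler1n subn_gt0.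
have rle : r i <= r j by rewrite -subr_ge0; apply: le_trans rij; rewrite divr_ge0// ltW.
(* At [X (r j)] the maps with parameters [r i] and [r j] differ by at least a (r j - r i), while
   degeneracy at [X (r i)] keeps the first one quadratically close to the identity. *)
have := mG _ _ (X (r j)) rle; rewrite Gj => h1.
have [h2 _ _] := hG (r i) (X (r i)) (X (r j)).
rewrite Gi Di mul1r in h2.
have close : `|X (r j) - X (r i)| * n%:R <= W.
  have t y : 0 <= y -> (Num.truncn y)%:R <= y < (Num.truncn y)%:R + 1.
    by move=> y0; rewrite natr1 truncn_itv.
  have p0 m : 0 <= (X (r m) - u) / W * n%:R.
    have [/andP[x1 _] _ _] := XP _ (rI m).
    apply: mulr_ge0 => //; apply: divr_ge0; last exact: ltW.
    by rewrite subr_ge0.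
  have := t _ (p0 i); have := t _ (p0 j); rewrite -/(k i) -/(k j) kij => tj ti.
  have : `|(X (r j) - u) / W * n%:R - (X (r i) - u) / W * n%:R| <= 1.
    by rewrite ler_norml; move: ti tj; lra.
  rewrite -!mulrBl (_ : X (r j) - u - (X (r i) - u) = X (r j) - X (r i)); last by ring.
  rewrite !normrM.
  rewrite (gtr0_norm n0) (@gtr0_norm _ W^-1) ?invr_gt0//.
  by rewrite mulrAC ler_pdivrMr// mul1r.
have h3 : a * (E / n.+1%:R) <= C * (X (r j) - X (r i)) ^+ 2.
  apply: le_trans (ler_wpM2l (ltW a0) rij) _.
  apply: le_trans (le_trans (ler_norm _) h2).
  by move: h1; lra.
have C0 : 0 <= C.
  have := hG 0 0 1; case => h _ _; have := le_trans (normr_ge0 _) h.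
  by rewrite subr0 expr1n mulr1.
have h4 : a * (E / n.+1%:R) <= C * (W ^+ 2 / n%:R ^+ 2).
  apply: le_trans h3 _; rewrite ler_wpM2l// -real_normK ?num_real//.
  rewrite -expr_div_n lerXn2r ?nnegrE ?divr_ge0 ?(ltW W0) ?(ltW n0)//.
  by rewrite ler_pdivlMr.
move: nbig; rewrite ltr_pdivrMr ?mulr_gt0// => nbig.
have n1 : n.+1%:R <= n%:R * 2 :> R by rewrite -natr1 mulr_natr mulr2n lerD2l ler1n.
suff : n%:R * (a * E) <= C * W ^+ 2 * 2 by rewrite leNgt nbig.
have h5 : a * E * n%:R ^+ 2 <= C * W ^+ 2 * n.+1%:R.
  rewrite -ler_pdivlMr ?exprn_gt0// mulrAC -ler_pdivrMr//.
  by rewrite -!mulrA in h4 *.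
have h6 : a * E * n%:R ^+ 2 <= C * W ^+ 2 * (n%:R * 2).
  by apply: le_trans h5 _; rewrite ler_wpM2l// mulr_ge0// exprn_ge0// ltW.
rewrite -(ler_pM2r n0); apply: le_trans (le_trans _ h6) _.
  by rewrite le_eqVlt; apply/orP; left; apply/eqP; ring.
by rewrite le_eqVlt; apply/orP; left; apply/eqP; ring.
Qed.

End TaylorOne.

(** * Attracting periodic orbits of monotone lifts of degree one *)

Section CircleLifts.
Context {R : realType}.
Implicit Types (F G D : R -> R) (L C x y z p : R).
Local Notation tau := (pi *+ 2 : R).

Lemma tau_gt0 : 0 < tau.
Proof. by rewrite mulrn_wgt0// pi_gt0. Qed.

Lemma crossing_fixed_point G D L C z z' :
  taylor1 G D L C -> {homo G : x y / x <= y} ->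
  z < z' -> z < G z -> G z' < z' ->
  (forall x, z <= x <= z' -> G x = x -> D x <> 1) ->
  exists p lam d, [/\ z < p < z', G p = p, 0 <= lam < 1, 0 < d &
    forall x, `|x - p| < d -> `|G x - p| <= lam * `|x - p|].
Proof.
move=> hG mG zz' Gz Gz' nd.
have C0 : 0 <= C.
  have := hG 0 1; case => h _ _; have := le_trans (normr_ge0 _) h.
  by rewrite subr0 expr1n mulr1.
pose S := [set x | z <= x <= z' /\ forall u, z <= u <= x -> u < G u].
have Sz : S z.
  by split=> [|u /le_anti<-//]; rewrite lexx ltW.
have Sub : ubound S z' by move=> x [/andP[]].
have hS : has_sup S by split; [exists z | exists z'].
pose p := sup S.
have zp : z <= p by apply: ub_le_sup => //; exists z'.
have pz' : p <= z' by apply: ge_sup => //; exists z.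
have below u : z <= u < p -> u < G u.
  move=> /andP[zu up]; have e0 : 0 < p - u by rewrite subr_gt0.
  have [x [xI xS] ux] := sup_adherent e0 hS.
  by apply: xS; rewrite zu ltW//; move: ux; rewrite /p opprB addrC subrK.
have pG : p <= G p.
  rewrite leNgt; apply/negP => Gp.
  have [zp'|zp'] := eqVneq z p; first by move: Gp Gz; rewrite zp'; lra.
  have ltzp : z < p by rewrite lt_neqAle zp'.
  pose u := Num.max z ((p + G p) / 2).
  have up : u < p by rewrite gt_max ltzp/=; move: Gp; lra.
  have := below u; rewrite le_max lexx up => /(_ isT) h.
  have := mG _ _ (ltW up); have : (p + G p) / 2 <= u by rewrite le_max lexx orbT.
  by move: h Gp; lra.
have Gp : G p = p.
  apply/eqP; rewrite eq_le pG andbT leNgt; apply/negP => pGp.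
  have pltz' : p < z'.
    rewrite lt_neqAle pz' andbT; apply/eqP => pz; move: pGp Gz'; rewrite pz; lra.
  pose x := Num.min z' ((p + G p) / 2).
  have px : p < x by rewrite lt_min pltz'/=; move: pGp; lra.
  have xG : x < G p by rewrite gt_min; apply/orP; right; move: pGp; lra.
  suff /(ub_le_sup (ex_intro _ _ Sub)) : S x by rewrite leNgt px.
  split; first by rewrite ge_min lexx andbT (le_trans zp)// ltW.
  move=> u /andP[zu ux]; have [up|pu] := ltP u p; first by apply: below; rewrite zu.
  by apply: lt_le_trans (mG _ _ pu); apply: le_lt_trans xG.
have zltp : z < p.
  by rewrite lt_neqAle zp andbT; apply/eqP => zp'; move: Gz; rewrite zp' Gp ltxx.
have pltz' : p < z'.
  by rewrite lt_neqAle pz' andbT; apply/eqP => zp'; move: Gz'; rewrite -zp' Gp ltxx.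
have tay h : `|G (p + h) - p - D p * h| <= C * h ^+ 2.
  by have [t _ _] := hG p (p + h); rewrite Gp [p + h - p]addrC addKr in t.
have C1 : 0 < C + 1 by rewrite ltr_wpDl.
have D1 : D p < 1.
  rewrite lt_neqAle; apply/andP; split.
    by apply/eqP; apply: nd => //; rewrite zp.
  rewrite leNgt; apply/negP => D1.
  pose h := Num.min (p - z) ((D p - 1) / (C + 1)).
  have h0 : 0 < h by rewrite lt_min subr_gt0 zltp divr_gt0// subr_gt0.
  have hz : h <= p - z by rewrite ge_min lexx.
  have hD : h * (C + 1) <= D p - 1 by rewrite -ler_pdivlMr// ge_min lexx orbT.
  have := below (p - h); rewrite lerBrDl -lerBrDr hz ltrBlDr ltrDl h0 => /(_ isT).
  have := tay (- h); rewrite ler_norml => /andP[_]; rewrite sqrrN expr2.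
  have : h * (h * (C + 1)) <= h * (D p - 1) by rewrite ler_pM2l.
  by have := mulr_gt0 h0 h0; lra.
have D0 : 0 <= D p.
  rewrite leNgt; apply/negP => D0.
  pose h := - D p / (C + 1).
  have h0 : 0 < h by rewrite divr_gt0// oppr_gt0.
  have hD : h * (C + 1) = - D p by rewrite /h mulfVK// gt_eqF.
  have := tay h; rewrite ler_norml => /andP[_]; rewrite expr2.
  have /mG : p <= p + h by rewrite lerDl ltW.
  rewrite Gp; have : h * (h * (C + 1)) = h * - D p by rewrite hD.
  by have := mulr_gt0 h0 h0; lra.
exists p, ((1 + D p) / 2), ((1 - D p) / 2 / (C + 1)); split=> //.
- by rewrite zltp.
- by move: D0 D1; lra.
- by rewrite !divr_gt0// subr_gt0.
move=> x; rewrite ltr_pdivlMr// => xd.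
have := tay (x - p); rewrite [p + _]addrC subrK => t.
have -> : G x - p = (G x - p - D p * (x - p)) + D p * (x - p) by rewrite subrK.
apply: le_trans (ler_normD _ _) _; rewrite normrM (ger0_norm D0).
apply: le_trans (lerD t (lexx _)) _; rewrite -real_normK ?num_real// expr2.
rewrite mulrA -mulrDl ler_wpM2r//.
by have := normr_ge0 (x - p); move: xd; lra.
Qed.

Section Degree1.
Variable F : R -> R.
Hypothesis F1 : forall x, F (x + tau) = F x + tau.

Lemma degree1_int (m : int) x : F (x + tau * m%:~R) = F x + tau * m%:~R.
Proof.
have := @periodic2pi_int R R (fun x => F x - x) _ m x => /(_ _)/wrap[].
  by move=> y; rewrite F1; ring.
by move/eqP; rewrite subr_eq => /eqP ->; ring.
Qed.

Lemma iter_degree1 n (m : int) x :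
  iter n F (x + tau * m%:~R) = iter n F x + tau * m%:~R.
Proof. by elim: n => //= n ->; exact: degree1_int. Qed.

Variables (q : nat) (p : R).
Hypotheses (q0 : (0 < q)%N) (Fp : iter q F p = p + tau).

Lemma iter_period n : iter n F p = iter (n %% q) F p + tau * (n %/ q)%:R.
Proof.
rewrite {1}(divn_eq n q); elim: (n %/ q)%N => [|k IH].
  by rewrite mul0n add0n mulr0 addr0.
rewrite mulSn -addnA addnC iterD Fp -[tau in LHS]mulr1 (iter_degree1 _ 1) IH.
by rewrite -natr1; ring.
Qed.

Lemma trajectory_mod z : trajectory F p z ->
  exists j (m : int), (j < q)%N /\ z = iter j F p + tau * m%:~R.
Proof.
move=> [n [m ->]]; exists (n %% q)%N, (m + (n %/ q)%:Z); rewrite ltn_mod q0.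
by split=> //; rewrite iter_period intrD; ring.
Qed.

Lemma iter_trajectory n z : trajectory F p z -> trajectory F p (iter n F z).
Proof.
move=> [k [m ->]]; exists (n + k)%N, m.
by rewrite iterD iter_degree1.
Qed.

(** Contraction at the single point [p] suffices. A point near the trajectory comes close to [p]
    modulo the period within q steps, is then contracted once per block of q steps, and ends with an
    incomplete block. The first and last passages cost a factor L^q each, whence the constant
    [M]. *)
Lemma trajectory_attracting L lam d : 1 <= L ->
  (forall x y, `|F y - F x| <= L * `|y - x|) -> 0 <= lam < 1 -> 0 < d ->
  (forall x, `|x - p| < d -> `|iter q F x - tau - p| <= lam * `|x - p|) ->
  attracting F (trajectory F p).
Proof.
move=> L1 FL /andP[lam0 lam1] d0 ctr.
have L0 : 0 < L by exact: lt_le_trans L1.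
have iL n x y : `|iter n F y - iter n F x| <= L ^+ n * `|y - x|.
  elim: n => [|n IH]; first by rewrite mul1r.
  by apply: le_trans (FL _ _) _; rewrite exprS -mulrA ler_pM2l.
have Lq j : (j <= q)%N -> L ^+ j <= L ^+ q by move=> jq; exact: ler_weXn2l.
have ctrk k x : `|x - p| < d ->
    `|iter (k * q) F x - tau * k%:R - p| <= lam ^+ k * `|x - p|.
  move=> xd; elim: k => [|k IH]; first by rewrite mulr0 subr0 mul1r.
  set x' := iter (k * q) F x - tau * k%:R in IH.
  have -> : iter (k.+1 * q) F x = iter q F x' + tau * k%:R.
    rewrite mulSn iterD -(iter_degree1 q k%:Z x') /x' ; congr (iter q F _).
    by rewrite subrK.
  have -> : iter q F x' + tau * k%:R - tau * k.+1%:R - p = iter q F x' - tau - p.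
    by rewrite -natr1; ring.
  apply: le_trans (ctr _ _) _.
    apply: le_lt_trans IH (le_lt_trans _ xd).
    by rewrite ler_piMl// exprn_ile1// ltW.
  by rewrite exprS -mulrA ler_wpM2l.
pose M := L ^+ q * L ^+ q.
have M1 : 1 <= M by rewrite mulr_ege1// exprn_ege1.
have M0 : 0 < M by exact: lt_le_trans M1.
have LqM : L ^+ q <= M by rewrite ler_peMr ?exprn_ege1// exprn_ge0// ltW.
(* The exponent is a lower bound for the number of complete blocks after up to q steps spent on
   reaching [p]. Truncated subtraction makes it 0 for times too short to get there. *)
have key y z n : trajectory F p z -> `|y - z| * M < d -> exists2 w,
    trajectory F p w & `|iter n F y - w| <= M * lam ^+ ((n - q) %/ q) * `|y - z|.
  move=> Oz yzd; have [j [m [jq zE]]] := trajectory_mod Oz.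
  have [nq|qn] := ltnP n (q - j).
    exists (iter n F z); first exact: iter_trajectory.
    have -> : (n - q = 0)%N.
      by apply/eqP; rewrite subn_eq0 (leq_trans (ltnW nq))// leq_subr.
    rewrite div0n mulr1; apply: le_trans (iL _ _ _) _; rewrite ler_wpM2r//.
    by apply: le_trans LqM; apply: Lq; exact: leq_trans (ltnW nq) (leq_subr _ _).
  pose y1 := iter (q - j) F y - tau * (m + 1)%:~R.
  have y1p : `|y1 - p| <= L ^+ q * `|y - z|.
    have -> : y1 - p = iter (q - j) F y - iter (q - j) F z.
      have -> : iter (q - j) F z = p + tau * (m + 1)%:~R.
        by rewrite zE iter_degree1 -iterD subnK ?(ltnW jq)// Fp intrD; ring.
      by rewrite /y1; ring.
    by apply: le_trans (iL _ _ _) _; rewrite ler_wpM2r// Lq// leq_subr.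
  have y1d : `|y1 - p| < d.
    by apply: le_lt_trans y1p (le_lt_trans _ yzd); rewrite mulrC ler_wpM2l.
  pose k := ((n - (q - j)) %/ q)%N; pose i := ((n - (q - j)) %% q)%N.
  have iq : (i < q)%N by rewrite ltn_mod.
  have nE : n = (i + (k * q + (q - j)))%N.
    by rewrite addnA [(i + _)%N]addnC -divn_eq subnK.
  exists (iter i F p + tau * (m + 1 + k%:Z)%:~R); first by exists i, (m + 1 + k%:Z).
  have -> : iter n F y = iter i F (iter (k * q) F y1 - tau * k%:R) +
      tau * (m + 1 + k%:Z)%:~R.
    rewrite -iter_degree1 [in LHS]nE !iterD; congr (iter i F _).
    have -> : iter (q - j) F y = y1 + tau * (m + 1)%:~R by rewrite subrK.
    by rewrite iter_degree1 [in RHS]intrD; ring.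
  rewrite opprD addrACA subrr addr0; apply: le_trans (iL _ _ _) _.
  rewrite /M -!mulrA; apply: ler_pM => //.
  - by rewrite exprn_ge0// ltW.
  - by rewrite Lq// ltnW.
  apply: le_trans (ctrk _ _ y1d) _; rewrite mulrCA; apply: ler_pM => //.
  - by rewrite exprn_ge0.
  - by rewrite ler_wiXn2l ?(ltW lam1)// leq_div2r// leq_sub2l// leq_subr.
split=> [e e0|].
  exists (Num.min e d / M) => [|y n [z Oz]]; first by rewrite divr_gt0// lt_min e0.
  rewrite /ball/= distrC ltr_pdivlMr// lt_min => /andP[ye yd].
  have [w Ow wy] := key y z n Oz yd; exists w => //; rewrite /ball/= distrC.
  apply: le_lt_trans wy (le_lt_trans _ ye); rewrite mulrC ler_wpM2l//.
  by rewrite ler_piMr ?(ltW M0)// exprn_ile1// ltW.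
exists (d / M) => [|y [z Oz]]; first by rewrite divr_gt0.
rewrite /ball/= distrC ltr_pdivlMr// => yd e e0.
have : lam ^+ n @[n --> \oo] --> 0 by apply: cvg_expr; rewrite ger0_norm.
move=> /cvgrPdist_lt /(_ (e / d) (divr_gt0 e0 d0)) [N _ lamN].
exists (q + N * q)%N => // n /= Nn; have [w Ow wy] := key y z n Oz yd.
exists w => //; rewrite /ball/= distrC; apply: le_lt_trans wy _.
rewrite mulrAC; apply: le_lt_trans (_ : d * lam ^+ ((n - q) %/ q) < _).
  by rewrite ler_wpM2r ?exprn_ge0// mulrC ltW.
rewrite mulrC -ltr_pdivlMr//.
have := lamN ((n - q) %/ q)%N; rewrite /= sub0r normrN ger0_norm ?exprn_ge0//; apply.
by rewrite leq_divRL// leq_subRL// (leq_trans _ Nn)// leq_addr.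
Qed.

(** The deviation of the n-th iterate of [p] from p + tau n / q is periodic in n, hence bounded by
    the sum [B0] over one period. Monotonicity squeezes any other orbit between those of two
    adjacent translates of [p], and division by n removes all bounded terms. *)
Lemma rotation_number_period : {homo F : x y / x <= y} ->
  has_rotation_number F q%:R^-1.
Proof.
move=> mF x.
have q0' : 0 < q%:R :> R by rewrite ltr0n.
have mi n : {homo iter n F : x y / x <= y} by elim: n => //= n IH y z /IH/mF.
pose B0 : R := \sum_(j < q) `|iter j F p - p - tau * (j%:R / q%:R)|.
have bp n : `|iter n F p - p - tau * (n%:R / q%:R)| <= B0.
  have nE : n%:R / q%:R = (n %/ q)%:R + (n %% q)%:R / q%:R :> R.
    by rewrite {1}(divn_eq n q) natrD natrM mulrDl mulfK ?gt_eqF.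
  rewrite iter_period nE.
  rewrite (_ : _ - _ - _ = iter (n %% q) F p - p - tau * ((n %% q)%N%:R / q%:R)); last by ring.
  rewrite /B0 (bigD1 (Ordinal (ltn_pmod n q0)))//= lerDl sumr_ge0//.
pose m := Num.floor ((x - p) / tau).
have m1 : p + tau * m%:~R <= x.
  by rewrite -lerBrDl mulrC -ler_pdivlMr ?tau_gt0// floor_le.
have m2 : x <= p + tau * (m + 1)%:~R.
  by rewrite -lerBlDl mulrC -ler_pdivrMr ?tau_gt0// ltW// floorD1_gt.
have bx n : `|iter n F x - x - tau * (n%:R / q%:R)| <= B0 + tau *+ 2.
  have := mi n _ _ m1; have := mi n _ _ m2; rewrite !iter_degree1.
  have := bp n; rewrite !ler_norml intrD.
  by move: m1 m2; rewrite intrD; have := tau_gt0; lra.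
apply/cvgrPdist_lt => e e0.
pose B := B0 + tau *+ 2.
near=> n.
have n0 : 0 < n%:R :> R by rewrite ltr0n; near: n; exists 1%N.
have tn : 0 < tau * n%:R by rewrite mulr_gt0 ?tau_gt0.
rewrite distrC.
have -> : (iter n F x - x) / (tau * n%:R) - q%:R^-1 =
    (iter n F x - x - tau * (n%:R / q%:R)) / (tau * n%:R).
  move: (tau) tau_gt0 => T T0; field.
  by rewrite !gt_eqF.
rewrite normrM normfV (gtr0_norm tn) ltr_pdivrMr//.
apply: le_lt_trans (bx n) _; rewrite mulrA -ltr_pdivrMl ?mulr_gt0 ?tau_gt0// mulrC.
near: n; exact: nbhs_infty_gtr.
Unshelve. all: by end_near. Qed.

End Degree1.

End CircleLifts.

(** * From sign changes of the rotation average to many attracting orbits *)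

Section Cyclicity.
Context {R : realType}.
Implicit Types (f h : R -> R).
Local Notation tau := (pi *+ 2 : R).

Definition rotation_average (q : nat) f x : R :=
  q%:R^-1 * \sum_(j < q) f (x + tau * (j%:R / q%:R)).

(** The width condition places all nodes within one period tau / q of the rotation average, so that
    orbits found between different pairs of nodes are distinct. The margin [eta] pays for
    perturbations of h and of the level. *)
Definition oscillates (q K : nat) h (z : nat -> R) (c eta : R) :=
  [/\ forall i j, (i < j < K.*2)%N -> z i < z j,
      forall i, (i < K.*2)%N -> z i - z 0%N < tau / q%:R &
      forall i, (i < K.*2)%N -> eta <= (-1) ^+ i * (h (z i) - c)].

Lemma counting_ge (T : choiceType) (A : set T) K (g : 'I_K -> T) :
  injective g -> (forall i, A (g i)) -> (K%:R%:E <= counting A :> \bar R)%E.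
Proof.
move=> gI Ag; rewrite /counting; case: asboolP => [fA|_]; last exact: leey.
rewrite lee_fin ler_nat -(size_enum_ord K) -(size_map g).
apply: uniq_leq_size; first by rewrite map_inj_uniq// enum_uniq.
by move=> _ /mapP[i _ ->]; rewrite in_fset_set// inE.
Qed.

Lemma sum_avg_err q f (F : R -> R) L e x :
  (0 < q)%N -> (forall x y, `|f y - f x| <= L * `|y - x|) -> 0 <= L ->
  (forall j, (j < q)%N -> `|iter j F x - x - tau * (j%:R / q%:R)| <= e) ->
  `|\sum_(j < q) f (iter j F x) - q%:R * rotation_average q f x| <= q%:R * (L * e).
Proof.
move=> q0 fL L0 Fe; rewrite /rotation_average mulVKf; last by rewrite pnatr_eq0 -lt0n.
rewrite -sumrB; apply: le_trans (ler_norm_sum _ _ _) _.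
rewrite [leRHS](_ : _ = \sum_(j < q) L * e); last first.
  by rewrite sumr_const card_ord mulr_natl.
apply: ler_sum => j _; apply: le_trans (fL _ _) _; rewrite ler_wpM2l//.
by rewrite opprD addrA Fe.
Qed.

Section OneMap.
Variables (f D : R -> R) (L C B : R) (q K : nat) (z : nat -> R) (c eta : R).
Hypotheses (pf : periodic2pi f) (hf : taylor1 f D L C) (fB : forall x, `|f x| <= B).
Hypotheses (q0 : (0 < q)%N) (K0 : (0 < K)%N) (eta0 : 0 < eta).
Hypothesis osc : oscillates q K (rotation_average q f) z c eta.
(** Of the smallness conditions, [aL] makes the lifts increasing, [aB] keeps the drift away from the
    rigid rotation from spoiling the signs in [osc], and [aW] keeps it below the part of a period
    tau / q that the nodes leave uncovered. [B'] bounds [f - c'] for all levels [c'] in use. *)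
Variable a : R.
Hypotheses (a0 : 0 < a) (aL : a * L <= 2^-1).
Let B' := B + `|c| + eta.
Hypothesis aB : a * L * q%:R * B' < eta / 2.
Let W := z K.*2.-1 - z 0%N.
Hypothesis aW : a * q%:R * B' < tau / q%:R - W.

(** The rotation parameter is replaced by the level [c']. The signs in [osc] survive for [c'] within
    eta / 2 of [c], which leaves an interval of levels for the Sard lemma. *)
Let F c' := circle_map f (q%:R^-1 - a * c' / tau) a.

Let L0 : 0 <= L. Proof. by have [_ _] := hf 0 0; exact: le_trans. Qed.
Let C0 : 0 <= C.
Proof.
have := hf 0 1; case => h _ _; have := le_trans (normr_ge0 _) h.
by rewrite subr0 expr1n mulr1.
Qed.
Let B0 : 0 <= B. Proof. exact: le_trans (normr_ge0 _) (fB 0). Qed.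
Let B'0 : 0 <= B'. Proof. by rewrite /B' !addr_ge0// ltW. Qed.
Let qR0 : 0 < q%:R :> R. Proof. by rewrite ltr0n. Qed.

Let FE c' x : F c' x = x + tau / q%:R + a * (f x - c').
Proof.
rewrite /F /circle_map; have := @tau_gt0 R; move: (tau) => T T0; field.
by rewrite !gt_eqF.
Qed.

Let F1 c' x : F c' (x + tau) = F c' x + tau.
Proof. by rewrite !FE pf; ring. Qed.

Let FL c' x y : `|F c' y - F c' x| <= (1 + a * L) * `|y - x|.
Proof.
have -> : F c' y - F c' x = (y - x) + a * (f y - f x) by rewrite !FE; ring.
apply: le_trans (ler_normD _ _) _; rewrite mulrDl mul1r lerD// normrM gtr0_norm//.
by rewrite -mulrA ler_pM2l//; have [] := hf x y.
Qed.

Let Fmono c' : {homo F c' : x y / x <= y}.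
Proof.
move=> x y xy; have [_ fL _] := hf x y.
move: fL; rewrite (@ger0_norm _ (y - x)) ?subr_ge0// ler_norml => /andP[fL _].
have h1 : a * - (L * (y - x)) <= a * (f y - f x) by rewrite ler_pM2l.
have h2 : (a * L) * (y - x) <= 2^-1 * (y - x) by rewrite ler_wpM2r// subr_ge0.
by rewrite !FE; lra.
Qed.

Let Ftaylor c' : taylor1 (F c') (fun x => 1 + a * D x) (1 + a * L) (a * C).
Proof.
move=> x y; have [h1 h2 h3] := hf x y; split; last first.
- apply: le_trans (ler_normD _ _) _; rewrite normr1 lerD2l normrM gtr0_norm//.
  by rewrite ler_pM2l.
- exact: FL.
rewrite (_ : _ - _ = a * (f y - f x - D x * (y - x))); last by rewrite !FE; ring.
by rewrite normrM gtr0_norm// -mulrA ler_pM2l.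
Qed.

Let iterE c' n x : iter n (F c') x =
  x + tau * (n%:R / q%:R) + a * (\sum_(j < n) f (iter j (F c') x) - n%:R * c').
Proof.
elim: n => [|n IH]; first by rewrite big_ord0/=; ring.
rewrite big_ord_recr /= FE -natr1 {1}IH.
by ring.
Qed.

Let near_c c' := `|c' - c| <= eta / 2.

Let iter_close c' n x : near_c c' -> (n <= q)%N ->
  `|iter n (F c') x - x - tau * (n%:R / q%:R)| <= a * q%:R * B'.
Proof.
move=> cc nq; have -> : iter n (F c') x - x - tau * (n%:R / q%:R) =
    a * \sum_(j < n) (f (iter j (F c') x) - c').
  by rewrite iterE sumrB sumr_const card_ord -[c' *+ n]mulr_natl; ring.
rewrite normrM gtr0_norm// -mulrA ler_pM2l//.
apply: le_trans (ler_norm_sum _ _ _) _.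
apply: le_trans (_ : \sum_(j < n) B' <= _); last first.
  by rewrite sumr_const card_ord -[B' *+ n]mulr_natl ler_wpM2r// ler_nat.
apply: ler_sum => j _.
have := fB (iter j (F c') x); have := cc; rewrite /near_c /B' !ler_norml.
by have := ler_norm c; have := lerNnormlW (lexx `|c|); have := eta0; lra.
Qed.

(** Of the margin [eta], the change of level uses at most one half, and the drift from the rigid
    rotation less than the other half by [aB]. *)
Let push c' i : near_c c' -> (i < K.*2)%N ->
  0 < (-1) ^+ i * (iter q (F c') (z i) - tau - z i).
Proof.
move=> cc iK; have [_ _ /(_ i iK) zi] := osc.
have := @sum_avg_err q f (F c') L (a * q%:R * B') (z i) q0.
case/(_ _ _ _)/wrap => [x y|//|j jq|].
- by have [] := hf x y.
- by apply: iter_close => //; exact: ltnW.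
rewrite iterE divff ?gt_eqF// mulr1.
set S := \sum_(j < q) _; set A := rotation_average q f (z i) in zi *.
rewrite (_ : _ - z i = a * (S - q%:R * c')); last by ring.
move=> Serr; rewrite mulrCA pmulr_rgt0//.
have h1 : q%:R * (L * (a * q%:R * B')) < q%:R * (eta / 2).
  by rewrite ltr_pM2l//; move: aB; lra.
have h2 : q%:R * eta <= q%:R * ((-1) ^+ i * (A - c)) by rewrite ler_pM2l.
have h3 : q%:R * `|c' - c| <= q%:R * (eta / 2) by rewrite ler_pM2l.
rewrite (_ : S - q%:R * c' =
  (S - q%:R * A) + q%:R * (A - c) - q%:R * (c' - c)); last by ring.
rewrite -signr_odd in h2 *; move: h2; case: (odd i); rewrite ?expr0 ?expr1.
  move: Serr h3; rewrite ler_norml => /andP[_ h5] h3.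
  have h4 : q%:R * - `|c' - c| <= q%:R * (c' - c) by rewrite ler_pM2l// lerNnormlW.
  by lra.
move: Serr h3; rewrite ler_norml => /andP[h5 _] h3.
have h4 : q%:R * (c' - c) <= q%:R * `|c' - c| by rewrite ler_pM2l// ler_norm.
by lra.
Qed.

Lemma attracting_orbits : exists r,
  has_rotation_number (circle_map f r a) q%:R^-1 /\
  (K%:R%:E <= num_attracting (circle_map f r a))%E.
Proof.
have L1 : 0 <= 1 + a * L by rewrite addr_ge0// mulr_ge0// ltW.
have [C' C'0 hC'] := taylor1_iter q L1 (mulr_ge0 (ltW a0) C0).
have /choice[D' hD'] := fun c' => hC' _ _ (@Ftaylor c').
pose G c' x := iter q (F c') x - tau.
have GC c' : taylor1 (G c') (D' c') ((1 + a * L) ^+ q) C'.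
  move=> x y; have [h1 h2 h3] := hD' c' x y.
  have GB : G c' y - G c' x = iter q (F c') y - iter q (F c') x by rewrite /G; ring.
  split=> //.
    by rewrite GB.
  by rewrite GB.
have imono c' n : {homo iter n (F c') : x y / x <= y}.
  by elim: n => //= n IH x y /IH; exact: Fmono.
have icmp c1 c2 n x : c1 <= c2 -> iter n (F c2) x <= iter n (F c1) x.
  move=> c12; elim: n => //= n IH; apply: le_trans (@Fmono c2 _ _ IH) _.
  by rewrite !FE lerD2l ler_pM2l// lerB.
(* The outermost application of [F] alone yields the gain a (c2 - c1); the inner ones only have to
   be ordered. *)
have Gcmp c1 c2 x : c1 <= c2 -> G c2 x + a * (c2 - c1) <= G c1 x.
  move=> c12; rewrite /G -(prednK q0) /= addrAC lerD2r.
  apply: le_trans (_ : F c1 (iter q.-1 (F c2) x) <= _); last by apply: Fmono; exact: icmp.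
  by rewrite !FE; lra.
have cc : c - eta / 2 < c + eta / 2 by have := eta0; lra.
have [c' [c'I nd]] := nondegenerate_level (z 0%N) (z K.*2.-1) a0 cc GC Gcmp.
have nc : near_c c' by rewrite /near_c ler_norml; move: c'I; lra.
have [zmono zwin _] := osc.
have zle i j : (i <= j < K.*2)%N -> z i <= z j.
  move=> /andP[]; rewrite leq_eqVlt => /predU1P[->//|ij] jK.
  by rewrite ltW// zmono// ij.
have K2 : (K.*2.-1 < K.*2)%N by rewrite prednK// double_gt0.
have iK (i : 'I_K) : (i.*2.+1 < K.*2)%N by rewrite ltn_Sdouble ltn_ord.
have fixp (i : 'I_K) : exists p lam d, [/\ z i.*2 < p < z i.*2.+1,
    G c' p = p, 0 <= lam < 1, 0 < d &
    forall x, `|x - p| < d -> `|G c' x - p| <= lam * `|x - p|].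
  apply: (crossing_fixed_point (GC c')).
  - by move=> x y xy; rewrite /G lerD2r imono.
  - by rewrite zmono// leqnn/=.
  - have := push nc (ltnW (iK i)); rewrite -signr_odd odd_double mul1r /G.
    by rewrite subr_gt0.
  - have := push nc (iK i); rewrite -signr_odd oddS odd_double expr1 mulN1r oppr_gt0.
    by rewrite subr_lt0.
  move=> x /andP[x1 x2]; apply: nd; apply/andP; split.
    by apply: le_trans x1; apply: zle; rewrite leq0n/= ltnW.
  apply: le_trans x2 _; apply: zle; rewrite K2 andbT.
  by rewrite -ltnS prednK ?double_gt0.
have /choice[p hp] := fixp.
exists (q%:R^-1 - a * c' / tau); rewrite -/(F c').
have Fp i : iter q (F c') (p i) = p i + tau.
  have [lam [d [_ Gp _ _ _]]] := hp i.
  by rewrite -[X in _ = X + _]Gp /G subrK.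
split.
  have h := @rotation_number_period R (F c') (F1 c') q (p (Ordinal K0)) q0 (Fp (Ordinal K0)).
  apply: h; exact: Fmono.
rewrite /num_attracting.
(* If [p j] lies on the trajectory of [p i], their difference is an integer multiple of tau / q up
   to the drift [e]. By [aW] that integer, n + m q, vanishes; since n < q also n = 0, so the drift
   is 0 and the two points coincide. *)
apply: (@counting_ge _ _ K (fun i => trajectory (F c') (p i))) => [i j tij|i].
  have : trajectory (F c') (p i) (p j).
    by rewrite tij; exists 0%N, 0; rewrite mulr0 addr0.
  move=> /(trajectory_mod (F1 c') q0 (Fp i))[n [m [nq pj]]].
  have [lam [d [/andP[pi1 pi2] _ _ _ _]]] := hp i.
  have [lam' [d' [/andP[pj1 pj2] _ _ _ _]]] := hp j.
  have zi0 (k : 'I_K) : z 0%N <= z k.*2 /\ z k.*2.+1 <= z K.*2.-1.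
    split; first by apply: zle; rewrite leq0n ltnW.
    by apply: zle; rewrite K2 andbT -ltnS prednK ?double_gt0.
  have [i1 i2] := zi0 i; have [j1 j2] := zi0 j.
  have dW : `|p j - p i| <= W by rewrite ler_norml /W; lra.
  have := iter_close (p i) nc (ltnW nq).
  set e := _ - _ - _ => he.
  have pjE : p j - p i = tau / q%:R * (n%:Z + m * q%:Z)%:~R + e.
    rewrite pj /e intrD intrM -!pmulrn; field.
    by rewrite gt_eqF.
  have nm0 : n%:Z + m * q%:Z = 0.
    apply/eqP; apply: contraT => nm.
    have t0 : 0 < tau / q%:R by rewrite divr_gt0 ?tau_gt0.
    have : tau / q%:R <= `|tau / q%:R * (n%:Z + m * q%:Z)%:~R|.
      by rewrite normrM (gtr0_norm t0) ler_peMr ?(ltW t0)// norm_intr_ge1// intr_eq0.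
    have -> : tau / q%:R * (n%:Z + m * q%:Z)%:~R = (p j - p i) - e by rewrite pjE addrK.
    move=> h; have := le_trans h (ler_normB _ _).
    by move: aW he dW; lra.
  have n0 : n = 0%N.
    move: nm0; case: (m) => k; last rewrite NegzE => /eqP.
      by rewrite -PoszM -PoszD => -[/eqP]; rewrite addn_eq0 => /andP[/eqP].
    rewrite mulNr subr_eq0 -PoszM => /eqP[nE]; move: nq; rewrite nE.
    by rewrite mulSn ltnNge leq_addr.
  have pij : p j = p i.
    apply/eqP; rewrite -subr_eq0 pjE nm0 mulr0 add0r /e n0 /=.
    by rewrite mul0r mulr0 subr0 subrr.
  apply/val_inj/eqP; rewrite eqn_leq; apply/andP; split; rewrite leqNgt; apply/negP => lt.
    have : z j.*2.+1 <= z i.*2 by apply: zle; rewrite ltn_double lt/= ltnW.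
    by move: pi1 pj2; rewrite pij; lra.
  have : z i.*2.+1 <= z j.*2 by apply: zle; rewrite ltn_double lt/= ltnW.
  by move: pj1 pi2; rewrite pij; lra.
have [lam [d [_ Gp lam1 d0 ctr]]] := hp i.
split; first by exists (p i) => //; exists q, 1; rewrite mulr1 Fp.
apply: (trajectory_attracting (L := 1 + a * L) (F1 c') q0 (Fp i) _ _ lam1 d0 ctr).
  by rewrite (lerDl 1) mulr_ge0// ltW.
by move=> x y; exact: FL.
Qed.

End OneMap.

Lemma oscillation_cyclicity f :
  periodic2pi f -> (exists D L C, taylor1 f D L C) -> (exists B, forall x, `|f x| <= B) ->
  (forall K, (0 < K)%N -> exists q z c eta, [/\ (0 < q)%N, 0 < eta &
     oscillates q K (rotation_average q f) z c eta]) ->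
  infinite_infinitesimal_cyclicity f.
Proof.
move=> pf [D [L [C hf]]] [B fB] osc [M hM].
pose K := (Num.truncn M).+1.
have MK : M < K%:R by rewrite truncnS_gt.
have [q [z [c [eta [q0 eta0 oz]]]]] := osc K isT.
(* The period q depends on [K] alone, so the rotation number 1 / q stays fixed while [a1] tends to
   0. *)
have := hM q%:R^-1; rewrite leNgt => /negP; apply.
apply: lt_le_trans (_ : (K%:R%:E <= _)%E); first by rewrite lte_fin.
apply: le_ereal_inf_tmp => _ [V V0 <-].
have [a1 [a10 Va1]] : exists a1 : R, 0 < a1 /\ V a1.
  by have [a1 [Va1 a10]] := filter_ex (filterI V0 (nbhs_right_gt 0)); exists a1.
apply: le_trans (ereal_sup_ubound _); last by exists a1.
have L0 : 0 <= L by have [_ _] := hf 0 0; exact: le_trans.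
have B0 : 0 <= B by exact: le_trans (normr_ge0 _) (fB 0).
have qR0 : 0 < q%:R :> R by rewrite ltr0n.
pose B' := B + `|c| + eta; have B'0 : 0 < B' by rewrite ltr_wpDl ?addr_ge0.
pose W := z K.*2.-1 - z 0%N.
have W0 : 0 < tau / q%:R - W.
  by have [_ h _] := oz; rewrite subr_gt0 h.
(* The first bound puts [a] below [a1], the others give the three smallness conditions of
   [attracting_orbits]; [L + 1] keeps the denominators positive. *)
pose a := Num.min (a1 / 2) (Num.min (2^-1 / (L + 1))
  (Num.min (eta / 2 / ((L + 1) * q%:R * B')) ((tau / q%:R - W) / 2 / (q%:R * B')))).
have L1 : 0 < L + 1 by rewrite ltr_wpDl.
have a0 : 0 < a.
  by rewrite !lt_min !divr_gt0// ?mulr_gt0.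
have [r [rot num]] : exists r, has_rotation_number (circle_map f r a) q%:R^-1 /\
    (K%:R%:E <= num_attracting (circle_map f r a))%E.
  apply: (attracting_orbits pf hf fB q0 _ eta0 oz a0) => //.
  - apply: le_trans (_ : a * (L + 1) <= _); first by rewrite ler_pM2l// lerDl.
    by rewrite -ler_pdivlMr// /a !ge_min lexx !orbT.
  - apply: lt_le_trans (_ : a * (L + 1) * q%:R * B' <= _).
      by rewrite !ltr_pM2r// ltr_pM2l// ltrDl.
    by rewrite -!mulrA -ler_pdivlMr ?mulr_gt0// /a !ge_min !mulrA lexx !orbT.
  - apply: le_lt_trans (_ : (tau / q%:R - W) / 2 < _); last first.
      by rewrite ltr_pdivrMr// ltr_pMr// ltr1n.
    by rewrite -mulrA -ler_pdivlMr ?mulr_gt0// /a !ge_min lexx !orbT.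
apply: le_trans num _; apply: ereal_sup_ubound; exists (r, a) => //=; split=> //.
rewrite gtr0_norm//; apply: le_lt_trans (_ : a1 / 2 < _); last by move: a10; lra.
by rewrite /a ge_min lexx.
Qed.

End Cyclicity.

(** * Generic families *)

Section FamilyOperators.
Context {R : realType} (b l : nat) (X : normedModType R).
Implicit Types (f g : 'rV[R]_b -> X) (t : 'rV[R]_b) (i : 'I_b) (s : seq 'I_b).
Local Notation cube := (@cube R b).
Local Notation ClX := (@Cl_set R b l X).

Section Operator.
Variables (T : X -> X) (C : R).
Hypothesis Tlin : forall (a : R) x y, T (a *: x + y) = a *: T x + T y.
Hypothesis TC : forall x, `|T x| <= C * `|x|.

Let T0 : T 0 = 0.
Proof. by apply/eqP; rewrite -normr_le0 (le_trans (TC _))// normr0 mulr0. Qed.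

Let TB x y : T (x - y) = T x - T y.
Proof. by rewrite addrC -scaleN1r Tlin scaleN1r addrC. Qed.

Let TZ a x : T (a *: x) = a *: T x.
Proof. by have := Tlin a x 0; rewrite T0 !addr0. Qed.

Lemma bounded_operator_continuous : continuous T.
Proof.
move=> x; apply/cvgrPdist_lt => e e0.
have C1 : 0 < `|C| + 1 by rewrite ltr_wpDl.
near=> y; rewrite -TB; apply: le_lt_trans (TC _) _.
apply: le_lt_trans (_ : (`|C| + 1) * `|x - y| < _).
  by rewrite ler_wpM2r// (le_trans (ler_norm _))// lerDl.
rewrite -ltr_pdivlMl//; near: y.
by apply: (@cvgr_dist_lt _ _ _ (nbhs x) _ id) => //; rewrite mulr_gt0// invr_gt0.
Unshelve. all: by end_near. Qed.

Lemma partial_operator i g t : cube t -> partially_derivable i g t ->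
  partially_derivable i (T \o g) t /\ partial i (T \o g) t = T (partial i g t).
Proof.
move=> ct dg; have FF := @cube_dir_proper R b i t ct.
have c : difference_quotient i (T \o g) t h @[h --> cube_dir i t] --> T (partial i g t).
  have -> : difference_quotient i (T \o g) t = T \o difference_quotient i g t.
    by apply/funext => h; rewrite /difference_quotient /= TZ TB.
  by apply: (cvg_comp _ _ dg); exact: bounded_operator_continuous.
split; first exact: cvgP c.
exact: cvg_lim c.
Qed.

Lemma partials_operator f s : f \in ClX -> (size s <= l)%N ->
  forall t, cube t -> partials s (T \o f) t = T (partials s f t).
Proof.
rewrite inE => -[_ df _]; elim: s => [//|i s IH] sl t ct.
have E u : cube u -> (T \o partials s f) u = partials s (T \o f) u.
  by move=> cu; rewrite IH// ltnW.
have [h1 h2] := partial_operator ct (df s i t sl ct).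
by rewrite /= -!/(partials s _) -(partial_eq ct E h1).
Qed.

Lemma Cl_operator f : f \in ClX -> T \o f \in ClX.
Proof.
move=> fl; have E := partials_operator fl; move: fl; rewrite !inE => -[f0 df cf].
split=> [t ct|s i t sl ct|s sl].
- by rewrite /= f0.
- have [h1 _] := partial_operator ct (df s i t sl ct).
  apply: partially_derivable_eq h1 => // u cu.
  by rewrite (E s (ltnW sl) u cu).
- apply: (@subspace_eq_continuous _ _ _ (T \o partials s f)).
    by move=> t; rewrite inE => ct; rewrite /from_subspace (E s sl t ct).
  move=> t; apply: (cvg_comp _ _ (cf s sl t)).
  exact: bounded_operator_continuous.
Qed.

Definition Cl_map (f : Cl_family b l X) : Cl_family b l X :=
  MkClFamily (Cl_operator (Cl_familyP f)).

End Operator.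

Definition constant_on_cube (p : X) t : X := if `[< cube t >] then p else 0.

Lemma Cl_constant p : constant_on_cube p \in ClX.
Proof.
have E0 t : cube t -> constant_on_cube p t = p.
  by rewrite /constant_on_cube => ct; case: asboolP.
have dc (q : X) i t : difference_quotient i (fun=> q) t = cst 0.
  by apply/funext => h; rewrite /difference_quotient subrr scaler0.
have pc (q : X) i t : cube t -> partially_derivable i (fun=> q) t /\
    partial i (fun=> q) t = 0.
  move=> ct; have FF := @cube_dir_proper R b i t ct.
  by rewrite /partially_derivable /partial dc; split; [exact: is_cvg_cst|exact: lim_cst].
have E s : exists q, forall t, cube t -> partials s (constant_on_cube p) t = q.
  elim: s => [|i s [q IH]]; first by exists p.
  exists 0 => t ct /=; rewrite -/(partials s _).
  have [h1 <-] := pc q i t ct; apply/esym/partial_eq => // u cu.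
  by rewrite IH.
rewrite inE; split=> [t ct|s i t sl ct|s sl].
- by rewrite /constant_on_cube; case: asboolP.
- have [q Eq] := E s; have [h1 _] := pc q i t ct.
  by apply: partially_derivable_eq h1 => // u cu; rewrite Eq.
- have [q Eq] := E s.
  apply: (@subspace_eq_continuous _ _ _ (cst q)).
    by move=> t; rewrite inE => ct; rewrite /from_subspace Eq.
  by apply: continuous_subspaceT; exact: cst_continuous.
Qed.

Definition Cl_cst p : Cl_family b l X := MkClFamily (Cl_constant p).

Lemma Cl_norm_ge (f : Cl_family b l X) t : cube t -> `|f t| <= `|f|.
Proof.
move=> ct; exact: (sup_norm_ub (i := ([bseq], t)) (Cl_norm_ubound f)).
Qed.

(** The common bound makes the operators equicontinuous, so pointwise convergence to 0 is uniform on
    the compact image of the cube under each derivative of [f]. There are finitely many words of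
    length at most l. *)
Lemma Cl_map_small (T : nat -> X -> X) (C : R)
    (Tlin : forall q (a : R) x y, T q (a *: x + y) = a *: T q x + T q y)
    (TC : forall q x, `|T q x| <= C * `|x|) :
  (forall x, T q x @[q --> \oo] --> (0 : X)) ->
  forall (f : Cl_family b l X) (e : R), 0 < e ->
  \forall q \near \oo, `|Cl_map (Tlin q) (TC q) f| <= e.
Proof.
move=> T0 f e e0.
have C1 : 0 < `|C| + 1 by rewrite ltr_wpDl.
have one (s : l.-bseq 'I_b) : \forall q \near \oo, forall t, cube t ->
    `|T q (partials s f t)| <= e.
  have := Cl_familyP f; rewrite inE => -[_ _ /(_ s (size_bseq s)) cf].
  have := @cube_compact R b; rewrite compact_near_coveringP => /near_covering_withinP cov.
  apply: (cov nat \oo (fun q t => `|T q (partials s f t)| <= e)) => t ct.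
  have e2 : 0 < e / 2 by rewrite divr_gt0.
  have e3 : 0 < e / 2 / (`|C| + 1) by rewrite divr_gt0.
  have /cvgrPdist_lt/(_ _ e2) h1 := T0 (partials s f t).
  have /cvgrPdist_lt/(_ _ e3) h2 := cf t.
  have {}h2 : \forall u \near within cube (nbhs t),
      `|partials s f t - partials s f u| < e / 2 / (`|C| + 1).
    by rewrite (nbhs_subspace_in ct).
  exists ([set u | cube u -> `|partials s f t - partials s f u| < e / 2 / (`|C| + 1)],
    [set q | `|0 - T q (partials s f t)| < e / 2]); first by split.
  move=> [u q] /= [hu hq] cu.
  have -> : T q (partials s f u) =
      T q (partials s f t) + (-1) *: T q (partials s f t - partials s f u).
    rewrite scaleN1r -[X in _ - T q X]addrC -[X in _ - T q (X + _)]scaleN1r Tlin.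
    by rewrite scaleN1r opprD opprK addrCA subrr addr0.
  apply: le_trans (ler_normD _ _) _; rewrite (splitr e) lerD//.
    by rewrite sub0r normrN in hq; exact: ltW.
  rewrite scaleN1r normrN; apply: le_trans (TC _ _) _.
  apply: le_trans (_ : (`|C| + 1) * (e / 2 / (`|C| + 1)) <= _).
    apply: le_trans (ler_wpM2r _ (_ : C <= `|C| + 1)) _ => //.
      by rewrite (le_trans (ler_norm _))// lerDl.
    by rewrite ler_pM2l// ltW// hu.
  by rewrite mulrC divfK// gt_eqF.
have all : \forall q \near \oo, forall s : l.-bseq 'I_b, forall t, cube t ->
    `|T q (partials s f t)| <= e by apply: filter_forall => s; exact: one.
apply: filterS all => q allq; apply: sup_norm_le => [|[s t] /= ct]; first exact: ltW.
have -> : partials s (T q \o f) t = T q (partials s f t).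
  by apply: (partials_operator (Tlin q) (TC q) (Cl_familyP f)) => //; exact: size_bseq.
exact: allq.
Qed.

End FamilyOperators.

(** * Open dense sets of families, for both function spaces at once *)

Section Genericity.
Context {R : realType} (b l : nat) (X : normedModType R) (ev : X -> R -> R).
Local Notation cube := (@cube R b).
Hypothesis ev_lin : forall (a : R) x y u, ev (a *: x + y) u = a * ev x u + ev y u.
Hypothesis ev_le : forall x u, `|ev x u| <= `|x|.

Lemma oscillates_perturb q K (x y : X) z c eta : (0 < q)%N ->
  oscillates q K (rotation_average q (ev x)) z c eta -> `|x - y| <= eta / 2 ->
  oscillates q K (rotation_average q (ev y)) z c (eta / 2).
Proof.
move=> q0 [z1 z2 osc] xy; split=> // i iK; have := osc i iK.
have q0' : 0 < q%:R :> R by rewrite ltr0n.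
have av : `|rotation_average q (ev x) (z i) - rotation_average q (ev y) (z i)| <= eta / 2.
  rewrite /rotation_average -mulrBr -sumrB normrM gtr0_norm ?invr_gt0//.
  rewrite ler_pdivrMl//; apply: le_trans (ler_norm_sum _ _ _) _.
  apply: le_trans (_ : \sum_(j < q) (eta / 2) <= _); last first.
    by rewrite sumr_const card_ord mulr_natl.
  apply: ler_sum => j _; apply: le_trans xy.
  have -> : forall u, ev x u - ev y u = ev (x - y) u; last exact: ev_le.
  by move=> u; rewrite addrC -mulN1r -ev_lin scaleN1r addrC.
move: av; rewrite ler_norml => /andP[h1 h2].
by rewrite -signr_odd; case: (odd i); rewrite ?expr0 ?expr1; lra.
Qed.

Hypothesis cyc : forall x, (forall K, (0 < K)%N -> exists q z c eta,
    [/\ (0 < q)%N, 0 < eta & oscillates q K (rotation_average q (ev x)) z c eta]) ->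
  infinite_infinitesimal_cyclicity (ev x).

(** [T q] removes the unknown part of the average at the nodes and [p q] supplies the oscillation.
    Nodes and margin depend on q but not on [x], so one choice serves every parameter of a family;
    only the level follows [x]. *)
Hypothesis ops : forall K, (0 < K)%N -> exists (T : nat -> X -> X) (C : R) (p : nat -> X),
  [/\ forall q (a : R) x y, T q (a *: x + y) = a *: T q x + T q y,
      forall q x, `|T q x| <= C * `|x|,
      forall x, T q x @[q --> \oo] --> (0 : X) &
      forall q, (0 < q)%N -> exists z eta, 0 < eta /\ forall x e, 0 < e -> exists c,
        oscillates q K (rotation_average q (ev (x - T q x + e *: p q))) z c (e * eta)].

(** The margin is chosen before t, which makes the set open. The level is chosen after t, and no
    continuity in t is asked of it. *)
Let U K : set (Cl_family b l X) := [set f | exists q z eta,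
  [/\ (0 < q)%N, 0 < eta & forall t, cube t -> exists c,
    oscillates q K.+1 (rotation_average q (ev (f t))) z c eta]].

Let U_open K : open (U K).
Proof.
rewrite openE => f [q [z [eta [q0 eta0 osc]]]].
apply/nbhs_ballP; exists (eta / 2) => /=; first by rewrite divr_gt0.
move=> g fg; exists q, z, (eta / 2); split=> //; first by rewrite divr_gt0.
move=> t ct; have [c oc] := osc t ct; exists c.
apply: oscillates_perturb oc _ => //.
apply: le_trans (Cl_norm_ge (f - g) ct) _.
by move: fg; rewrite -ball_normE => /ltW.
Qed.

Let U_dense K (f : Cl_family b l X) e : 0 < e -> exists2 g, U K g & `|f - g| < e.
Proof.
move=> e0; have [T [C [p [Tlin TC T0 osc]]]] := ops (ltn0Sn K).
have e2 : 0 < e / 2 by rewrite divr_gt0.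
have [N _ TN] := Cl_map_small Tlin TC T0 f e2.
pose q := N.+1; have Tq := TN q (leqnSn N).
have [z [eta [eta0 oz]]] := osc q isT.
pose P := Cl_cst b l (p q).
pose d := e / 2 / (`|P| + 1).
have P1 : 0 < `|P| + 1 by rewrite ltr_wpDl.
have d0 : 0 < d by rewrite divr_gt0.
exists (f - Cl_map (Tlin q) (TC q) f + d *: P).
  exists q, z, (d * eta); split=> //; first by rewrite mulr_gt0.
  move=> t ct; have [c oc] := oz (f t) d d0; exists c.
  have -> // : (f - Cl_map (Tlin q) (TC q) f + d *: P) t = f t - T q (f t) + d *: p q.
  have -> : p q = constant_on_cube (p q) t by rewrite /constant_on_cube asboolT.
  by [].
rewrite opprD opprB addrA addrCA subrr addr0.
apply: le_lt_trans (ler_normB _ _) _.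
rewrite (splitr e) ler_ltD//= normrZ gtr0_norm// /d.
by rewrite mulrAC ltr_pdivrMr// ltr_pM2l// ltrDl.
Qed.

Lemma Baire_generic_cyclicity :
  Baire_generic [set f : Cl_family b l X |
    forall t, cube t -> infinite_infinitesimal_cyclicity (ev (f t))].
Proof.
exists (~` \bigcup_K ~` U K).
  exists (fun K => ~` U K) => // K; rewrite /nowhere_dense.
  rewrite -(closure_id _).1; last exact/open_closedC.
  apply/seteqP; split=> // f; rewrite /interior => /nbhs_ballP[e /= e0 fe].
  have [g gU fg] := U_dense K f e0.
  by apply: (fe g) => //; rewrite -ball_normE.
move=> f fU t ct; apply: cyc => -[//|K] _.
have : U K f by apply: contrapT => nU; apply: fU; exists K.
move=> [q [z [eta [q0 eta0 osc]]]]; have [c oc] := osc t ct.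
by exists q, z, c, eta.
Qed.

End Genericity.

(** * Finite smoothness *)

Section Averages.
Context {R : realType}.
Implicit Types (f g h : R -> R).
Local Notation tau := (pi *+ 2 : R).

Lemma rotation_average_periodic q g x : (0 < q)%N -> periodic2pi g ->
  rotation_average q g (x + tau / q%:R) = rotation_average q g x.
Proof.
case: q => // q _ pg; rewrite /rotation_average; congr (_ * _).
rewrite big_ord_recr big_ord_recl /= addrC mul0r mulr0 addr0; congr (_ + _).
  rewrite -(pg x); congr g.
  rewrite -addrA; congr (_ + _); rewrite -mulrDr -[RHS]mulr1; congr (_ * _).
  by rewrite -[X in X + _]mul1r -mulrDl addrC natr1 divff.
apply: eq_bigr => i _; congr g; rewrite -addrA; congr (_ + _).
have -> : (bump 0 i)%:R = i%:R + 1 :> R by rewrite /bump add1n natr1.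
by rewrite (mulrDl i%:R) mul1r mulrDr addrC.
Qed.

Lemma period_nat h d n x : (forall y, h (y + d) = h y) -> h (x + d * n%:R) = h x.
Proof.
move=> hd; elim: n => [|n IH]; first by rewrite mulr0 addr0.
by rewrite -natr1 mulrDr mulr1 addrA hd.
Qed.

Lemma period_int h d (m : int) x : (forall y, h (y + d) = h y) -> h (x + d * m%:~R) = h x.
Proof.
move=> hd; case: m => n; first exact: period_nat.
by rewrite NegzE -(@period_nat h d n.+1 (x + _))// -addrA -mulrDr addNr mulr0 addr0.
Qed.

Lemma rotation_average_id q h x : (0 < q)%N ->
  (forall y, h (y + tau / q%:R) = h y) -> rotation_average q h x = h x.
Proof.
move=> q0 hq; rewrite /rotation_average.
under eq_bigr => j _.
  rewrite [j%:R / _]mulrC mulrA (period_nat _ _ hq); over.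
by rewrite sumr_const card_ord -[h x *+ q]mulr_natl mulKf// pnatr_eq0 -lt0n.
Qed.

Lemma period_representative (d x : R) : 0 < d -> exists m : int, 0 <= x + d * m%:~R < d.
Proof.
move=> d0; exists (- Num.floor (x / d)).
have /andP[h1 h2] := floor_itv (x / d); rewrite mulrNz mulrN.
move: h1 h2; rewrite ler_pdivlMr// ltr_pdivrMr// intrD mulrDl mul1r [d * _]mulrC.
by lra.
Qed.

Lemma periodic_uniform_continuous g : periodic2pi g -> continuous (g : R -> R^o) ->
  forall e, 0 < e -> exists2 d, 0 < d & forall u v, `|u - v| < d -> `|g u - g v| < e.
Proof.
move=> pg cg e e0.
have := @segment_compact R 0 tau; rewrite compact_near_coveringP => cov.
have near : \forall d \near 0^'+, `[0, tau]%classic `<=`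
    [set u | forall v, `|u - v| < d -> `|g u - g v| < e].
  apply: (cov R 0^'+ (fun d u => forall v, `|u - v| < d -> `|g u - g v| < e)) => u _.
  have e2 : 0 < e / 2 by rewrite divr_gt0.
  have /cvgrPdist_lt/(_ _ e2)/nbhs_ballP[r /= r0 hr] := cg u.
  exists (ball u (r / 2), [set d | d < r / 2]).
    split; first by apply: nbhsx_ballx; rewrite divr_gt0.
    by apply: nbhs_right_lt; rewrite divr_gt0.
  move=> [u' d] /= [uu' dr] v u'v.
  have h1 : `|g u - g u'| < e / 2.
    by apply: hr; apply: le_ball uu'; rewrite ler_pdivrMr// ler_peMr ?ler1n// ltW.
  have h2 : `|g u - g v| < e / 2.
    apply: hr; rewrite /ball/= in uu' *; have := ler_distD u' u v.
    by move: u'v dr uu'; lra.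
  by have := ler_distD (g u) (g u') (g v); rewrite [`|g u' - g u|]distrC; move: h1 h2; lra.
have [d [hd d0]] := filter_ex (filterI near (nbhs_right_gt 0)).
exists d => // u v uv.
have [m /andP[m1 m2]] := @period_representative tau u (tau_gt0).
rewrite -(period_int m u pg) -(period_int m v pg); apply: hd => /=.
- by rewrite in_itv/= m1 ltW.
- by rewrite opprD addrACA subrr addr0.
Qed.

Lemma rotation_average_osc q g e d : (0 < q)%N ->
  (forall u v, `|u - v| < d -> `|g u - g v| < e) ->
  forall u v, `|u - v| < d -> `|rotation_average q g u - rotation_average q g v| <= e.
Proof.
move=> q0 gd u v uv; have q0' : 0 < q%:R :> R by rewrite ltr0n.
rewrite /rotation_average -mulrBr -sumrB normrM gtr0_norm ?invr_gt0//.
rewrite ler_pdivrMl//; apply: le_trans (ler_norm_sum _ _ _) _.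
apply: le_trans (_ : \sum_(j < q) e <= _); last first.
  by rewrite sumr_const card_ord mulr_natl.
by apply: ler_sum => j _; apply/ltW/gd; rewrite opprD addrACA subrr addr0.
Qed.

(* At the first nodes of a grid of 2N+1 points cos(N x) alternates in sign. *)
Lemma cos_grid (N i : nat) : (i < N)%N ->
  cos (pi / N.*2.+1%:R * N%:R) <=
  (-1) ^+ i * cos (N%:R * (tau * (i%:R / N.*2.+1%:R))) :> R.
Proof.
move=> iN; have n0 : 0 < N.*2.+1%:R :> R by rewrite ltr0n.
have nE : N.*2.+1%:R = N%:R * 2 + 1 :> R by rewrite -natr1 -muln2 natrM.
have -> : N%:R * (tau * (i%:R / N.*2.+1%:R)) = - (pi / N.*2.+1%:R * i%:R) + pi *+ i :> R.
  by rewrite -mulr_natr -[pi *+ i]mulr_natr nE; field; rewrite -nE gt_eqF.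
have cosn x : cos (x + pi *+ i) = (-1) ^+ i * cos x :> R.
  elim: (i) x => [|j IH] x; first by rewrite addr0 mul1r.
  by rewrite mulrSr addrA cosDpi IH exprS mulN1r mulNr.
rewrite cosn mulrA -expr2 -exprM mulnC exprM sqrrN !expr1n mul1r cosN.
have pn : 0 <= pi / N.*2.+1%:R :> R by rewrite divr_ge0 ?pi_ge0 ?ltW.
have I j : (j <= N)%N -> pi / N.*2.+1%:R * j%:R \in `[0, pi : R].
  move=> jN; rewrite in_itv/= mulr_ge0//= -mulrA ler_piMr ?pi_ge0//.
  rewrite mulrC ler_pdivrMr// mul1r ler_nat.
  by rewrite (leq_trans jN)// -addnn leqW// leq_addr.
rewrite leNgt ltr_cos ?I// ?(ltnW iN)// -leNgt ler_wpM2l// ler_nat ltnW//.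
Qed.

Lemma cos_grid_gt0 N : 0 < cos (pi / N.*2.+1%:R * N%:R) :> R.
Proof.
have n0 : 0 < N.*2.+1%:R :> R by rewrite ltr0n.
apply: cos_gt0_pihalf; apply/andP; split.
  apply: lt_le_trans (_ : 0 <= _); first by rewrite oppr_lt0 divr_gt0 ?pi_gt0.
  by rewrite mulr_ge0 ?divr_ge0 ?pi_ge0.
rewrite -mulrA ltr_pM2l ?pi_gt0// mulrC ltr_pdivrMr// ltr_pdivlMl//.
by rewrite -natrM ltr_nat mul2n ltnS.
Qed.

(** From one node to the next the phase advances by pi less pi / (2 N + 1). Using N of the 2 N + 1
    nodes in a period tau / q keeps the accumulated lag below pi / 2, hence the cosine away from
    0. *)
Lemma oscillates_grid q K h (c e : R) : (0 < q)%N -> (0 < K)%N -> 0 < e ->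
  let N := K.*2 in let z i : R := tau * (i%:R / (N.*2.+1 * q)%:R) in
  (forall i, (i <= N)%N -> h (z i) = c + e * cos ((N * q)%:R * z i)) ->
  oscillates q K h z c (e * cos (pi / N.*2.+1%:R * N%:R)).
Proof.
move=> q0 K0 e0 N z hz.
have n0 : 0 < (N.*2.+1 * q)%:R :> R by rewrite ltr0n muln_gt0.
have qR0 : 0 < q%:R :> R by rewrite ltr0n.
split=> [i j /andP[ij _]|i iN|i iN].
- by rewrite /z ltr_pM2l ?tau_gt0// ltr_pM2r ?invr_gt0// ltr_nat.
- rewrite /z mul0r mulr0 subr0 ltr_pM2l ?tau_gt0// natrM invfM mulrA.
  rewrite [ltRHS](_ : _ = 1 / q%:R) ?ltr_pM2r ?invr_gt0// ?mul1r//.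
  rewrite ltr_pdivrMr ?ltr0n// mul1r ltr_nat.
  by rewrite ltnS -addnn (leq_trans (ltnW iN))// leq_addr.
rewrite hz; last exact: ltnW.
rewrite addrC addrA addNr add0r mulrCA ler_pM2l//.
have -> : (N * q)%:R * z i = N%:R * (tau * (i%:R / N.*2.+1%:R)).
  by rewrite /z !natrM; field; rewrite !gt_eqF// ltr0n.
exact: cos_grid.
Qed.

End Averages.

Section CkFamilies.
Context {R : realType} (k : nat).
Implicit Types (f g : Ck R k).
Local Notation tau := (pi *+ 2 : R).
Local Notation d i f := (derive1n i (f : R -> R^o)).

Lemma Ck_norm_ge i f x : (i <= k)%N -> `|d i f x| <= `|f|.
Proof. by move=> ik; apply: (sup_norm_ub (i := (i, x)) (Ck_norm_ubound f)). Qed.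

Lemma Ck_norm_le f M : 0 <= M -> (forall i x, (i <= k)%N -> `|d i f x| <= M) -> `|f| <= M.
Proof. by move=> M0 fM; apply: sup_norm_le => // -[i x] /= ik; exact: fM. Qed.

Lemma Ck_derive_lin i (a : R) f g x : (i <= k)%N ->
  d i (a *: f + g) x = a * d i f x + d i g x.
Proof.
by move=> ik; have := Ck_deriv_lin a (CkP f) (CkP g) ik => /(congr1 (fun h => h x)).
Qed.

Lemma Ck_derive0 i x : (i <= k)%N -> d i (0 : Ck R k) x = 0.
Proof.
by move=> ik; apply/eqP; rewrite -normr_le0 -(normr0 (Ck R k)); exact: Ck_norm_ge.
Qed.

Lemma Ck_deriveZ i (a : R) f x : (i <= k)%N -> d i (a *: f) x = a * d i f x.
Proof. by move=> ik; rewrite -[a *: f]addr0 Ck_derive_lin// Ck_derive0// addr0. Qed.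

Lemma Ck_derive_sum i n (F : nat -> Ck R k) x : (i <= k)%N ->
  d i (\sum_(j < n) F j) x = \sum_(j < n) d i (F j) x.
Proof.
move=> ik; elim: n => [|n IH]; first by rewrite !big_ord0 Ck_derive0.
have -> : \sum_(j < n.+1) F j = 1 *: \sum_(j < n) F j + F n by rewrite big_ord_recr scale1r.
by rewrite Ck_derive_lin// IH mul1r big_ord_recr.
Qed.

Lemma derive1n_shift (h : R -> R^o) i s x :
  derive1n i (fun y => h (y + s) : R^o) x = derive1n i h (x + s).
Proof.
elim: i x => [//|i IH] x; rewrite !derive1nS.
have -> : derive1n i (fun y => h (y + s) : R^o) = (fun y => derive1n i h (y + s)).
  exact/funext.
by rewrite /derive1; under eq_fun do rewrite -addrA.
Qed.

Lemma derivable_shift (h : R -> R^o) s x : derivable h (x + s) 1 ->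
  derivable (fun y => h (y + s) : R^o) x 1.
Proof. by rewrite /derivable /=; under [in X in _ -> X]eq_fun do rewrite /= -addrA. Qed.

Lemma Ck_shift_subproof f s : (fun x => f (x + s) : R^o) \in @Ck_set R k.
Proof.
have := CkP f; rewrite !inE => -[pf df cf]; split.
- by move=> x; rewrite addrAC pf.
- move=> i x ik; have -> : derive1n i (fun y => f (y + s) : R^o) =
      (fun y => derive1n i (f : R -> R^o) (y + s)) by apply/funext => y; exact: derive1n_shift.
  by apply: derivable_shift; exact: df.
- have -> : derive1n k (fun y => f (y + s) : R^o) =
      (fun y => derive1n k (f : R -> R^o) (y + s)) by apply/funext => y; exact: derive1n_shift.
  move=> x; apply: (@continuous_comp _ _ _ (fun y => y + s)); last exact: cf.
  by apply: cvgD => //; exact: cvg_cst.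
Qed.

Definition Ck_shift f s : Ck R k := MkCk (Ck_shift_subproof f s).

Lemma derive1n_cos (m : R) i :
  derive1n i (fun x => cos (m * x) : R^o) = (fun x => m ^+ i * cos (m * x + pi / 2 *+ i) : R^o).
Proof.
elim: i => [|i IH]; first by apply/funext => x; rewrite derive1n0 expr0 mul1r addr0.
rewrite derive1nS IH; apply/funext => x; rewrite derive1E.
have h : is_derive x 1 (fun x => m * x + pi / 2 *+ i : R^o) m.
  by apply: is_derive_eq; rewrite addr0 -[LHS]/(m * 1) mulr1.
have h1 := @is_derive1_comp R cos (fun x => m * x + pi / 2 *+ i) x _ _
  (is_derive_cos (m * x + pi / 2 *+ i)) h.
have h2 : is_derive x 1 (fun x => m ^+ i * cos (m * x + pi / 2 *+ i) : R^o)
    (m ^+ i *: (- sin (m * x + pi / 2 *+ i) * m)).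
  pose g : R -> R^o := cos \o (fun x => m * x + pi / 2 *+ i).
  have hg : is_derive x (1 : R) g (- sin (m * x + pi / 2 *+ i) * m) by exact: h1.
  have : is_derive x (1 : R) (m ^+ i *: g) (m ^+ i *: (- sin (m * x + pi / 2 *+ i) * m)).
    exact: is_deriveZ.
  by [].
rewrite (@derive_val _ _ _ _ _ _ _ h2).
have -> : m * x + pi / 2 *+ i.+1 = (m * x + pi / 2 *+ i) + pi / 2.
  by rewrite (mulrSr (pi / 2)) addrA.
by rewrite cosDpihalf exprSr /GRing.scale /=; ring.
Qed.

Lemma Ck_cos_subproof (m : nat) : (fun x => cos (m%:R * x) : R^o) \in @Ck_set R k.
Proof.
rewrite inE; split=> [x|i x _|x].
- have -> : m%:R * (x + tau) = m%:R * x + tau * m%:R by ring.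
  by apply: (@period_nat R cos) => y; exact: cosD2pi.
- by rewrite derive1n_cos; apply: ex_derive.
- rewrite derive1n_cos; apply: differentiable_continuous; apply/derivable1_diffP.
  by apply: ex_derive.
Qed.

Definition Ck_cos m : Ck R k := MkCk (Ck_cos_subproof m).

Definition Ck_average q f : Ck R k :=
  q%:R^-1 *: \sum_(j < q) Ck_shift f (tau * (j%:R / q%:R)).

Lemma Ck_averageE q f i x : (i <= k)%N ->
  d i (Ck_average q f) x = rotation_average q (d i f) x.
Proof.
move=> ik; rewrite Ck_deriveZ//.
have -> := Ck_derive_sum q (fun j => Ck_shift f (tau * (j%:R / q%:R))) x ik.
by congr (_ * _); apply: eq_bigr => j _; rewrite derive1n_shift.
Qed.

Lemma Ck_average_norm q f : `|Ck_average q f| <= `|f|.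
Proof.
apply: Ck_norm_le => // i x ik; rewrite Ck_averageE// /rotation_average.
case: q => [|q]; first by rewrite big_ord0 mulr0 normr0.
have q0 : 0 < q.+1%:R :> R by rewrite ltr0n.
rewrite normrM gtr0_norm ?invr_gt0// ler_pdivrMl//.
apply: le_trans (ler_norm_sum _ _ _) _.
apply: le_trans (_ : \sum_(j < q.+1) `|f| <= _); last first.
  by rewrite sumr_const card_ord mulr_natl.
by apply: ler_sum => j _; exact: Ck_norm_ge.
Qed.

Lemma Ck_average_lin q (a : R) f g :
  Ck_average q (a *: f + g) = a *: Ck_average q f + Ck_average q g.
Proof.
apply/val_inj/funext => x; rewrite -![val _ x]/(d 0 _ x).
rewrite Ck_derive_lin// !Ck_averageE// /rotation_average mulrCA -mulrDr.
congr (_ * _); rewrite mulr_sumr -big_split; apply: eq_bigr => j _.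
by rewrite Ck_derive_lin.
Qed.

(** [Ck_cos 0] is the constant function 1; it embeds the number A_q f(0) in [Ck]. *)
Definition Ck_oscillation q f : Ck R k :=
  Ck_average q f - Ck_average q f 0 *: Ck_cos 0.

Lemma Ck_oscillation_lin q (a : R) f g :
  Ck_oscillation q (a *: f + g) = a *: Ck_oscillation q f + Ck_oscillation q g.
Proof.
rewrite /Ck_oscillation Ck_average_lin.
have -> : (a *: Ck_average q f + Ck_average q g) 0 =
  a * Ck_average q f 0 + Ck_average q g 0 by [].
by rewrite scalerDl scalerBr -scalerA opprD addrACA.
Qed.

Lemma Ck_oscillation_norm q f : `|Ck_oscillation q f| <= (1 + `|Ck_cos 0|) * `|f|.
Proof.
apply: le_trans (ler_normB _ _) _; rewrite mulrDl mul1r lerD ?Ck_average_norm//.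
rewrite normrZ mulrC ler_wpM2l//; apply: le_trans (Ck_average_norm q f).
exact: (@Ck_norm_ge 0 (Ck_average q f) 0 (leq0n k)).
Qed.

Lemma Ck_cos0E x : Ck_cos 0 x = 1.
Proof. by rewrite /= mul0r cos0. Qed.

(** Each derivative of A_q f has period tau / q and inherits the modulus of continuity of the same
    derivative of [f], so it varies little over a period. It is small because it is compared with a
    zero in the same period: for order 0 after subtracting the value at 0, for higher orders at a
    point given by Rolle's theorem. *)
Lemma Ck_oscillation_cvg f : Ck_oscillation q f @[q --> \oo] --> (0 : Ck R k).
Proof.
apply/cvgrPdist_le => e e0.
have one (i : 'I_k.+1) : \forall q \near \oo, forall x, `|d i (Ck_oscillation q f) x| <= e.
  have ik : (i <= k)%N by rewrite -ltnS.
  have [de de0 hd] := periodic_uniform_continuous (Ck_periodic i (CkP f))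
    (Ck_continuous (CkP f) ik) e0.
  near=> q.
  have q0 : (0 < q)%N by near: q; exact: nbhs_infty_gt.
  have q0' : 0 < q%:R :> R by rewrite ltr0n.
  have qd : tau / q%:R < de.
    rewrite ltr_pdivrMr// -ltr_pdivrMl//; near: q; exact: nbhs_infty_gtr.
  have t0 : 0 < tau / q%:R by rewrite divr_gt0 ?tau_gt0.
  have osc := rotation_average_osc q0 hd.
  move=> x; rewrite /Ck_oscillation -scaleNr addrC Ck_derive_lin// Ck_averageE//.
  rewrite [d i _ x](_ : _ = (i == 0%N :> nat)%:R); last first.
    rewrite derive1n_cos expr0n; case: eqP => [->|_]; last by rewrite mul0r.
    by rewrite mul0r addr0 cos0 mulr1.
  have [m /andP[m1 m2]] := period_representative x t0.
  have av y : rotation_average q (d i f) (y + tau / q%:R) = rotation_average q (d i f) y.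
    by apply: rotation_average_periodic => //; exact: Ck_periodic (CkP f).
  rewrite -(period_int m x av); set x' := x + _ in m1 m2 *.
  case: (nat_of_ord i) ik osc av => [|j] ik osc av.
    rewrite eqxx mulr1 addrC -[Ck_average q f 0]/(d 0 (Ck_average q f) 0) Ck_averageE//.
    by apply: osc; rewrite subr0 ger0_norm// (lt_trans m2).
  rewrite mulr0 add0r.
  have AE i' : (i' <= k)%N -> rotation_average q (d i' f) = d i' (Ck_average q f).
    by move=> ik'; apply/funext => y; rewrite Ck_averageE.
  have cA := CkP (Ck_average q f).
  have [|||xi xiI xi0] := @Rolle R (d j (Ck_average q f)) 0 (tau / q%:R) t0.
  - by move: cA; rewrite inE => -[_ dA _] y _; exact: dA.
  - by apply: continuous_subspaceT; apply: (Ck_continuous cA); exact: ltnW.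
  - rewrite -(AE _ (ltnW ik)) -[tau / q%:R]add0r rotation_average_periodic//.
    exact: Ck_periodic (CkP f).
  have -> : rotation_average q (d j.+1 f) x' =
      rotation_average q (d j.+1 f) x' - rotation_average q (d j.+1 f) xi.
    rewrite [X in _ = _ - X](_ : _ = 0) ?subr0// AE// derive1nS derive1E.
    by rewrite (@derive_val _ _ _ _ _ _ _ xi0).
  apply: osc; apply: le_lt_trans qd.
  move: xiI; rewrite in_itv/= => /andP[xi1 xi2]; rewrite ler_norml.
  by move: m1 m2 xi1 xi2; lra.
have all : \forall q \near \oo, forall i : 'I_k.+1, forall x,
  `|d i (Ck_oscillation q f) x| <= e by apply: filter_forall => i; exact: one.
apply: filterS all => q allq; rewrite sub0r normrN; apply: Ck_norm_le => [|i x ik].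
  exact: ltW.
by have := allq (Ordinal (ik : (i < k.+1)%N)) x.
Unshelve. all: by end_near. Qed.

Lemma Ck_MVT f i x y : (i < k)%N ->
  exists2 u, `|u - x| <= `|y - x| & d i f y - d i f x = d i.+1 f u * (y - x).
Proof.
move=> ik; have := CkP f; rewrite inE => -[_ df _].
have cf : continuous (d i f) by apply: (Ck_continuous (CkP f)); exact: ltnW.
have der u : is_derive u (1 : R) (d i f) (d i.+1 f u).
  by rewrite derive1nS derive1E; apply: DeriveDef => //; exact: df.
have mvt a c : a < c -> exists2 u, a < u < c & d i f c - d i f a = d i.+1 f u * (c - a).
  move=> ac; have [u uI E] := MVT ac (fun u _ => der u) (continuous_subspaceT cf).
  by exists u => //; rewrite in_itv in uI.
have [xy|yx|->] := ltgtP x y; last by exists y; rewrite ?subrr ?mulr0 ?normr0.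
  have [u /andP[u1 u2] E] := mvt _ _ xy; exists u => //.
  by rewrite !gtr0_norm ?subr_gt0// lerD2r ltW.
have [u /andP[u1 u2] E] := mvt _ _ yx; exists u.
  by rewrite !ltr0_norm ?subr_lt0// lerN2 lerD2r ltW.
by rewrite -opprB E -mulrN opprB.
Qed.

Lemma Ck_taylor1 f : (2 <= k)%N -> exists D L C, taylor1 f D L C.
Proof.
move=> k2; exists (d 1 f), `|f|, `|f| => x y.
have [u ux E] := Ck_MVT f x y (ltnW k2); rewrite !derive1n0 in E.
split; last by apply: Ck_norm_ge; exact: ltnW.
  rewrite E -mulrBl; have [v _ ->] := Ck_MVT f x u k2.
  rewrite !normrM -mulrA; apply: ler_pM => //; first exact: Ck_norm_ge.
  rewrite -[(y - x) ^+ 2]real_normK ?num_real// expr2 ler_wpM2r//.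
by rewrite E normrM ler_wpM2r//; apply: Ck_norm_ge; exact: ltnW.
Qed.

End CkFamilies.

Lemma Ck_generic (R : realType) (b l k : nat) : (2 <= k)%N ->
  Baire_generic [set f : Cl_family b l (Ck R k) |
    forall t : 'rV[R]_b, cube t -> infinite_infinitesimal_cyclicity (f t)].
Proof.
move=> k2; apply: (@Baire_generic_cyclicity R b l (Ck R k) (fun f => f : R -> R)) => //.
- by move=> f x; exact: (@Ck_norm_ge R k 0).
- move=> f; apply: oscillation_cyclicity.
  + by have := CkP f; rewrite inE => -[].
  + exact: Ck_taylor1.
  + by exists `|f| => x; exact: (@Ck_norm_ge R k 0).
move=> K K0; exists (@Ck_oscillation R k), (1 + `|@Ck_cos R k 0|), (fun q => Ck_cos k (K.*2 * q)).
split=> [q a f g|q f|f|q q0].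
- exact: Ck_oscillation_lin.
- exact: Ck_oscillation_norm.
- exact: Ck_oscillation_cvg.
exists (fun i => pi *+ 2 * (i%:R / (K.*2.*2.+1 * q)%:R)), (cos (pi / K.*2.*2.+1%:R * K.*2%:R)).
split=> [|f e e0]; first exact: cos_grid_gt0.
(* A_q fixes functions of period tau / q, among them A_q f, the constants and the added cosine.
   Hence A_q of [f - T_q f] is the constant A_q f(0), here even off the grid. *)
exists (Ck_average q f 0); apply: oscillates_grid => // i _.
set z := _ * _.
have qR0 : 0 < q%:R :> R by rewrite ltr0n.
have AE (h : Ck R k) x : rotation_average q h x = Ck_average q h x.
  by have := @Ck_averageE R k q h 0 x (leq0n k); rewrite !derive1n0.
have Aid (h : Ck R k) : (forall x, h (x + pi *+ 2 / q%:R) = h x) -> Ck_average q h z = h z.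
  by move=> hq; rewrite -AE; exact: rotation_average_id.
have cosq (m : nat) (x : R) : Ck_cos k (m * q) (x + pi *+ 2 / q%:R) = Ck_cos k (m * q) x.
  rewrite /= (_ : _ * (_ + _) = (m * q)%:R * x + pi *+ 2 * m%:R); last first.
    by rewrite natrM; field; rewrite gt_eqF.
  by apply: (@period_nat R cos) => y; exact: cosD2pi.
have -> : f - Ck_oscillation q f + e *: Ck_cos k (K.*2 * q) =
    e *: Ck_cos k (K.*2 * q) + ((-1) *: Ck_oscillation q f + f).
  by rewrite scaleN1r addrC [- _ + _]addrC.
have oE : Ck_oscillation q f = (- Ck_average q f 0) *: Ck_cos k (0 * q) + Ck_average q f.
  by rewrite /Ck_oscillation scaleNr addrC mul0n.
rewrite AE oE !Ck_average_lin.
have val (a : R) (g h : Ck R k) : (a *: g + h) z = a * g z + h z by [].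
rewrite !val (Aid (Ck_cos k (K.*2 * q)) (cosq _)) (Aid (Ck_cos k (0 * q)) (cosq _)).
rewrite (Aid (Ck_average q f)); last first.
  by move=> x; rewrite -!AE rotation_average_periodic//; have := CkP f; rewrite inE => -[].
by rewrite mul0n Ck_cos0E mulr1 /=; ring.
Qed.

(** * Complex exponentials and power series *)

Section ComplexExponential.
Context {R : realType}.
Local Open Scope complex_scope.
Local Notation C := (R[i]^o).
Local Notation tau := (pi *+ 2 : R).
Implicit Types (u v t : R) (z w : R[i]).

Definition cexp z : R[i] :=
  (expR (complex.Re z))%:C * (cos (complex.Im z) +i* sin (complex.Im z)).

Lemma cexpD z w : cexp (z + w) = cexp z * cexp w.
Proof.
case: z => a b; case: w => c d; rewrite /cexp /= expRD sinD cosD.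
by apply/eqP; rewrite eq_complex /=; apply/andP; split; apply/eqP; ring.
Qed.

Lemma normc_cexp z : normc (cexp z) = expR (complex.Re z).
Proof.
rewrite /cexp normcM normc_real gtr0_norm ?expR_gt0//= cos2Dsin2 sqrtr1.
by rewrite mulr1.
Qed.

Lemma is_derive_ext (f g : R -> R^o) x (d e : R) :
  is_derive x (1 : R) f d -> f =1 g -> d = e -> is_derive x (1 : R) g e.
Proof. by move=> h /funext <- <-. Qed.

Lemma is_derive_pow n t c :
  is_derive t (1 : R) (fun t => t ^+ n.+1 * c : R^o) (t ^+ n * (n.+1%:R * c)).
Proof.
have h := is_deriveZ c (is_deriveX n.+1 (is_derive_id (t : R^o) (1 : R))).
apply: (is_derive_ext h) => [y|]; last by rewrite /GRing.scale /=; ring.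
suff E m : ((id : R^o -> R) ^+ m) y = y ^+ m by rewrite mulrC -E.
by elim: m => // m IH; rewrite !exprS -IH.
Qed.

Lemma is_derive_linear u t : is_derive t (1 : R) (fun t => t * u : R^o) u.
Proof.
have h := is_deriveZ u (is_derive_id (t : R^o) (1 : R)).
by apply: (is_derive_ext h) => [y|]; rewrite /GRing.scale /= 1?mulrC ?mulr1 // mul1r.
Qed.

Section Series.
Variables u v : R.
Let p n : R[i] := (n`!%:R)^-1 * (u +i* v) ^+ n.
Let a n := complex.Re (p n).
Let b n := complex.Im (p n).

Let pS n : n.+1%:R * a n.+1 = u * a n - v * b n /\ n.+1%:R * b n.+1 = u * b n + v * a n.
Proof.
have h : n.+1%:R * p n.+1 = (u +i* v) * p n.
  rewrite /p factS natrM invfM exprS mulrACA mulrCA !mulrA; congr (_ * _).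
  rewrite mulrC -!mulrA; congr (_ * _).
  by rewrite mulrCA divff ?mulr1 // pnatr_eq0.
have nE : n.+1%:R = (n.+1%:R : R)%:C by rewrite rmorph_nat.
rewrite nE /a /b in h *; move: h; case: (p n.+1) => x y; case: (p n) => x' y' /=.
move/eqP; rewrite eq_complex /= => /andP[/eqP h1 /eqP h2].
by move: h1 h2; rewrite !mul0r subr0 addr0 => -> ->.
Qed.

Let is_derive_psum (c : nat -> R) n t :
  is_derive t 1 (fun t => \sum_(k < n.+1) t ^+ k * c k : R^o)
    (\sum_(k < n) t ^+ k * (k.+1%:R * c k.+1)).
Proof.
elim: n => [|n IH].
  rewrite big_ord0; under eq_fun do rewrite big_ord1 expr0 mul1r.
  exact: is_derive_cst.
under eq_fun do rewrite big_ord_recr.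
rewrite big_ord_recr /=.
exact: (@is_deriveD _ _ _ _ _ _ _ _ _ IH (is_derive_pow n t (c n.+1))).
Qed.

(** [A] and [B] are the real and imaginary parts of the remainder of exp(t (u + i v)) after n terms.
    Differentiation in t turns the remainder of order n + 1 into u + i v times that of order n, so
    for |u| + |v| <= 1/2 the mean value theorem halves the bound at each order. *)
Let A n t := expR (t * u) * cos (t * v) - \sum_(k < n) t ^+ k * a k.
Let B n t := expR (t * u) * sin (t * v) - \sum_(k < n) t ^+ k * b k.

Let dA n t : is_derive t 1 (A n.+1 : R -> R^o) (u * A n t - v * B n t).
Proof.
have h1 : is_derive t (1 : R) (fun t => expR (t * u) * cos (t * v) : R^o)
    (u * (expR (t * u) * cos (t * v)) - v * (expR (t * u) * sin (t * v))).
  have := is_deriveM (is_derive1_comp (is_derive_expR _) (is_derive_linear u t))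
    (is_derive1_comp (is_derive_cos _) (is_derive_linear v t)).
  by move/is_derive_ext; apply => //; rewrite /GRing.scale /=; ring.
have h2 := is_derive_psum a n t.
have := @is_deriveB _ _ _ _ _ _ _ _ _ h1 h2.
move/is_derive_ext; apply => //; rewrite /A /B !mulrBr opprB.
rewrite [in LHS](eq_bigr (fun k : 'I_n => u * (t ^+ k * a k) - v * (t ^+ k * b k))).
  by rewrite sumrB -!mulr_sumr; ring.
by move=> k _; have [-> _] := pS k; ring.
Qed.

Let dB n t : is_derive t 1 (B n.+1 : R -> R^o) (u * B n t + v * A n t).
Proof.
have h1 : is_derive t (1 : R) (fun t => expR (t * u) * sin (t * v) : R^o)
    (u * (expR (t * u) * sin (t * v)) + v * (expR (t * u) * cos (t * v))).
  have := is_deriveM (is_derive1_comp (is_derive_expR _) (is_derive_linear u t))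
    (is_derive1_comp (is_derive_sin _) (is_derive_linear v t)).
  by move/is_derive_ext; apply => //; rewrite /GRing.scale /=; ring.
have h2 := is_derive_psum b n t.
have := @is_deriveB _ _ _ _ _ _ _ _ _ h1 h2.
move/is_derive_ext; apply => //; rewrite /A /B !mulrBr.
rewrite [in LHS](eq_bigr (fun k : 'I_n => u * (t ^+ k * b k) + v * (t ^+ k * a k))).
  by rewrite big_split /= -!mulr_sumr; ring.
by move=> k _; have [_ ->] := pS k; ring.
Qed.

Hypothesis uv : `|u| + `|v| <= 2^-1.

Let AB n t : 0 <= t <= 1 ->
  `|A n t| <= expR 1 * 2^-1 ^+ n /\ `|B n t| <= expR 1 * 2^-1 ^+ n.
Proof.
have e1 : 0 < expR 1 :> R by exact: expR_gt0.
elim: n t => [|n IH] t /andP[t0 t1].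
  rewrite /A /B !big_ord0 !subr0 mulr1 !normrM !(gtr0_norm (expR_gt0 _)).
  have h1 : expR (t * u) <= expR 1.
    rewrite ler_expR; apply: le_trans (ler_norm _) _; rewrite normrM ger0_norm//.
    apply: le_trans (_ : 1 * `|u| <= _); first by rewrite ler_wpM2r.
    by have := normr_ge0 v; move: uv; lra.
  have e0 := expR_ge0 (t * u).
  split; rewrite -[leRHS]mulr1; apply: ler_pM => //; rewrite ler_norml.
    by rewrite cos_geN1 cos_le1.
  by rewrite sin_geN1 sin_le1.
have z0 (f df : R -> R) : f 0 = 0 -> (forall x, is_derive x (1 : R) (f : R -> R^o) (df x)) ->
    (forall x, 0 <= x <= 1 -> `|df x| <= expR 1 * 2^-1 ^+ n.+1) ->
    `|f t| <= expR 1 * 2^-1 ^+ n.+1.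
  move=> f0 hf hd; have [t00|t00] := eqVneq t 0.
    by rewrite t00 f0 normr0 mulr_ge0 ?exprn_ge0// ltW.
  have tp : 0 < t by rewrite lt_neqAle eq_sym t00.
  have cf : {within `[0, t], continuous f}.
    apply: continuous_subspaceT => x; apply: differentiable_continuous.
    by apply/derivable1_diffP; have [] := hf x.
  have [x] := @MVT R f df 0 t tp (fun x _ => hf x) cf.
  rewrite in_itv/= f0 !subr0 => /andP[x0 xt] ->; rewrite normrM (gtr0_norm tp).
  rewrite -[leRHS]mulr1; apply: ler_pM => //.
  by apply: hd; rewrite (ltW x0) (le_trans (ltW xt)).
have bound x y : `|x| <= expR 1 * 2^-1 ^+ n -> `|y| <= expR 1 * 2^-1 ^+ n ->
    `|u * x| + `|v * y| <= expR 1 * 2^-1 ^+ n.+1.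
  move=> hx hy; rewrite !normrM.
  apply: le_trans (_ : (`|u| + `|v|) * (expR 1 * 2^-1 ^+ n) <= _).
    by rewrite mulrDl lerD// ler_wpM2l.
  rewrite exprS [leRHS]mulrCA ler_wpM2r// mulr_ge0 ?exprn_ge0//; exact: ltW.
split.
  apply: (z0 (A n.+1) (fun x => u * A n x - v * B n x)) => [|x|x xI]; last 1 first.
  - have [hA hB] := IH x xI; apply: le_trans (ler_normB _ _) _; exact: bound.
  - rewrite /A mul0r mul0r expR0 cos0 mulr1 big_ord_recl big1 => [|k _].
      have a0 : a 0 = 1 by rewrite /a /p expr0 fact0 invr1 mulr1.
      by rewrite -[X in _ - X]/(0 ^+ 0%N * a 0%N + 0) a0 expr0 mulr1 addr0 subrr.
    by rewrite expr0n /= mul0r.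
  - exact: dA.
apply: (z0 (B n.+1) (fun x => u * B n x + v * A n x)) => [|x|x xI]; last 1 first.
- have [hA hB] := IH x xI; apply: le_trans (ler_normD _ _) _; exact: bound.
- rewrite /B !mul0r expR0 sin0 mulr0 big_ord_recl big1 => [|k _].
    have b0 : b 0 = 0 by rewrite /b /p expr0 fact0 invr1 mulr1.
    by rewrite -[X in _ - X]/(0 ^+ 0%N * b 0%N + 0) b0 mulr0 addr0 subrr.
  by rewrite expr0n /= mul0r.
- exact: dB.
Qed.

(** A neighborhood of 0 is enough: analyticity is local, and [cexpD] carries the expansion to every
    center. *)
Lemma cexp_series : series (p : nat -> C) @ \oo --> (cexp (u +i* v) : C).
Proof.
apply/cvg_normcP => e e0.
have h n : normc (series (p : nat -> C) n - cexp (u +i* v)) <= 2 * expR 1 * 2^-1 ^+ n.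
  have [|hA hB] := @AB n 1; first by rewrite ler01 lexx.
  rewrite normcB.
  have -> : cexp (u +i* v) - series (p : nat -> C) n = A n 1 +i* B n 1.
    rewrite /A /B !mul1r.
    have -> : series (p : nat -> C) n = (\sum_(k < n) a k) +i* (\sum_(k < n) b k).
      rewrite /series /= big_mkord; elim: (n) => [|j IH]; first by rewrite !big_ord0.
      by rewrite !big_ord_recr /= IH /a /b; case: (p j).
    apply/eqP; rewrite eq_complex /= !mul0r subr0 addr0; apply/andP; split; apply/eqP.
      by congr (_ - _); apply: eq_bigr => k _; rewrite expr1n mul1r.
    by congr (_ - _); apply: eq_bigr => k _; rewrite expr1n mul1r.
  have -> : A n 1 +i* B n 1 = (A n 1)%:C + 'i * (B n 1)%:C.
    by apply/eqP; rewrite eq_complex /=; apply/andP; split; apply/eqP; ring.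
  apply: le_trans (le_normcD _ _) _; rewrite normcM !normc_real.
  have -> : normc ('i : R[i]) = 1 by rewrite /= expr0n expr1n add0r sqrtr1.
  by move: hA hB; lra.
have c0 : 0 < 2 * expR 1 :> R by rewrite mulr_gt0// expR_gt0.
have : (2^-1 : R) ^+ n @[n --> \oo] --> 0.
  by apply: cvg_expr; rewrite gtr0_norm ?invr_gt0// invf_lt1// ltr1n.
move=> /cvgrPdist_lt /(_ _ (divr_gt0 e0 c0)).
apply: filterS => n; rewrite sub0r normrN ger0_norm ?exprn_ge0 ?invr_ge0// => hn.
by apply: le_lt_trans (h n) _; rewrite mulrC -ltr_pdivlMr.
Qed.

End Series.

End ComplexExponential.

(** * Holomorphy expressed by second differences *)

Section Tame.
Context {R : realType}.
Local Open Scope complex_scope.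
Local Notation C := (R[i]^o).
Implicit Types (B : set R[i]) (H K : R[i] -> R[i]) (c : R) (z w : R[i]).

Lemma normc_gt0 z : z != 0 -> 0 < normc z.
Proof.
move=> z0; rewrite lt_neqAle normc_ge0 andbT eq_sym; apply: contra_neq z0.
exact: eq0_normc.
Qed.

(* Up to sign, the divided difference of order two times the Vandermonde
   product, so no division is needed. *)
Definition second_difference H z z' w : R[i] :=
  (H z - H w) * (z' - w) - (H z' - H w) * (z - w).

(* An elementary substitute for holomorphy, used without contour integrals: the
   bound on second differences expresses vertical increments of [H] on a fine
   grid by horizontal ones, and the latter telescope over a period. *)
Definition tame B H c := forall z z' w, B z -> B z' -> B w ->
  [/\ normc (H z) <= c, normc (H z - H w) <= c * normc (z - w) &
      normc (second_difference H z z' w) <=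
        c * normc (z - z') * normc (z - w) * normc (z' - w)].

Lemma tame_sub B B' H c : B' `<=` B -> tame B H c -> tame B' H c.
Proof. by move=> BB' h z z' w /BB' Bz /BB' Bz' /BB' Bw; exact: h. Qed.

Lemma tame_eq B H K c : {in B, H =1 K} -> tame B H c -> tame B K c.
Proof.
move=> HK h z z' w Bz Bz' Bw; rewrite /second_difference.
by rewrite -!HK ?inE//; exact: h.
Qed.

Lemma tame_le B H c c' : c <= c' -> tame B H c -> tame B H c'.
Proof.
move=> cc h z z' w Bz Bz' Bw; have [h0 h1 h2] := h z z' w Bz Bz' Bw; split.
- exact: le_trans cc.
- by apply: le_trans h1 _; rewrite ler_wpM2r// normc_ge0.
- by apply: le_trans h2 _; do 3!(rewrite ler_wpM2r// ?normc_ge0//).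
Qed.

Lemma tame_cst B (a : R[i]) : tame B (fun=> a) (normc a).
Proof.
move=> z z' w _ _ _; rewrite /second_difference !subrr !mul0r subr0 normc0.
by split=> //; rewrite ?mulr_ge0 ?normc_ge0.
Qed.

Lemma tameD B H K c c' : tame B H c -> tame B K c' -> tame B (fun z => H z + K z) (c + c').
Proof.
move=> h k z z' w Bz Bz' Bw; have [h0 h1 h2] := h z z' w Bz Bz' Bw.
have [k0 k1 k2] := k z z' w Bz Bz' Bw; split.
- by apply: le_trans (le_normcD _ _) _; rewrite lerD.
- by rewrite opprD addrACA; apply: le_trans (le_normcD _ _) _; rewrite mulrDl lerD.
have -> : second_difference (fun z => H z + K z) z z' w =
    second_difference H z z' w + second_difference K z z' w.
  by rewrite /second_difference; ring.
by apply: le_trans (le_normcD _ _) _; rewrite !mulrDl lerD.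
Qed.

Lemma tameM B H K c c' : 0 <= c -> 0 <= c' -> tame B H c -> tame B K c' ->
  tame B (fun z => H z * K z) (3 * c * c').
Proof.
move=> c0 c'0 h k z z' w Bz Bz' Bw; have [h0 h1 h2] := h z z' w Bz Bz' Bw.
have [k0 k1 k2] := k z z' w Bz Bz' Bw.
have [hw0 _ _] := h w w w Bw Bw Bw.
have [_ h1' _] := h z' z w Bz' Bz Bw; have [_ k1' _] := k z w z' Bz Bw Bz'.
have cc : 0 <= c * c' by rewrite mulr_ge0.
have n0 := @normc_ge0 R.
split.
- rewrite normcM; apply: le_trans (_ : c * c' <= _); first exact: ler_pM.
  by move: cc; lra.
- have -> : H z * K z - H w * K w = (H z - H w) * K z + H w * (K z - K w) by ring.
  apply: le_trans (le_normcD _ _) _; rewrite !normcM.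
  apply: le_trans (_ : (c * normc (z - w)) * c' + c * (c' * normc (z - w)) <= _).
    by rewrite lerD// ler_pM.
  by have := mulr_ge0 cc (n0 (z - w)); lra.
have -> : second_difference (fun z => H z * K z) z z' w =
    H w * second_difference K z z' w + K z * second_difference H z z' w +
    (H z' - H w) * (z - w) * (K z - K z') by rewrite /second_difference; ring.
apply: le_trans (le_normcD _ _) _; apply: le_trans (lerD (le_normcD _ _) (lexx _)) _.
rewrite !normcM; set p := normc (z - z') in h2 k2 k1' *.
set s := normc (z - w) in h2 k2 *; set t := normc (z' - w) in h2 k2 h1' *.
apply: le_trans (_ : c * (c' * p * s * t) + c' * (c * p * s * t) +
    c * t * s * (c' * p) <= _).
  apply: lerD; first (apply: lerD; exact: ler_pM).
  apply: ler_pM => //; first by rewrite mulr_ge0 ?n0.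
  by rewrite ler_wpM2r// n0.
by rewrite le_eqVlt; apply/orP; left; apply/eqP; ring.
Qed.

Lemma tameV B K c e : 0 <= c -> 0 < e -> (forall z, B z -> e <= normc (K z)) ->
  tame B K c -> exists2 c', 0 <= c' & tame B (fun z => (K z)^-1) c'.
Proof.
move=> c0 e0 Ke k.
pose m := e^-1; have m0 : 0 < m by rewrite invr_gt0.
have V z : B z -> normc (K z)^-1 <= m.
  by move=> /Ke h; rewrite normcV lef_pV2// posrE (lt_le_trans e0).
have K0 z : B z -> K z != 0.
  by move=> /Ke h; apply/eqP => z0; move: h; rewrite z0 normc0 leNgt e0.
exists (m + m * m * c + 2 * m * m * m * c * c) => [|z z' w Bz Bz' Bw].
  by rewrite !addr_ge0 ?mulr_ge0 ?(ltW m0).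
have [_ k1 k2] := k z z' w Bz Bz' Bw.
have [k0' k1' _] := k z' z w Bz' Bz Bw; have [_ k1'' _] := k z' w z Bz' Bw Bz.
have n0 := @normc_ge0 R; have mm := ltW m0.
have t1 : 0 <= m * m * c by rewrite !mulr_ge0.
have t2 : 0 <= 2 * m * m * m * c * c by rewrite !mulr_ge0.
split.
- by apply: le_trans (V z Bz) _; move: t1 t2; lra.
- have -> : (K z)^-1 - (K w)^-1 = - ((K z)^-1 * (K w)^-1 * (K z - K w)).
    by field; rewrite !K0.
  rewrite normcN !normcM; apply: le_trans (_ : m * m * (c * normc (z - w)) <= _).
    by rewrite !ler_pM ?mulr_ge0 ?V ?n0.
  rewrite mulrA ler_wpM2r//; move: t2 mm; lra.
have -> : second_difference (fun z => (K z)^-1) z z' w =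
    - ((K z)^-1 * (K z')^-1 * (K w)^-1 *
    (K z' * second_difference K z z' w + (K z' - K w) * (z - w) * (K z' - K z))).
  by rewrite /second_difference; field; rewrite !K0.
rewrite normcN normcM [normc (z - z')]normcB in k2 *.
set p := normc (z' - z) in k1'' k2 *.
set s := normc (z - w) in k1 k2 *; set t := normc (z' - w) in k1' k2 *.
apply: le_trans (_ : (m * m * m) * (c * (c * p * s * t) + c * t * s * (c * p)) <= _).
  apply: ler_pM => //.
    by rewrite !normcM !ler_pM ?mulr_ge0 ?V.
  by apply: le_trans (le_normcD _ _) _; rewrite !normcM lerD// !ler_pM// mulr_ge0.
have P : 0 <= p * s * t by apply: mulr_ge0; [apply: mulr_ge0|]; exact: n0.
apply: le_trans (_ : (2 * m * m * m * c * c) * (p * s * t) <= _).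
  by rewrite le_eqVlt; apply/orP; left; apply/eqP; ring.
rewrite [leRHS](_ : _ = (m + m * m * c + 2 * m * m * m * c * c) * (p * s * t)); last by ring.
by rewrite ler_wpM2r//; move: t1 mm; lra.
Qed.

(** Tameness consists of closed inequalities between values at three points, so it passes to
    pointwise limits with the same constant. *)
Lemma tame_limit B (h : nat -> R[i] -> R[i]) H c : (forall n, tame B (h n) c) ->
  (forall z, B z -> (h ^~ z : nat -> C) @ \oo --> (H z : C)) -> tame B H c.
Proof.
move=> ht hH z z' w Bz Bz' Bw.
have near e : 0 < e -> exists n, [/\ normc (h n z - H z) < e, normc (h n z' - H z') < e &
    normc (h n w - H w) < e].
  move=> e0; have /cvg_normcP/(_ _ e0) h1 := hH z Bz.
  have /cvg_normcP/(_ _ e0) h2 := hH z' Bz'; have /cvg_normcP/(_ _ e0) h3 := hH w Bw.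
  have [n [[? ?] ?]] := filter_ex (filterI (filterI h1 h2) h3).
  by exists n.
have approx (x y a : R) : 0 <= a -> (forall e, 0 < e -> x <= y + a * e) -> x <= y.
  move=> a0 he; apply/ler_addgt0Pr => e e0.
  have a1 : 0 < a + 1 by rewrite ltr_wpDl.
  apply: le_trans (he (e / (a + 1)) (divr_gt0 e0 a1)) _.
  rewrite lerD2l mulrCA ler_piMr ?(ltW e0)// ler_pdivrMr// mul1r lerDl//.
have n0 := @normc_ge0 R.
split.
- apply: (approx _ _ 1) => // e e0; have [n [hz hz' hw]] := near e e0.
  have [h0 _ _] := ht n z z' w Bz Bz' Bw.
  rewrite mul1r -[H z](subKr (h n z)); apply: le_trans (le_normcD _ _) _.
  by rewrite normcN lerD// ltW.
- apply: (approx _ _ 2) => // e e0; have [n [hz hz' hw]] := near e e0.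
  have [_ h1 _] := ht n z z' w Bz Bz' Bw.
  have -> : H z - H w = (h n z - h n w) + (- (h n z - H z) + (h n w - H w)) by ring.
  apply: le_trans (le_normcD _ _) _; rewrite lerD// mulr_natl mulr2n.
  by apply: le_trans (le_normcD _ _) _; rewrite normcN lerD// ltW.
pose s := normc (z - w) ; pose t := normc (z' - w).
apply: (approx _ _ (2 * t + 2 * s)) => [|e e0]; first by rewrite addr_ge0 ?mulr_ge0 ?n0.
have [n [hz hz' hw]] := near e e0.
have [_ _ h2] := ht n z z' w Bz Bz' Bw.
have -> : second_difference H z z' w = second_difference (h n) z z' w +
    ((- (h n z - H z) + (h n w - H w)) * (z' - w) +
     ((h n z' - H z') - (h n w - H w)) * (z - w)).
  by rewrite /second_difference; ring.
apply: le_trans (le_normcD _ _) _; rewrite lerD//.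
have e2 x y : normc x < e -> normc y < e -> normc (x + y) <= 2 * e.
  by move=> hx hy; apply: le_trans (le_normcD _ _) _; move: hx hy; lra.
apply: le_trans (le_normcD _ _) _; rewrite !normcM -/s -/t mulrDl.
rewrite [2 * t * e]mulrAC [2 * s * e]mulrAC lerD//.
  by rewrite ler_wpM2r ?n0// e2 ?normcN.
by rewrite ler_wpM2r ?n0// e2 ?normcN.
Qed.

Lemma tame_pow rho n : 0 < rho ->
  tame [set z | normc z <= rho] (fun z => z ^+ n) 
    (n.+1%:R ^+ 2 * rho ^+ n * (1 + rho^-1 + rho^-1 * rho^-1)).
Proof.
move=> r0; have ri : 0 < rho^-1 by rewrite invr_gt0.
have n0 := @normc_ge0 R.
(* The induction closes with the separate constants 1, n and n^2, since m^2 + m <= (m + 1)^2; they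
   are merged into one constant afterwards. *)
have sharp z z' w : normc z <= rho -> normc z' <= rho -> normc w <= rho ->
  [/\ normc (z ^+ n) <= rho ^+ n,
      normc (z ^+ n - w ^+ n) <= n%:R * rho ^+ n * rho^-1 * normc (z - w),
      normc (z' ^+ n - w ^+ n) <= n%:R * rho ^+ n * rho^-1 * normc (z' - w) &
      normc (second_difference (fun z => z ^+ n) z z' w) <=
      n%:R ^+ 2 * rho ^+ n * rho^-1 * rho^-1 * normc (z - z') * normc (z - w) * normc (z' - w)].
  move=> hz hz' hw; elim: n => [|m [IH0 IH1 IH1' IH2]].
    rewrite !expr0 /second_difference !subrr !mul0r subr0 normc0 normc1.
    by split=> //; rewrite ?mul0r ?expr0n ?mul0r.
  have rm : rho ^+ m.+1 = rho * rho ^+ m by rewrite exprS.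
  have wm : normc (w ^+ m) <= rho ^+ m.
    by rewrite normcX lerXn2r// nnegrE// ltW.
  have lip u : normc u <= rho -> normc (u ^+ m - w ^+ m) <= m%:R * rho ^+ m * rho^-1 * normc (u - w) ->
      normc (u ^+ m.+1 - w ^+ m.+1) <= m.+1%:R * rho ^+ m.+1 * rho^-1 * normc (u - w).
    move=> hu hm; have -> : u ^+ m.+1 - w ^+ m.+1 = u * (u ^+ m - w ^+ m) + w ^+ m * (u - w).
      by rewrite !exprS; ring.
    apply: le_trans (le_normcD _ _) _; rewrite !normcM.
    apply: le_trans (lerD (ler_pM _ _ hu hm) (ler_wpM2r (n0 _) wm)) _; rewrite ?n0//.
    rewrite rm -natr1 le_eqVlt; apply/orP; left; apply/eqP; field; exact: lt0r_neq0.
  split.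
  - by rewrite normcX lerXn2r// nnegrE// ltW.
  - exact: lip.
  - exact: lip.
  have -> : second_difference (fun z => z ^+ m.+1) z z' w =
      z * second_difference (fun z => z ^+ m) z z' w +
      (z' ^+ m - w ^+ m) * (z - w) * (z - z').
    by rewrite /second_difference !exprS; ring.
  apply: le_trans (le_normcD _ _) _; rewrite !normcM.
  set p := normc (z - z') in IH2 *; set s := normc (z - w) in IH2 *.
  set t := normc (z' - w) in IH1' IH2 *.
  have P : 0 <= rho ^+ m * rho^-1 * p * s * t.
    by rewrite !mulr_ge0 ?n0 ?exprn_ge0// ltW.
  apply: le_trans (_ : rho * (m%:R ^+ 2 * rho ^+ m * rho^-1 * rho^-1 * p * s * t) +
    m%:R * rho ^+ m * rho^-1 * t * s * p <= _).
    by rewrite lerD ?ler_pM ?mulr_ge0 ?n0.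
  apply: le_trans (_ : (m%:R ^+ 2 + m%:R) * (rho ^+ m * rho^-1 * p * s * t) <= _).
    rewrite le_eqVlt; apply/orP; left; apply/eqP; field; exact: lt0r_neq0.
  apply: le_trans (_ : m.+1%:R ^+ 2 * (rho ^+ m * rho^-1 * p * s * t) <= _).
    rewrite ler_wpM2r// -natr1 sqrrD mulr1 expr1n -addrA lerD2l.
    by have := ler0n R m; lra.
  rewrite rm le_eqVlt; apply/orP; left; apply/eqP; field; exact: lt0r_neq0.
move=> z z' w hz hz' hw; have [h0 h1 _ h2] := sharp z z' w hz hz' hw.
have rn : 0 < rho ^+ n by rewrite exprn_gt0.
have n1 : 1 <= n.+1%:R ^+ 2 :> R by rewrite -natrX ler1n expn_gt0.
have nn : n%:R <= n.+1%:R ^+ 2 :> R by rewrite -natrX ler_nat (leq_trans (leqnSn n))// -[X in (X <= _)%N]expn1 leq_pexp2l.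
have nn2 : n%:R ^+ 2 <= n.+1%:R ^+ 2 :> R by rewrite -!natrX ler_nat leq_exp2r.
set N := n.+1%:R ^+ 2 in n1 nn nn2 *.
have N0 : 0 <= N by apply: le_trans n1.
have NR : 0 <= N * rho ^+ n by rewrite mulr_ge0// ltW.
split.
- apply: le_trans h0 _; rewrite !mulrDr mulr1 -addrA.
  apply: le_trans (_ : N * rho ^+ n <= _); first by rewrite ler_peMl// ltW.
  by rewrite lerDl addr_ge0 ?mulr_ge0// ltW.
- apply: le_trans h1 _; rewrite ler_wpM2r ?n0// !mulrDr mulr1.
  apply: le_trans (_ : N * rho ^+ n * rho^-1 <= _).
    by do 2!(rewrite ler_wpM2r// ?(ltW rn) ?(ltW ri)//).
  by rewrite addrAC lerDr addr_ge0 ?mulr_ge0// ltW.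
- apply: le_trans h2 _; do 3!(rewrite ler_wpM2r ?n0//).
  rewrite !mulrDr mulr1 mulrA.
  apply: le_trans (_ : N * rho ^+ n * rho^-1 * rho^-1 <= _).
    by do 3!(rewrite ler_wpM2r// ?(ltW rn) ?(ltW ri)//).
  by rewrite lerDr addr_ge0 ?mulr_ge0// ltW.
Qed.

End Tame.

Section Good.
Context {R : realType}.
Local Open Scope complex_scope.
Local Notation C := (R[i]^o).
Implicit Types (H K : R[i] -> R[i]) (c r : R) (z w d : R[i]).

Lemma tameZ B H c (a : R[i]) : tame B H c -> tame B (fun z => a * H z) (normc a * c).
Proof.
move=> h z z' w Bz Bz' Bw; have [h0 h1 h2] := h z z' w Bz Bz' Bw.
have a0 := normc_ge0 a; split.
- by rewrite normcM ler_wpM2l.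
- by rewrite -mulrBr normcM -mulrA ler_wpM2l.
have -> : second_difference (fun z => a * H z) z z' w = a * second_difference H z z' w.
  by rewrite /second_difference; ring.
by rewrite normcM -!mulrA ler_wpM2l// !mulrA.
Qed.

Lemma tame_shift B H c (s : R[i]) : tame [set z | B (z + s)] (fun z => H (z + s)) c <->
  tame B H c.
Proof.
have E z w : (z + s) - (w + s) = z - w by ring.
split=> h z z' w Bz Bz' Bw; last first.
  have [h0 h1 h2] := h (z + s) (z' + s) (w + s) Bz Bz' Bw.
  by rewrite !E in h1 h2; rewrite /second_difference !E in h2 *.
have Bs u : B u -> [set z | B (z + s)] (u - s) by rewrite /= subrK.
have [] := h (z - s) (z' - s) (w - s) (Bs _ Bz) (Bs _ Bz') (Bs _ Bw).
have F u v : (u - s) - (v - s) = u - v by ring.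
by rewrite /second_difference !F !subrK.
Qed.

Definition cball z r : set R[i] := [set w | normc (w - z) < r].

Lemma pseries_tame (a : nat -> C) z0 r H : 0 < r ->
  (forall z, normc (z - z0) < r ->
    series (fun n => a n * (z - z0) ^+ n : C) @ \oo --> (H z : C)) ->
  exists2 e, 0 < e <= r & exists2 c, 0 <= c & tame (cball z0 e) H c.
Proof.
move=> r0 aH; pose r2 := r / 2; have r20 : 0 < r2 by rewrite divr_gt0.
have nr2 : normc r2%:C = r2 by rewrite normc_real gtr0_norm.
have [|b b0 ab] := @pseries_bounded R a r2%:C (H (z0 + r2%:C)).
  have := aH (z0 + r2%:C); rewrite addrC addKr; apply.
  by rewrite nr2 ltr_pdivrMr// ltr_pMr// ltr1n.
rewrite nr2 in ab.
(* The 8 is 4 times 2: the bound (n + 1)^2 <= 4^n absorbs the polynomial factor of [tame_pow], and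
   the remaining 2^-n sums to at most 2. *)
pose rho := r2 / 8; have rho0 : 0 < rho by rewrite divr_gt0.
exists rho.
  rewrite rho0 /= /rho /r2; move: r0; lra.
pose k := 1 + rho^-1 + rho^-1 * rho^-1.
have k0 : 0 <= k by rewrite !addr_ge0 ?mulr_ge0 ?invr_ge0 ?ltW.
have term n : tame (cball z0 rho) (fun z => a n * (z - z0) ^+ n) (b * k * 2^-1 ^+ n).
  have /(tameZ (a n)) t : tame (cball z0 rho) (fun z => (z - z0) ^+ n)
      (n.+1%:R ^+ 2 * rho ^+ n * k).
    apply/(tame_shift _ _ _ z0).
    have sub : [set z | cball z0 rho (z + z0)] `<=` [set z | normc z <= rho].
      by move=> z; rewrite /cball /= addrK => /ltW.
    have := tame_sub sub (tame_pow n rho0).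
    by apply: tame_eq => z _; rewrite addrK.
  apply: tame_le t.
  apply: le_trans (_ : (normc (a n) * r2 ^+ n) * (n.+1%:R ^+ 2 * 8^-1 ^+ n) * k <= _).
    rewrite /rho exprMn le_eqVlt; apply/orP; left; apply/eqP; ring.
  rewrite [leRHS]mulrAC ler_wpM2r// ler_pM ?mulr_ge0 ?normc_ge0 ?exprn_ge0 ?(ltW r20)//.
  have -> : 8^-1 = 4^-1 * 2^-1 :> R by rewrite -invfM -natrM.
  rewrite exprMn mulrA -[leRHS]mul1r ler_wpM2r ?exprn_ge0//.
  rewrite exprVn ler_pdivrMr ?exprn_gt0// mul1r -natrX -[4]/(4%:R) -natrX ler_nat.
  by rewrite (_ : 4 = 2 ^ 2)%N// -expnM mulnC expnM leq_exp2r// ltn_expl.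
exists (b * k * 2); first by rewrite !mulr_ge0.
apply: (@tame_limit R _ (fun n z => series (fun n => a n * (z - z0) ^+ n : C) n)).
  move=> n; apply: tame_le (_ : b * k * \sum_(0 <= i < n) 2^-1 ^+ i <= _) _.
    by rewrite ler_wpM2l ?mulr_ge0// geometric_le2// lexx invr_ge0 ler0n.
  rewrite /series /=; elim: n => [|n IH].
    rewrite big_geq// mulr0.
    have : tame (cball z0 rho) (fun=> 0 : R[i]) 0 by rewrite -[X in tame _ _ X](@normc0 R); exact: tame_cst.
    by apply: tame_eq => z _; rewrite big_geq.
  rewrite big_nat_recr//= mulrDr; have := tameD IH (term n).
  by apply: tame_eq => z _; rewrite big_nat_recr.
move=> z zr; apply: aH; apply: lt_le_trans zr _; rewrite /rho /r2; move: r0; lra.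
Qed.

(* Holomorphy at [z0] with derivative [d].  The divided difference [H1] is part
   of the data, so that quotients with a removable singularity are [tame]. *)
Definition good H z0 d := exists r c H1,
  [/\ 0 < r, 0 <= c, tame (cball z0 r) H c, tame (cball z0 r) H1 c &
      H1 z0 = d /\ forall z, H z - H z0 = (z - z0) * H1 z].

(** The divided difference at [z0] is again a power series on the same disc, with the coefficients
    shifted by one, so [pseries_tame] applies to it as well. *)
Lemma pseries_good (a : nat -> C) z0 r H : 0 < r ->
  (forall z, normc (z - z0) < r ->
    series (fun n => a n * (z - z0) ^+ n : C) @ \oo --> (H z : C)) ->
  good H z0 (a 1).
Proof.
move=> r0 aH.
have H0 : H z0 = a 0.
  apply/eqP; rewrite -subr_eq0; apply/eqP/eq0_normc/le_anti.
  rewrite normc_ge0 andbT; apply/ler_addgt0Pr => e e0; rewrite add0r.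
  have := aH z0; rewrite subrr normc0 => /(_ r0)/cvg_normcP/(_ e e0)[N _ hN].
  have := hN N.+1 (leqnSn N); rewrite normcB /series /= big_nat_recl// big1 => [|i _].
    by rewrite expr0 mulr1 addr0 => /ltW.
  by rewrite exprS mul0r mulr0.
pose H1 z := if z == z0 then a 1 else (H z - H z0) / (z - z0).
have aH1 z : normc (z - z0) < r ->
    series (fun n => a n.+1 * (z - z0) ^+ n : C) @ \oo --> (H1 z : C).
  move=> zr; apply/cvg_normcP => e e0.
  have S n : series (fun n => a n * (z - z0) ^+ n : C) n.+1 = a 0 +
      (z - z0) * series (fun n => a n.+1 * (z - z0) ^+ n : C) n.
    rewrite /series /= big_nat_recl// expr0 mulr1 mulr_sumr; congr (_ + _).
    by apply: eq_bigr => i _; rewrite exprS; ring.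
  rewrite /H1; case: eqP => [->|/eqP zz].
    exists 1%N => // -[//|n] _; rewrite /series /= big_nat_recl// big1 => [|i _].
      by rewrite expr0 mulr1 addr0 subrr normc0.
    by rewrite subrr exprS mul0r mulr0.
  have zz0 : z - z0 != 0 by rewrite subr_eq0.
  have n0 := normc_gt0 zz0.
  have /cvg_normcP/(_ _ (mulr_gt0 e0 n0))[N _ hN] := aH z zr.
  exists N => // n /= Nn; have := hN n.+1 (leqW Nn); rewrite S -H0.
  rewrite -ltr_pdivrMr//; apply: le_lt_trans.
  rewrite -normcV -normcM le_eqVlt; apply/orP; left; apply/eqP; congr normc.
  by field.
have [e1 /andP[e10 e1r] [c1 c10 t1]] := pseries_tame r0 aH.
have [e2 /andP[e20 e2r] [c2 c20 t2]] := pseries_tame r0 aH1.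
exists (Num.min e1 e2), (c1 + c2), H1; split.
- by rewrite lt_min e10.
- by rewrite addr_ge0.
- apply: (@tame_le _ _ _ c1); first by rewrite lerDl.
  by apply: tame_sub t1 => z; rewrite /cball /= lt_min => /andP[].
- apply: (@tame_le _ _ _ c2); first by rewrite lerDr.
  by apply: tame_sub t2 => z; rewrite /cball /= lt_min => /andP[].
split; first by rewrite /H1 eqxx.
move=> z; rewrite /H1; case: eqP => [->|/eqP zz]; first by rewrite !subrr mul0r.
by rewrite mulrC divfK// subr_eq0.
Qed.

Lemma analytic_good U H z0 : analytic_on U H -> U z0 -> exists d, good H z0 d.
Proof.
by move=> aH /aH[a [r r0 h]]; exists (a 1); exact: (pseries_good r0 h).
Qed.

Lemma good_common H K z0 d d' : good H z0 d -> good K z0 d' -> exists r c H1 K1,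
  [/\ 0 < r, 0 <= c, tame (cball z0 r) H c /\ tame (cball z0 r) H1 c,
      tame (cball z0 r) K c /\ tame (cball z0 r) K1 c &
   [/\ H1 z0 = d, K1 z0 = d', (forall z, H z - H z0 = (z - z0) * H1 z) &
      (forall z, K z - K z0 = (z - z0) * K1 z)]].
Proof.
move=> [e1 [c1 [H1 [e10 c10 t1 t1' [E1 D1]]]]] [e2 [c2 [K1 [e20 c20 t2 t2' [E2 D2]]]]].
have s1 : cball z0 (Num.min e1 e2) `<=` cball z0 e1.
  by move=> z; rewrite /cball /= lt_min => /andP[].
have s2 : cball z0 (Num.min e1 e2) `<=` cball z0 e2.
  by move=> z; rewrite /cball /= lt_min => /andP[].
have l1 : c1 <= c1 + c2 by rewrite lerDl.
have l2 : c2 <= c1 + c2 by rewrite lerDr.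
exists (Num.min e1 e2), (c1 + c2), H1, K1; split=> //.
- by rewrite lt_min e10.
- by rewrite addr_ge0.
- by split; [exact: tame_le l1 (tame_sub s1 t1)|exact: tame_le l1 (tame_sub s1 t1')].
- by split; [exact: tame_le l2 (tame_sub s2 t2)|exact: tame_le l2 (tame_sub s2 t2')].
Qed.

Lemma good_cst (a : R[i]) z0 : good (fun=> a) z0 0.
Proof.
have n0 := normc_ge0 a.
exists 1, (normc a), (fun=> 0); split=> //; first exact: tame_cst.
  by apply: (@tame_le _ _ _ (normc (0 : R[i]))); [rewrite normc0|exact: tame_cst].
by split=> // z; rewrite subrr mulr0.
Qed.

Lemma goodD H K z0 d d' : good H z0 d -> good K z0 d' ->
  good (fun z => H z + K z) z0 (d + d').
Proof.
move=> hH hK; have [r [c [H1 [K1 [r0 c0 [t1 t1'] [t2 t2'] [E1 E2 D1 D2]]]]]] :=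
  good_common hH hK.
exists r, (c + c), (fun z => H1 z + K1 z); split; rewrite ?addr_ge0//.
- exact: tameD.
- exact: tameD.
by split=> [|z]; [rewrite E1 E2|rewrite mulrDr -D1 -D2; ring].
Qed.

Lemma goodM H K z0 d d' : good H z0 d -> good K z0 d' ->
  good (fun z => H z * K z) z0 (d * K z0 + H z0 * d').
Proof.
move=> hH hK; have [r [c [H1 [K1 [r0 c0 [t1 t1'] [t2 t2'] [E1 E2 D1 D2]]]]]] :=
  good_common hH hK.
have n0 := normc_ge0 (H z0).
have m0 : 0 <= 3 * c * c by rewrite !mulr_ge0.
exists r, (3 * c * c + normc (H z0) * c), (fun z => H1 z * K z + H z0 * K1 z); split=> //.
- by rewrite addr_ge0// mulr_ge0.
- by apply: (@tame_le _ _ _ (3 * c * c)); [rewrite lerDl mulr_ge0|exact: tameM].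
- by apply: tameD; [exact: tameM|exact: tameZ].
split=> [|z]; first by rewrite E1 E2.
rewrite mulrDr [X in _ = _ + X]mulrCA -D2 mulrA -D1; ring.
Qed.

Lemma goodZ H z0 d (a : R[i]) : good H z0 d -> good (fun z => a * H z) z0 (a * d).
Proof.
by move=> /(goodM (good_cst a z0)); rewrite mul0r add0r.
Qed.

Lemma good_shift H z0 s d : good H (z0 + s) d -> good (fun z => H (z + s)) z0 d.
Proof.
move=> [r [c [H1 [r0 c0 t1 t2 [E1 D1]]]]].
exists r, c, (fun z => H1 (z + s)).
have sub : cball z0 r `<=` [set z | cball (z0 + s) r (z + s)].
  by move=> z; rewrite /cball /= (_ : z + s - (z0 + s) = z - z0)//; ring.
split=> //.
- by apply: tame_sub sub _; apply/tame_shift.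
- by apply: tame_sub sub _; apply/tame_shift.
by split=> // z; rewrite D1; congr (_ * _); ring.
Qed.

Lemma good_sum n (H : nat -> R[i] -> R[i]) z0 : (forall j, exists d, good (H j) z0 d) ->
  exists d, good (fun z => \sum_(j < n) H j z) z0 d.
Proof.
move=> hH; elim: n => [|n [d IH]].
  by exists 0; under eq_fun do rewrite big_ord0; exact: good_cst.
have [d' h] := hH n; exists (d + d').
by under eq_fun do rewrite big_ord_recr; exact: goodD.
Qed.

End Good.

(** * Discrete contour shift *)

Section Waves.
Context {R : realType}.
Local Open Scope complex_scope.
Local Notation C := (R[i]^o).
Local Notation tau := (pi *+ 2 : R).
Implicit Types (a b x y : R) (z w : R[i]).

Definition wave a z : R[i] := cexp ('i * a%:C * z).

Lemma wave_add a z w : wave a (z + w) = wave a z * wave a w.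
Proof. by rewrite /wave mulrDr cexpD. Qed.

Lemma iaE a x y : 'i * a%:C * (x +i* y) = (- a * y) +i* (a * x) :> R[i].
Proof. by apply/eqP; rewrite eq_complex /=; apply/andP; split; apply/eqP; ring. Qed.

Lemma normc_wave a z : normc (wave a z) = expR (- a * complex.Im z).
Proof. by case: z => x y; rewrite /wave normc_cexp iaE. Qed.

Lemma wave_real a x : wave a x%:C = cos (a * x) +i* sin (a * x).
Proof.
rewrite /wave -[x%:C]/(x +i* 0) iaE /cexp /= mulr0 expR0.
by apply/eqP; rewrite eq_complex /=; apply/andP; split; apply/eqP; ring.
Qed.

Lemma wave_shift a x y z : a * x = y -> wave a (z + x%:C) = wave a z * (cos y +i* sin y).
Proof. by move=> <-; rewrite wave_add wave_real. Qed.

Lemma cos_sin_tau (n : int) : cos (tau * n%:~R) +i* sin (tau * n%:~R) = 1 :> R[i].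
Proof.
rewrite -[tau * _]add0r (period_int n 0 (@cosD2pi R)) (period_int n 0 (@sinD2pi R)).
by rewrite cos0 sin0.
Qed.

Lemma wave_period (n : int) z : wave n%:~R (z + tau%:C) = wave n%:~R z.
Proof. by rewrite (wave_shift _ (mulrC _ _)) cos_sin_tau mulr1. Qed.

(** On this disc both parts of i a (z - z0) are at most 1/4 in absolute value, the range of
    [cexp_series]; the summand 1 covers [a = 0]. *)
Lemma wave_pseries a (c z0 : R[i]) z : normc (z - z0) < (4 * (`|a| + 1))^-1 ->
  series (fun n => (c * wave a z0 * (('i * a%:C) ^+ n * (n`!%:R)^-1)) * (z - z0) ^+ n : C)
    @ \oo --> (c * wave a z : C).
Proof.
move=> zr; have a1 : 0 < `|a| + 1 by rewrite ltr_wpDl.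
set d := z - z0 in zr *.
have uvE : 'i * a%:C * d = (- a * complex.Im d) +i* (a * complex.Re d).
  by case: (d) => x y; exact: iaE.
have small (u : R) : `|u| <= normc d -> `|a| * `|u| <= 4^-1.
  move=> ud; apply: le_trans (_ : (`|a| + 1) * normc d <= _).
    by apply: ler_pM => //; rewrite lerDl.
  by rewrite -ler_pdivlMl// mulrC -invfM ltW.
have Red : `|complex.Re d| <= normc d.
  case: (d) => x y /=; rewrite -[X in X <= _]sqrtr_sqr ler_wsqrtr// lerDl sqr_ge0//.
have Imd : `|complex.Im d| <= normc d.
  case: (d) => x y /=; rewrite -[X in X <= _]sqrtr_sqr ler_wsqrtr// lerDr sqr_ge0//.
have uv : `|- a * complex.Im d| + `|a * complex.Re d| <= 2^-1.
  rewrite !normrM normrN; have := small _ Red; have := small _ Imd.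
  by lra.
have := cexp_series uv; rewrite -uvE => /cvg_normcP h; apply/cvg_normcP => e e0.
have n1 : 0 < normc (c * wave a z0) + 1 by rewrite ltr_wpDl// normc_ge0.
have := h _ (divr_gt0 e0 n1); apply: filterS => n hn.
have -> : c * wave a z = c * wave a z0 * cexp ('i * a%:C * d).
  by rewrite -[z in LHS](subrK z0) addrC wave_add mulrA.
have -> : series (fun n => (c * wave a z0 * (('i * a%:C) ^+ n * (n`!%:R)^-1)) * d ^+ n : C) n =
    c * wave a z0 * series (fun n => (n`!%:R)^-1 * ('i * a%:C * d) ^+ n : C) n.
  rewrite /series /= mulr_sumr; apply: eq_bigr => i _.
  by rewrite [in RHS]exprMn; ring.
rewrite -mulrBr normcM.
apply: le_lt_trans (_ : (normc (c * wave a z0) + 1) * _ < _).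
  by apply: ler_wpM2r; [exact: normc_ge0|rewrite lerDl].
by rewrite mulrC -ltr_pdivlMr.
Qed.

Lemma wave_analytic U c a : analytic_on U (fun z => c * wave a z : C).
Proof.
move=> z0 _; exists (fun n => c * wave a z0 * (('i * a%:C) ^+ n * (n`!%:R)^-1)).
exists (4 * (`|a| + 1))^-1; first by rewrite invr_gt0 mulr_gt0// ltr_wpDl.
by move=> z zr; exact: wave_pseries.
Qed.

Lemma wave_good a z0 : good (wave a) z0 ('i * a%:C * wave a z0).
Proof.
have r0 : 0 < (4 * (`|a| + 1))^-1 by rewrite invr_gt0 mulr_gt0// ltr_wpDl.
have := @pseries_good R (fun n => 1 * wave a z0 * (('i * a%:C) ^+ n * (n`!%:R)^-1))
  z0 _ (fun z => 1 * wave a z) r0 (fun z => @wave_pseries a 1 z0 z).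
rewrite (_ : 1`!%:R = 1 :> R[i])// invr1 expr1 mulr1 mul1r mulrC.
by under eq_fun do rewrite mul1r.
Qed.

Lemma cos_eq1 x : cos x = 1 -> exists m : int, x = tau * m%:~R.
Proof.
move=> cx; have [m /andP[m0 m1]] := period_representative x (@tau_gt0 R).
exists (- m); apply/eqP; rewrite mulrNz mulrN -addr_eq0; apply/eqP.
have := period_int m x (@cosD2pi R); rewrite cx.
set y := x + _ in m0 m1 *.
have -> : y = (y / 2) *+ 2 by rewrite -mulr_natr divfK// pnatr_eq0.
rewrite cos_mulr2n => c2.
have s2 : sin (y / 2) ^+ 2 = 0.
  by have := cos2Dsin2 (y / 2); move: c2; rewrite mulr2n; lra.
apply/eqP; rewrite mulrn_eq0 /= -[_ == 0]negbK; apply/negP => yn.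
have : 0 < sin (y / 2).
  apply: sin_gt0_pi; rewrite lt_neqAle eq_sym yn divr_ge0//=.
  by rewrite ltr_pdivrMr// mulr_natr.
by move/eqP: s2; rewrite sqrf_eq0 => /eqP ->; rewrite ltxx.
Qed.

End Waves.

Section ContourShift.
Context {R : realType}.
Local Open Scope complex_scope.
Local Notation C := (R[i]^o).
Local Notation tau := (pi *+ 2 : R).
Implicit Types (H : R[i] -> R[i]) (P : set R[i]) (x y eta : R) (z w : R[i]).

(* The abscissas are shifted by half a step to keep away from the real
   multiples of 2pi/M, where the kernel below is singular. *)
Definition grid (L : nat) y (k : nat) : R[i] :=
  (tau * ((k%:R + 2^-1) / L%:R)) +i* y.

Definition grid_mean L y H : R[i] := L%:R^-1 * \sum_(k < L) H (grid L y k).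

Lemma normc_nat n : normc (n%:R : R[i]) = n%:R.
Proof. by have := normc_real (n%:R : R); rewrite rmorph_nat normr_nat. Qed.

Lemma normc_mean_le (L : nat) (u : nat -> R[i]) b : (0 < L)%N ->
  (forall k, (k < L)%N -> normc (u k) <= b) ->
  normc (L%:R^-1 * \sum_(k < L) u k) <= b.
Proof.
move=> L0 ub; have LR : 0 < L%:R :> R by rewrite ltr0n.
rewrite normcM normcV normc_nat ler_pdivrMl// -(big_mkord xpredT u).
apply: le_trans (normc_sum _ _) _; rewrite big_mkord.
apply: le_trans (_ : \sum_(k < L) b <= _); first by apply: ler_sum => k _; exact: ub.
by rewrite sumr_const card_ord mulr_natl.
Qed.

Lemma normc_le_sum x y : normc (x +i* y) <= `|x| + `|y|.
Proof.
have -> : x +i* y = x%:C + 'i * y%:C.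
  by apply/eqP; rewrite eq_complex /=; apply/andP; split; apply/eqP; ring.
apply: le_trans (le_normcD _ _) _; rewrite normcM !normc_real.
by rewrite (_ : normc 'i = 1) ?mul1r//= expr0n expr1n add0r sqrtr1.
Qed.

(** A Lebesgue number argument. A single integer serves as inverse radius and as constant, because
    increasing it weakens both requirements. *)
Lemma uniformly_tame H P eta :
  (forall z0, `|complex.Im z0| <= eta ->
    exists r c, 0 < r /\ tame (cball z0 r `&` P) H c) ->
  exists n : nat, forall x y, 0 <= x <= tau -> `|y| <= eta ->
    tame (cball (x +i* y) n.+1%:R^-1 `&` P) H n%:R.
Proof.
move=> hH.
have cK : compact (`[0, tau]%classic `*` `[- eta, eta]%classic : set (R * R)).
  by apply: compact_setX; exact: segment_compact.
move: cK; rewrite compact_near_coveringP => cov.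
have : \forall n \near \oo, `[0, tau]%classic `*` `[- eta, eta]%classic `<=`
    [set p : R * R | tame (cball (p.1 +i* p.2) n.+1%:R^-1 `&` P) H n%:R].
  apply: (cov nat \oo (fun n p => tame (cball (p.1 +i* p.2) n.+1%:R^-1 `&` P) H n%:R)) => -[x y] [/= _].
  rewrite in_itv /= -ler_norml => yeta.
  have [r [c [r0 t]]] := hH (x +i* y) yeta.
  exists (ball (x, y) (r / 4), [set n | (2 / r < n.+1%:R) /\ (c <= n%:R)]).
    split; first by apply: nbhsx_ballx; rewrite divr_gt0.
    near=> n; split=> /=; last by near: n; exact: nbhs_infty_ger.
    by apply: (@lt_trans _ _ n%:R); [near: n; exact: nbhs_infty_gtr|rewrite ltr_nat].
  move=> [[x' y'] n] /= [[bx byy] [nr nc]]; apply: tame_le nc _.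
  apply: tame_sub t => z [/= zb Pz]; split=> //; rewrite /cball /= in zb *.
  have -> : z - (x +i* y) = (z - (x' +i* y')) + ((x' - x) +i* (y' - y)).
    by case: z {zb Pz} => u v; apply/eqP; rewrite eq_complex /=; apply/andP; split; apply/eqP; ring.
  apply: le_lt_trans (le_normcD _ _) _.
  have h1 : normc (z - (x' +i* y')) < r / 2.
    apply: lt_trans zb _; rewrite -[r / 2]invf_div ltf_pV2// posrE ?divr_gt0//.
  have := normc_le_sum (x' - x) (y' - y).
  rewrite /ball /= in bx byy; rewrite distrC [`|y' - y|]distrC.
  by move: bx byy h1; lra.
case=> n _ hn; exists n => x y xI yI.
apply: (hn n (leqnn n) (x, y)); split => /=; first by rewrite in_itv.
by rewrite in_itv /= -ler_norml.
Unshelve. all: by end_near. Qed.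

(** A discrete Cauchy theorem. On a cell of width s and height h, the second difference bound says
    that the vertical increment of [H] is i h / s times the horizontal one, up to O(h (h + s)).
    Horizontal increments telescope to 0 over a period. With s and h of order 1 / L, the L^2 cells
    contribute O(1) to the sums and O(1 / L) to the means. [H] is only evaluated at grid points, so
    it may be singular off [P]. *)
Lemma contour_shift H P eta : 0 < eta ->
  (forall z0, `|complex.Im z0| <= eta ->
    exists r c, 0 < r /\ tame (cball z0 r `&` P) H c) ->
  (forall z, `|complex.Im z| <= eta -> H (z + tau%:C) = H z) ->
  forall e, 0 < e -> exists L0, forall L, (L0 <= L)%N -> (0 < L)%N ->
    (forall k y, P (grid L y k)) ->
    normc (grid_mean L eta H - grid_mean L (- eta) H) <= e.
Proof.
move=> eta0 hH Hper e e0; have [n hn] := uniformly_tame hH.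
have t0 := @tau_gt0 R; set T := tau in t0 hn Hper *.
(* The first summand makes a cell smaller than the radius of uniform tameness, the second makes the
   final error at most [e]. *)
pose L0 := (Num.truncn ((T + 2 * eta) * n.+1%:R + n%:R * (2 * eta + T) * (2 * eta) / e)).+1.
exists L0 => L LL0 Lpos PL.
have Lr : 0 < L%:R :> R by rewrite ltr0n.
have Lbig : (T + 2 * eta) * n.+1%:R + n%:R * (2 * eta + T) * (2 * eta) / e < L%:R.
  by apply: lt_le_trans (truncnS_gt _) _; rewrite ler_nat.
have p1 : 0 <= (T + 2 * eta) * n.+1%:R by rewrite mulr_ge0// addr_ge0 ?mulr_ge0// ltW.
have p2 : 0 <= n%:R * (2 * eta + T) * (2 * eta) / e.
  have te : 0 <= 2 * eta + T by move: eta0 t0; lra.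
  have e2 : 0 <= 2 * eta by move: eta0; lra.
  apply: divr_ge0; last exact: ltW.
  by apply: mulr_ge0 => //; apply: mulr_ge0.
pose s := T / L%:R; pose h := 2 * eta / L%:R.
have s0 : 0 < s by rewrite divr_gt0.
have h0 : 0 < h by rewrite divr_gt0// mulr_gt0.
have sh : s + h < n.+1%:R^-1.
  rewrite /s /h -mulrDl ltr_pdivrMr// -ltr_pdivrMl ?invr_gt0// invrK mulrC.
  by move: Lbig p2; lra.
pose y l := - eta + h * l%:R.
have yI l : (l <= L)%N -> `|y l| <= eta.
  move=> lL; have : h * l%:R <= h * L%:R by rewrite ler_pM2l// ler_nat.
  have : 0 <= h * l%:R by rewrite mulr_ge0// ltW.
  rewrite /h divfK ?gt_eqF// -/h ler_norml /y; lra.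
have y0 : y 0 = - eta by rewrite /y mulr0 addr0.
have yL : y L = eta by rewrite /y /h divfK ?gt_eqF//; ring.
have zs l k : grid L (y l) k.+1 = grid L (y l) k + s%:C.
  apply/eqP; rewrite eq_complex /= addr0 eqxx andbT; apply/eqP.
  by rewrite -natr1 -/T /s; ring.
have zh l k : grid L (y l.+1) k = grid L (y l) k + 'i * h%:C.
  apply/eqP; rewrite eq_complex /= /y -natr1; apply/andP; split; apply/eqP; ring.
have step l : (l < L)%N -> normc (\sum_(k < L) H (grid L (y l.+1) k) -
    \sum_(k < L) H (grid L (y l) k)) <= L%:R * (n%:R * (h + s) * h).
  move=> lL; set A := \sum_(k < L) _; set B := \sum_(k < L) _.
  have tel : \sum_(k < L) (H (grid L (y l) k.+1) - H (grid L (y l) k)) = 0.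
    rewrite -(big_mkord xpredT (fun k => H (grid L (y l) k.+1) - H (grid L (y l) k))).
    rewrite telescope_sumr//.
    have -> : grid L (y l) L = grid L (y l) 0 + T%:C.
      apply/eqP; rewrite eq_complex /= addr0 eqxx andbT -/T; apply/eqP; field.
      by rewrite gt_eqF.
    by rewrite Hper ?subrr//= yI// ltnW.
  have -> : A - B = \sum_(k < L) ((H (grid L (y l.+1) k) - H (grid L (y l) k)) -
      ('i * h%:C / s%:C) * (H (grid L (y l) k.+1) - H (grid L (y l) k))).
    by rewrite sumrB -mulr_sumr tel mulr0 subr0 sumrB.
  have nsum (u : nat -> R[i]) c : (forall k, (k < L)%N -> normc (u k) <= c) ->
      normc (\sum_(k < L) u k) <= L%:R * c.
    move=> uc; rewrite -(big_mkord xpredT u); apply: le_trans (normc_sum _ _) _.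
    rewrite big_mkord; apply: le_trans (_ : \sum_(k < L) c <= _).
      by apply: ler_sum => k _; exact: uc.
    by rewrite sumr_const card_ord mulr_natl.
  apply: (nsum (fun k => (H (grid L (y l.+1) k) - H (grid L (y l) k)) -
      ('i * h%:C / s%:C) * (H (grid L (y l) k.+1) - H (grid L (y l) k)))) => k kL.
  set w := grid L (y l) k.
  have wI : 0 <= T * ((k%:R + 2^-1) / L%:R) <= T.
    apply/andP; split.
      apply: mulr_ge0; first exact: ltW.
      by apply: divr_ge0; [rewrite addr_ge0// invr_ge0|exact: ltW].
    rewrite ler_piMr ?(ltW t0)// ler_pdivrMr// mul1r.
    have : k.+1%:R <= L%:R :> R by rewrite ler_nat.
    by rewrite -natr1; lra.
  have nh : normc ('i * h%:C : R[i]) = h.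
    by rewrite normcM normc_real gtr0_norm//= expr0n expr1n add0r sqrtr1 mul1r.
  have ns : normc s%:C = s by rewrite normc_real gtr0_norm.
  have nr0 : 0 < n.+1%:R^-1 :> R by rewrite invr_gt0.
  have Bw : (cball w n.+1%:R^-1 `&` P) w.
    by split; [rewrite /cball /mkset subrr normc0|exact: PL].
  have Bz : (cball w n.+1%:R^-1 `&` P) (grid L (y l.+1) k).
    split; last exact: PL.
    by rewrite /cball /mkset zh addrAC subrr add0r nh; apply: le_lt_trans sh; rewrite lerDr ltW.
  have Bz' : (cball w n.+1%:R^-1 `&` P) (grid L (y l) k.+1).
    split; last exact: PL.
    by rewrite /cball /mkset zs addrAC subrr add0r ns; apply: le_lt_trans sh; rewrite lerDl ltW.
  have dz : grid L (y l.+1) k - w = 'i * h%:C by rewrite zh -/w addrAC subrr add0r.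
  have dz' : grid L (y l) k.+1 - w = s%:C by rewrite zs -/w addrAC subrr add0r.
  have dzz : grid L (y l.+1) k - grid L (y l) k.+1 = 'i * h%:C - s%:C.
    by rewrite -dz -dz'; ring.
  have [_ _] := hn _ _ wI (yI _ (ltnW lL)) _ _ _ Bz Bz' Bw.
  rewrite /second_difference -/w dz dz' dzz.
  rewrite nh ns => hh.
  have sC : s%:C != 0 :> R[i] by rewrite -[0]/(0%:C) (inj_eq (@complexI _)) gt_eqF.
  have -> : H (grid L (y l.+1) k) - H w - 'i * h%:C / s%:C * (H (grid L (y l) k.+1) - H w) =
     ((H (grid L (y l.+1) k) - H w) * s%:C - (H (grid L (y l) k.+1) - H w) * ('i * h%:C)) / s%:C.
    by field.
  rewrite normcM normcV ns ler_pdivrMr//; apply: le_trans hh _.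
  rewrite ler_wpM2r ?(ltW s0)// ler_wpM2r ?(ltW h0)// ler_wpM2l//.
  by apply: le_trans (le_normcD _ _) _; rewrite normcN nh ns.
have total l : (l <= L)%N -> normc (\sum_(k < L) H (grid L (y l) k) -
    \sum_(k < L) H (grid L (y 0) k)) <= l%:R * (L%:R * (n%:R * (h + s) * h)).
  elim: l => [|l IH] lL; first by rewrite subrr normc0 mul0r.
  rewrite -natr1 mulrDl mul1r.
  have := step l lL; have := IH (ltnW lL).
  set D := \sum_(k < L) H (grid L (y l.+1) k); set D' := \sum_(k < L) H (grid L (y 0) k).
  set D1 := \sum_(k < L) H (grid L (y l) k) => h1 h2.
  have -> : D - D' = (D1 - D') + (D - D1) by ring.
  by apply: le_trans (le_normcD _ _) _; exact: lerD.
have := total L (leqnn L); rewrite yL y0 => tot.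
have LC : normc (L%:R^-1 : R[i]) = L%:R^-1.
  by rewrite normcV normc_nat.
rewrite /grid_mean -mulrBr normcM LC ler_pdivrMl//; apply: le_trans tot _.
have -> : L%:R * (L%:R * (n%:R * (h + s) * h)) = n%:R * (2 * eta + T) * (2 * eta).
  by rewrite /h /s; field; rewrite gt_eqF.
by rewrite -ler_pdivrMr//; move: Lbig p1; lra.
Qed.

End ContourShift.

(** * Interpolation coefficients of analytic functions *)

Section Bessel.
Context {R : realType}.
Local Open Scope complex_scope.
Local Notation tau := (pi *+ 2 : R).
Implicit Types (x y : R).

Definition cis x : R[i] := cos x +i* sin x.

Lemma cisD x y : cis (x + y) = cis x * cis y.
Proof.
rewrite /cis sinD cosD; apply/eqP; rewrite eq_complex /=.
by apply/andP; split; apply/eqP; ring.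
Qed.

Lemma cis0 : cis 0 = 1. Proof. by rewrite /cis cos0 sin0. Qed.

Lemma cis_int (n : int) : cis (tau * n%:~R) = 1.
Proof. exact: cos_sin_tau. Qed.

Lemma cisX x n : cis (x * n%:R) = cis x ^+ n.
Proof.
by elim: n => [|n IH]; rewrite ?mulr0 ?cis0// -natr1 mulrDr mulr1 cisD IH exprSr.
Qed.

Lemma conjc_cis x : conjc (cis x) = cis (- x).
Proof. by rewrite /cis cosN sinN. Qed.

Lemma cis_eq1 x : cis x = 1 -> exists m : int, x = tau * m%:~R.
Proof. by case=> /cos_eq1. Qed.

Lemma normc_cis x : normc (cis x) = 1.
Proof. by rewrite /= cos2Dsin2 sqrtr1. Qed.

Lemma sum_cis L (d : int) : (0 < L)%N ->
  \sum_(k < L) cis (tau * d%:~R / L%:R * k%:R) = if (L%:Z %| d)%Z then L%:R else 0.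
Proof.
move=> L0; have LR : L%:R != 0 :> R by rewrite pnatr_eq0 -lt0n.
set x := tau * d%:~R / L%:R.
have xL : cis x ^+ L = 1 by rewrite -cisX /x divfK// cis_int.
case: ifP => [/dvdzP[e de]|nd].
  have -> : x = tau * e%:~R by rewrite /x de intrM -pmulrn; field.
  under eq_bigr do rewrite cisX cis_int expr1n.
  by rewrite sumr_const card_ord.
have x1 : cis x - 1 != 0.
  rewrite subr_eq0; apply/eqP => /cis_eq1[m xm]; move/negP: nd; apply.
  apply/dvdzP; exists m; apply/eqP; rewrite -(eqr_int R) intrM -pmulrn; apply/eqP.
  apply: (mulfI (lt0r_neq0 (@tau_gt0 R))).
  by rewrite mulrA -xm /x divfK.
apply: (mulfI x1); rewrite mulr0; under eq_bigr do rewrite cisX.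
by rewrite -subrX1 xL subrr.
Qed.

Lemma mul_conjc (z : R[i]) : z * conjc z = (normc z ^+ 2)%:C.
Proof.
case: z => a b; rewrite /= sqr_sqrtr ?addr_ge0 ?sqr_ge0//.
by apply/eqP; rewrite eq_complex /=; apply/andP; split; apply/eqP; ring.
Qed.

(** Distinct frequencies below L are orthogonal on the L grid points. For the projection [w] of [v]
    on their span, L S is both <v, w> and <w, w>. Then |v| |w| <= B^2 / 2 + |w|^2 / 2 gives L S <= L
    B^2 / 2 + L S / 2. *)
Lemma bessel L Q (v : nat -> R[i]) (m : nat -> nat) B : (0 < L)%N ->
  (forall i j, (i < Q)%N -> (j < Q)%N -> m i = m j -> i = j) ->
  (forall i, (i < Q)%N -> (m i < L)%N) -> (forall k, (k < L)%N -> normc (v k) <= B) ->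
  \sum_(i < Q) normc (L%:R^-1 *
    \sum_(k < L) v k * cis (- ((m i)%:R * (tau * ((k%:R + 2^-1) / L%:R))))) ^+ 2 <= B ^+ 2.
Proof.
move=> L0 mI mL vB; pose theta (k : nat) : R := tau * ((k%:R + 2^-1) / L%:R).
have LR : L%:R != 0 :> R by rewrite pnatr_eq0 -lt0n.
have LC : L%:R != 0 :> R[i] by rewrite pnatr_eq0 -lt0n.
have Lpos : 0 < L%:R :> R by rewrite ltr0n.
pose c i := L%:R^-1 * \sum_(k < L) v k * cis (- ((m i)%:R * theta k)).
pose w k := \sum_(i < Q) c i * cis ((m i)%:R * theta k).
pose S := \sum_(i < Q) normc (c i) ^+ 2.
change (S <= B ^+ 2).
have cjsum n (u : nat -> R[i]) : conjc (\sum_(i < n) u i) = \sum_(i < n) conjc (u i).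
  exact: (raddf_sum (@conjc R)).
have conjM (x y : R[i]) : conjc (x * y) = conjc x * conjc y.
  case: x y => [x1 x2] [y1 y2]; apply/eqP; rewrite eq_complex /=.
  by apply/andP; split; apply/eqP; ring.
have orth i j : (i < Q)%N -> (j < Q)%N ->
    \sum_(k < L) cis ((m i)%:R * theta k) * cis (- ((m j)%:R * theta k)) =
    if i == j then L%:R else 0.
  move=> iQ jQ; pose d := (m i)%:Z - (m j)%:Z.
  under eq_bigr => k _.
    rewrite -cisD (_ : _ + _ = tau * d%:~R / L%:R * 2^-1 + tau * d%:~R / L%:R * k%:R).
      rewrite cisD; over.
    by rewrite /d intrB -!pmulrn /theta; field.
  rewrite -mulr_sumr sum_cis//.
  have [ij|ij] := eqVneq i j.
    by rewrite /d ij subrr dvdz0 mulr0 mul0r mul0r cis0 mul1r.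
  rewrite ifF ?mulr0//; apply/negP => /dvdzP[e]; rewrite /d => E.
  have mi := mL i iQ; have mj := mL j jQ.
  move/eqP: ij; apply; apply: mI => //.
  clear -E mi mj; case: e E => [[|n]|n].
  - lia.
  - rewrite -PoszM mulSn; lia.
  - rewrite NegzE mulNr -PoszM mulSn; lia.
have Sv : (L%:R * S)%:C = \sum_(k < L) v k * conjc (w k).
  rewrite /w; under [RHS]eq_bigr => k _.
    rewrite (cjsum Q (fun i => c i * cis ((m i)%:R * theta k))) mulr_sumr; over.
  rewrite exchange_big /= rmorphM rmorph_nat /S rmorph_sum /= mulr_sumr.
  apply: eq_bigr => i _; rewrite -mul_conjc.
  under [RHS]eq_bigr => k _ do rewrite conjM conjc_cis mulrCA.
  by rewrite -mulr_sumr mulrCA [in RHS]mulrC /c; field.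
have Sw : (L%:R * S)%:C = \sum_(k < L) w k * conjc (w k).
  rewrite /w; under [RHS]eq_bigr => k _.
    rewrite (cjsum Q (fun i => c i * cis ((m i)%:R * theta k))) mulr_sumr.
    under eq_bigr => j _ do rewrite mulr_suml.
    over.
  rewrite exchange_big /= rmorphM rmorph_nat /S rmorph_sum /= mulr_sumr.
  apply: eq_bigr => j _; rewrite exchange_big /=.
  have E (i : 'I_Q) : \sum_(k < L) c i * cis ((m i)%:R * theta k) *
      conjc (c j * cis ((m j)%:R * theta k)) =
      c i * conjc (c j) * (if i == j then L%:R else 0).
    rewrite -(orth i j)// mulr_sumr; apply: eq_bigr => k _.
    by rewrite conjM conjc_cis; ring.
  under [RHS]eq_bigr => i _ do rewrite E.
  rewrite (bigD1 j)//= eqxx big1 ?addr0 => [|i /negbTE ij]; last by rewrite ij mulr0.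
  by rewrite -mul_conjc; ring.
have ww : L%:R * S = \sum_(k < L) normc (w k) ^+ 2.
  apply: (@complexI R); rewrite Sw rmorph_sum /=.
  by apply: eq_bigr => k _; rewrite mul_conjc.
have SL : L%:R * S <= \sum_(k < L) normc (v k) * normc (w k).
  have S0 : 0 <= L%:R * S by rewrite mulr_ge0// sumr_ge0// => i _; rewrite sqr_ge0.
  rewrite -[leLHS]ger0_norm// -normc_real Sv -(big_mkord xpredT (fun k => v k * conjc (w k))).
  apply: le_trans (normc_sum _ _) _; rewrite big_mkord.
  apply: ler_sum => k _; rewrite normcM.
  by rewrite (_ : normc (conjc (w k)) = normc (w k))//; case: (w k) => a b; rewrite /= sqrrN.
have amgm : \sum_(k < L) normc (v k) * normc (w k) <=
    \sum_(k < L) (B ^+ 2 / 2 + normc (w k) ^+ 2 / 2).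
  apply: ler_sum => k _; have h := vB k (ltn_ord k).
  have n1 := normc_ge0 (v k); have n2 := normc_ge0 (w k).
  have h2 : normc (v k) ^+ 2 <= B ^+ 2 by rewrite lerXn2r// nnegrE// (le_trans n1).
  have := sqr_ge0 (normc (v k) - normc (w k)); rewrite sqrrB.
  by move: h2; lra.
have := le_trans SL amgm; rewrite big_split /= sumr_const card_ord -mulr_suml -ww.
rewrite -mulr_natl => h.
by rewrite -(ler_pM2l Lpos); lra.
Qed.

End Bessel.

(** * A Fourier coefficient on M points compared with a grid mean near the boundary *)

Section KernelEstimate.
Context {R : realType}.
Local Open Scope complex_scope.
Local Notation C := (R[i]^o).
Local Notation tau := (pi *+ 2 : R).
Variables (delta B : R) (F : R[i] -> R[i]).
Hypotheses (delta0 : 0 < delta) (aF : analytic_on (strip delta) (F : R[i] -> C)).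
Hypothesis Fper : forall z, strip delta z -> F (z + tau%:C) = F z.
Hypothesis FB : forall z, strip delta z -> normc (F z) <= B.
Variables (M m : nat).
Hypothesis M0 : (0 < M)%N.

Definition twisted z : R[i] := F z * wave (- m%:R) z.

(** Its value at 0 is the m-th discrete Fourier coefficient of F on the M points 2 pi j / M, see
    [coefE]. *)
Definition twisted_average z : R[i] :=
  M%:R^-1 * \sum_(j < M) twisted (z + (tau * (j%:R / M%:R))%:C).

Local Notation g := twisted.
Local Notation G := twisted_average.
Let E (z : R[i]) := 1 - wave (- M%:R) z.
(* [G] is 2pi/M-periodic, so the zeros of [E], the real multiples of 2pi/M, are
   removable singularities of [Q].  Its means over Im z = eta and Im z = - eta
   agree, which recovers [G 0]: (E z)^-1 is close to 1 on one of these lines and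
   to 0 on the other. *)
Let Q (z : R[i]) := (G z - G 0) * (E z)^-1.
Let P : set R[i] := [set z | wave (- M%:R) z != 1].
Let MR : 0 < M%:R :> R. Proof. by rewrite ltr0n. Qed.

Let strip_shift z (x : R) : strip delta z -> strip delta (z + x%:C).
Proof. by case: z => a b; rewrite /strip /= addr0. Qed.

Let wave_nat_period n z : wave (- n%:R) (z + tau%:C) = wave (- n%:R) z.
Proof. by have := wave_period (- n%:Z) z; rewrite mulrNz -pmulrn. Qed.

Let g_period z : strip delta z -> g (z + tau%:C) = g z.
Proof. by move=> zs; rewrite /g Fper// wave_nat_period. Qed.

Let G_period z : strip delta z -> G (z + tau%:C) = G z.
Proof.
move=> zs; rewrite /G; congr (_ * _); apply: eq_bigr => j _.
by rewrite addrAC g_period//; exact: strip_shift.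
Qed.

Let G_period_M z : strip delta z -> G (z + (tau / M%:R)%:C) = G z.
Proof.
move=> zs; rewrite /G; congr (_ * _).
case: (M) M0 MR => // M' _ MR'; rewrite big_ord_recr big_ord_recl /= addrC.
rewrite mul0r mulr0 rmorph0 addr0; congr (_ + _).
  rewrite -(g_period zs); congr g; rewrite -addrA -rmorphD; congr (_ + _%:C).
  by rewrite -natr1; field; rewrite natr1 gt_eqF.
apply: eq_bigr => i _; congr g; rewrite -addrA -rmorphD; congr (_ + _%:C).
have -> : (bump 0 i)%:R = i%:R + 1 :> R by rewrite /bump add1n natr1.
by rewrite (mulrDl i%:R) mul1r mulrDr addrC.
Qed.

Let G_good z0 : strip delta z0 -> exists d, good G z0 d.
Proof.
move=> zs; have [j|d h] := @good_sum R M (fun j z => g (z + (tau * (j%:R / M%:R))%:C)) z0.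
  have [d hF] := analytic_good aF (strip_shift (tau * (j%:R / M%:R)) zs).
  have hg := goodM hF (wave_good (- m%:R) _).
  by eexists; exact: good_shift hg.
by eexists; exact: goodZ h.
Qed.

Lemma tame_inv_near (K : R[i] -> R[i]) z0 r c : 0 < r -> 0 <= c ->
  tame (cball z0 r) K c -> K z0 != 0 ->
  exists r' c', [/\ 0 < r' <= r, 0 <= c' & tame (cball z0 r') (fun z => (K z)^-1) c'].
Proof.
move=> r0 c0 t K0; have k0 := normc_gt0 K0.
have c1 : 0 < c + 1 by rewrite ltr_wpDl.
pose e := normc (K z0) / 2 / (c + 1).
have e0 : 0 < e by rewrite !divr_gt0.
pose r' := Num.min r e.
have r'0 : 0 < r' by rewrite lt_min r0.
have sub : cball z0 r' `<=` cball z0 r by move=> z; rewrite /cball /mkset lt_min => /andP[].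
have Kb z : cball z0 r' z -> normc (K z0) / 2 <= normc (K z).
  move=> zr; have /andP[_ ze] : (normc (z - z0) < r) && (normc (z - z0) < e) by rewrite -lt_min.
  have z0r : cball z0 r z0 by rewrite /cball /mkset subrr normc0.
  have [_ h _] := t z z z0 (sub _ zr) (sub _ zr) z0r.
  have h1 : normc (K z0) <= normc (K z) + normc (K z - K z0).
    rewrite [normc (K z - _)]normcB -[K z0 in leLHS](subrK (K z)) addrC.
    by rewrite [leRHS]addrC addrC; exact: le_normcD.
  have h2 : c * normc (z - z0) <= normc (K z0) / 2.
    apply: le_trans (_ : (c + 1) * e <= _); last by rewrite /e mulrC divfK// gt_eqF.
    by apply: ler_pM => //; [exact: normc_ge0|rewrite lerDl|exact: ltW].
  by move: h h1 h2; lra.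
have k2 : 0 < normc (K z0) / 2 by rewrite divr_gt0.
have [c' c'0 t'] := tameV c0 k2 Kb (tame_sub sub t).
by exists r', c'; split=> //; rewrite r'0 ge_min lexx.
Qed.

Let E_good z0 : good E z0 (- ('i * (- M%:R)%:C * wave (- M%:R) z0)).
Proof.
have := goodD (good_cst 1 z0) (goodZ (-1) (wave_good (- M%:R) z0)).
by rewrite add0r mulN1r; under eq_fun do rewrite mulN1r.
Qed.

Let singular z : ~ P z -> exists p : int, z = (tau * p%:~R / M%:R)%:C.
Proof.
rewrite /P /mkset => /negP; rewrite negbK; case: z => x y /eqP w1.
have := congr1 (@normc R) w1; rewrite normc_wave normc1 /= opprK => ey.
have My : M%:R * y = 0 by apply: expR_inj; rewrite ey expR0.
have y0 : y = 0 by apply: (mulfI (lt0r_neq0 MR)); rewrite My mulr0.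
move: w1; rewrite y0 wave_real mulNr cosN => -[/cos_eq1[p Mx] _].
by exists p; rewrite -Mx mulrC mulKf// gt_eqF.
Qed.

Let G_singular z : ~ P z -> G z = G 0.
Proof.
move=> /singular[p ->].
have s0 : strip delta 0 by rewrite /strip /= normr0.
have Gn n z' : strip delta z' -> G (z' + (tau / M%:R * n%:R)%:C) = G z'.
  elim: n => [|n IH] zs; first by rewrite mulr0 rmorph0 addr0.
  rewrite -natr1 mulrDr mulr1 rmorphD addrA G_period_M ?IH//; exact: strip_shift.
case: p => n; first by rewrite -(Gn n 0 s0) add0r mulrAC.
set z' := (X in G X = _); have zs : strip delta z' by rewrite /strip /= normr0.
rewrite -(Gn n.+1 z' zs) /z' -rmorphD NegzE mulrNz -pmulrn.
by congr G; rewrite (_ : _ + _ = 0)//; ring.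
Qed.

(** The zeros of [E] are simple, with derivative i M, and [G - G 0] vanishes there by periodicity.
    Near such a point [Q] is the quotient of the divided differences [G1] and [E1], the second of
    which does not vanish. Intersecting with [P] drops the zero itself, where [Q] takes the default
    value 0. *)
Let Q_tame z0 : strip delta z0 -> exists r c, 0 < r /\ tame (cball z0 r `&` P) Q c.
Proof.
move=> zs; have [d [r1 [c1 [G1 [r10 c10 tG tG1 [_ GE]]]]]] := G_good zs.
have [r2 [c2 [E1 [r20 c20 tE tE1 [Ed EE]]]]] := E_good z0.
have [Pz|nPz] := pselect (P z0).
  have E0 : E z0 != 0 by rewrite subr_eq0 eq_sym.
  have [r3 [c3 [/andP[r30 r32] c30 t3]]] := tame_inv_near r20 c20 tE E0.
  exists (Num.min r1 r3), (3 * (c1 + normc (- G 0)) * c3); split; first by rewrite lt_min r10.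
  apply: tameM => //; first by rewrite addr_ge0// normc_ge0.
    apply: tameD; last exact: tame_cst.
    by apply: tame_sub tG => z [+ _]; rewrite /cball /mkset lt_min => /andP[].
  by apply: tame_sub t3 => z [+ _]; rewrite /cball /mkset lt_min => /andP[].
have w1 : wave (- M%:R) z0 = 1 by move/negP: nPz; rewrite negbK => /eqP.
have E10 : E1 z0 != 0.
  rewrite Ed w1 mulr1 oppr_eq0 mulf_neq0//.
    by rewrite eq_complex /= oner_eq0 andbF.
  by rewrite -[0]/(0%:C) (inj_eq (@complexI _)) oppr_eq0 gt_eqF.
have [r3 [c3 [/andP[r30 r32] c30 t3]]] := tame_inv_near r20 c20 tE1 E10.
exists (Num.min r1 r3), (3 * c1 * c3); split; first by rewrite lt_min r10.
have QE : {in cball z0 (Num.min r1 r3) `&` P, (fun z => G1 z * (E1 z)^-1) =1 Q}.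
  move=> z; rewrite inE => -[_ Pz].
  have zz : z - z0 != 0.
    by rewrite subr_eq0; apply/eqP => zE; apply: nPz; rewrite -zE.
  have E00 : E z0 = 0 by rewrite /E w1 subrr.
  rewrite /Q -(G_singular nPz) GE -[E z]subr0 -E00 EE invfM.
  by rewrite mulrACA divff// mul1r.
apply: tame_eq QE _; apply: tameM => //.
  by apply: tame_sub tG1 => z [+ _]; rewrite /cball /mkset lt_min => /andP[].
by apply: tame_sub t3 => z [+ _]; rewrite /cball /mkset lt_min => /andP[].
Qed.

(** If a grid point were a real multiple of 2 pi / M, then k + 1/2 would be a multiple of the
    integer L / M. *)
Let grid_P L y k : (M %| L)%N -> (0 < L)%N -> P (grid L y k).
Proof.
move=> /dvdnP[s LE] L0; apply: contrapT => /singular[p] [/eqP + _].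
have LR : 0 < L%:R :> R by rewrite ltr0n.
have t0 := @tau_gt0 R.
rewrite -[_ * _ / M%:R]mulrA (inj_eq (mulfI (lt0r_neq0 t0))).
rewrite (eqr_div _ _ (lt0r_neq0 LR) (lt0r_neq0 MR)).
rewrite LE natrM => /eqP h.
have h2 : (k%:R + 2^-1) = p%:~R * s%:R :> R.
  by apply: (mulIf (lt0r_neq0 MR)); rewrite h; ring.
have : ((2 * k + 1)%:Z%:~R : R) = (2 * (p * s%:Z))%:~R.
  by rewrite -pmulrn natrD natrM 2!intrM -[s%:Z%:~R]pmulrn -h2; field.
move=> /eqP; rewrite eqr_int => /eqP; clear; lia.
Qed.

(** A lower bound for 1 - e^(- M eta), uniform in M >= 1 and eta >= delta / 2. *)
Let c0 := 1 - expR (- delta / 2).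

Let c0_gt0 : 0 < c0.
Proof. by rewrite subr_gt0 -expR0 ltr_expR mulNr oppr_lt0 divr_gt0. Qed.

Let B0 : 0 <= B.
Proof.
apply: le_trans (normc_ge0 (F 0)) (FB _).
by rewrite /strip /= normr0.
Qed.

Let g_bound z eta : `|complex.Im z| <= eta -> eta < delta -> normc (g z) <= B * expR (m%:R * eta).
Proof.
move=> ze ed; have zs : strip delta z by exact: le_lt_trans ed.
rewrite /g normcM; apply: ler_pM; rewrite ?normc_ge0 ?FB//.
rewrite normc_wave opprK ler_expR ler_wpM2l//.
exact: le_trans (ler_norm _) ze.
Qed.

Let G_bound z eta : `|complex.Im z| <= eta -> eta < delta -> normc (G z) <= B * expR (m%:R * eta).
Proof.
move=> ze ed; apply: (normc_mean_le (u := fun j => g (z + (tau * (j%:R / M%:R))%:C))) => // j _.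
by apply: g_bound => //; case: z ze => x y /=; rewrite addr0.
Qed.

(** For M dividing L the rotations in [G] permute the grid cyclically, so [G] and [g] have the same
    mean. On Im z = - eta the factor e^(- i m z) has modulus e^(- m eta), which is the decay
    sought. *)
Let grid_mean_G L eta : (M %| L)%N -> (0 < L)%N -> 0 <= eta < delta ->
  grid_mean L (- eta) G = (expR (- m%:R * eta))%:C *
  (L%:R^-1 * \sum_(k < L) F (grid L (- eta) k) * cis (- (m%:R * (tau * ((k%:R + 2^-1) / L%:R))))).
Proof.
move=> ML L0 /andP[eta0 etad].
have LR : 0 < L%:R :> R by rewrite ltr0n.
have gs k : strip delta (grid L (- eta) k) by rewrite /strip /= normrN ger0_norm.
have gper k : g (grid L (- eta) (k + L)) = g (grid L (- eta) k).
  rewrite -(g_period (gs k)); congr g.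
  apply/eqP; rewrite eq_complex /= addr0 eqxx andbT natrD; apply/eqP; field.
  by rewrite gt_eqF.
have gshift n : \sum_(k < L) g (grid L (- eta) (k + n)) = \sum_(k < L) g (grid L (- eta) k).
  elim: n => [|n IH]; first by under eq_bigr do rewrite addn0.
  rewrite -IH; case: (L) L0 gper => // L' _ gper.
  rewrite big_ord_recr [RHS]big_ord_recl /= addrC; congr (_ + _).
    by rewrite addnS -addSn addnC gper add0n.
  by apply: eq_bigr => k _; rewrite -[bump 0 k]/k.+1 addnS addSn.
have step j : (j < M)%N -> \sum_(k < L) g (grid L (- eta) k + (tau * (j%:R / M%:R))%:C) =
    \sum_(k < L) g (grid L (- eta) k).
  move=> jM; rewrite -(gshift (j * (L %/ M))%N); apply: eq_bigr => k _; congr g.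
  apply/eqP; rewrite eq_complex /= addr0 eqxx andbT; apply/eqP.
  have LE : L%:R = (L %/ M)%:R * M%:R :> R by rewrite -natrM divnK.
  have s0 : (L %/ M)%:R != 0 :> R.
    by apply/eqP => s0; move: LR; rewrite LE s0 mul0r ltxx.
  by rewrite LE natrD natrM; field; rewrite s0 gt_eqF.
rewrite /grid_mean mulrCA; congr (_ * _).
transitivity (\sum_(k < L) g (grid L (- eta) k)).
  rewrite /G -mulr_sumr exchange_big /=.
  rewrite (eq_bigr (fun=> \sum_(k < L) g (grid L (- eta) k))) => [|j _]; last exact: step.
  rewrite sumr_const card_ord; set X := \sum_(k < L) _.
  by rewrite -(mulr_natl X) mulKf// pnatr_eq0 -lt0n.
rewrite mulr_sumr; apply: eq_bigr => k _; rewrite /g [RHS]mulrCA; congr (_ * _).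
rewrite /wave /grid iaE /cexp /=; congr ((expR _)%:C * _); first by ring.
by rewrite /cis mulNr.
Qed.

(** With eps = e^(- M eta), the inverse of [E] is within eps / (1 - eps) of 0 on Im z = eta and of 1
    on Im z = - eta, and [G - G 0] is at most 2 B e^(m eta) on both lines; this gives the term with
    4 / [c0]. It accounts for the aliasing of the frequencies m + k M, k <> 0, into m. *)
Lemma twisted_average_bound eta e : delta / 2 <= eta < delta -> 0 < e ->
  exists L0, forall L, (L0 <= L)%N -> (0 < L)%N -> (M %| L)%N ->
  normc (G 0) <= expR (- m%:R * eta) *
    normc (L%:R^-1 * \sum_(k < L) F (grid L (- eta) k) *
      cis (- (m%:R * (tau * ((k%:R + 2^-1) / L%:R))))) +
    4 / c0 * B * expR (- M%:R * eta) * expR (m%:R * eta) + e.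
Proof.
move=> /andP[eta1 etad] e0.
have eta0 : 0 < eta by apply: lt_le_trans eta1; rewrite divr_gt0.
have Qt z : `|complex.Im z| <= eta -> exists r c, 0 < r /\ tame (cball z r `&` P) Q c.
  by move=> ze; apply: Q_tame; exact: le_lt_trans etad.
have Qp z : `|complex.Im z| <= eta -> Q (z + tau%:C) = Q z.
  move=> ze; have zs : strip delta z by exact: le_lt_trans etad.
  by rewrite /Q /E G_period// wave_nat_period.
have [L0 hL0] := contour_shift eta0 Qt Qp e0.
exists L0 => L LL0 Lp ML; have shift := hL0 L LL0 Lp (fun k y => @grid_P L y k ML Lp).
pose S := B * expR (m%:R * eta); pose eps := expR (- M%:R * eta).
have S0 : 0 <= S by rewrite mulr_ge0// expR_ge0.
have eps0 : 0 < eps by exact: expR_gt0.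
have eps1 : c0 <= 1 - eps.
  rewrite lerD2l lerN2 ler_expR !mulNr lerN2.
  apply: le_trans eta1 _; rewrite ler_peMl ?ler1n// ltW//.
have eps2 : 0 < 1 - eps by exact: lt_le_trans eps1.
have Gz z : `|complex.Im z| <= eta -> normc (G z - G 0) <= 2 * S.
  move=> ze; apply: le_trans (le_normcD _ _) _; rewrite normcN mulr_natl mulr2n lerD//.
    exact: G_bound.
  by apply: G_bound => //; rewrite /= normr0 ltW.
have K0 : 2 * S * eps / (1 - eps) <= 2 / c0 * S * eps.
  rewrite [leRHS](_ : _ = 2 * S * eps / c0); last by ring.
  by rewrite ler_wpM2l ?lef_pV2 ?posrE// !mulr_ge0// ltW.
have tri (x y : R[i]) : normc x - normc y <= normc (x - y).
  by rewrite lerBlDr -[x in leLHS](subrK y); exact: le_normcD.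
have nw k y : normc (wave (- M%:R) (grid L y k)) = expR (M%:R * y).
  by rewrite normc_wave opprK.
have top k : normc (Q (grid L eta k)) <= 2 / c0 * S * eps.
  apply: le_trans K0; rewrite /Q normcM normcV.
  have h1 : (1 - eps) / eps <= normc (E (grid L eta k)).
    rewrite -normcN opprB; apply: le_trans (tri _ _); rewrite nw normc1.
    by rewrite mulrBl divff ?gt_eqF// mul1r /eps mulNr expRN invrK.
  rewrite -mulrA; apply: ler_pM; rewrite ?normc_ge0 ?invr_ge0 ?normc_ge0//.
    by apply: Gz; rewrite /= ger0_norm// ltW.
  by rewrite -[eps / _]invf_div lef_pV2// posrE ?divr_gt0// (lt_le_trans _ h1)// divr_gt0.
have bot k : normc (Q (grid L (- eta) k) - (G (grid L (- eta) k) - G 0)) <= 2 / c0 * S * eps.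
  have wn : normc (wave (- M%:R) (grid L (- eta) k)) = eps.
    by rewrite nw /eps mulNr mulrN.
  have h1 : 1 - eps <= normc (E (grid L (- eta) k)).
    by apply: le_trans (tri _ _); rewrite wn normc1.
  have E0 : E (grid L (- eta) k) != 0.
    by apply/eqP => E0; move: h1; rewrite E0 normc0 leNgt eps2.
  have -> : Q (grid L (- eta) k) - (G (grid L (- eta) k) - G 0) =
      (G (grid L (- eta) k) - G 0) * (wave (- M%:R) (grid L (- eta) k) *
      (E (grid L (- eta) k))^-1).
    move: E0; rewrite /Q /E; move: (G _) (G 0) (wave _ _) => x y w w1.
    by field.
  apply: le_trans K0; rewrite normcM normcM normcV wn -[leRHS]mulrA.
  apply: ler_pM; rewrite ?normc_ge0 ?mulr_ge0 ?invr_ge0 ?normc_ge0 ?(ltW eps0)//.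
    by apply: Gz; rewrite /= normrN ger0_norm// ltW.
  by rewrite ler_pM2l// lef_pV2// posrE// (lt_le_trans _ h1).
have LC : L%:R != 0 :> R[i] by rewrite pnatr_eq0 -lt0n.
have -> : G 0 = grid_mean L (- eta) G +
   (grid_mean L (- eta) (fun z => Q z - (G z - G 0)) +
   ((grid_mean L eta Q - grid_mean L (- eta) Q) - grid_mean L eta Q)).
  rewrite /grid_mean !sumrB sumr_const card_ord -[G 0 *+ L]mulr_natl.
  by field.
apply: le_trans (le_normcD _ _) _.
rewrite grid_mean_G//; last by rewrite ltW.
rewrite normcM normc_real ger0_norm ?expR_ge0// -[leRHS]addrA lerD2l.
apply: le_trans (le_normcD _ _) _.
apply: le_trans (lerD (lexx _) (le_normcD _ _)) _; rewrite normcN.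
have h1 := normc_mean_le Lp (fun k _ => bot k); have h2 := normc_mean_le Lp (fun k _ => top k).
rewrite -/(grid_mean L eta Q) in h2.
have -> : 4 / c0 * B * expR (- M%:R * eta) * expR (m%:R * eta) =
  2 / c0 * S * eps + 2 / c0 * S * eps by rewrite /S /eps; field; exact: lt0r_neq0.
by move: h1 h2 shift; rewrite /grid_mean /=; lra.
Qed.

End KernelEstimate.

(** * Taylor estimates and decay of coefficients in C^omega_delta *)

Section ComegaFourier.
Context {R : realType} (delta : {posnum R}).
Local Open Scope complex_scope.
Local Notation C := (R[i]^o).
Local Notation tau := (pi *+ 2 : R).
Local Notation D := (strip delta%:num).
Implicit Types (f : Comega delta) (z : R[i]).
Local Notation F f := (the_continuation delta f).

Lemma strip_real (x : R) : D x%:C.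
Proof. by rewrite /strip /= normr0. Qed.

Lemma Comega_norm_ge f z : D z -> normc (F f z) <= `|f|.
Proof. by move=> Dz; exact: (sup_norm_ub (Comega_norm_ubound f)). Qed.

Lemma continuation_real f (x : R) : F f x%:C = (f x)%:C.
Proof. exact: (the_continuationP f).2. Qed.

Lemma Comega_le f x : `|f x| <= `|f|.
Proof. by rewrite -normc_real -continuation_real; apply: Comega_norm_ge; exact: strip_real. Qed.

Lemma Comega_periodic f : periodic2pi f.
Proof. by have := ComegaP f; rewrite inE => -[]. Qed.

Lemma continuation_period f z : D z -> F f (z + tau%:C) = F f z.
Proof.
have [aF Fr] := the_continuationP f.
suff cont : continuation delta f (fun z => F f (z + tau%:C)).
  by move=> Dz; exact: (continuation_unique cont (the_continuationP f) Dz).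
split=> [z0 Dz0|x].
  have Dz1 : D (z0 + tau%:C) by case: z0 Dz0 => a b; rewrite /strip /= addr0.
  have [a [r r0 h]] := aF _ Dz1; exists a, r => // w wr.
  have := h (w + tau%:C); rewrite (_ : w + tau%:C - (z0 + tau%:C) = w - z0); last by ring.
  by apply.
by rewrite -rmorphD Fr Comega_periodic.
Qed.

(** Tameness is uniform along the real axis by compactness and periodicity. Taking x, y and x + s in
    the second difference and letting s tend to 0 turns it into the Taylor remainder at x. *)
Lemma Comega_taylor1 f : exists D L C, taylor1 f D L C.
Proof.
have [aF Fr] := the_continuationP f.
have d0 : 0 < delta%:num :> R by [].
have gd z : D z -> exists d, good (F f) z d by exact: analytic_good.
have [n hn] : exists n : nat, forall x y : R, 0 <= x <= tau -> `|y| <= 0 ->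
    tame (cball (x +i* y) n.+1%:R^-1 `&` setT) (F f) n%:R.
  apply: uniformly_tame => z0 z00.
  have [|d [r [c [H1 [r0 c0 t _ _]]]]] := gd z0; first exact: le_lt_trans d0.
  by exists r, c; split=> //; rewrite setIT.
pose r : R := n.+1%:R^-1; have r0 : 0 < r by rewrite invr_gt0.
pose B := `|f|.
have loc x : exists D, `|D| <= n%:R /\ forall y, `|y - x| < r ->
    `|f y - f x - D * (y - x)| <= n%:R * (y - x) ^+ 2 /\ `|f y - f x| <= n%:R * `|y - x|.
  wlog xI : x / 0 <= x <= tau.
    move=> wl; have [m /andP[m0 m1]] := period_representative x (@tau_gt0 R).
    have [|D0 [D1 D2]] := wl (x + tau * m%:~R); first by rewrite m0 ltW.
    exists D0; split=> // y yx.
    have := D2 (y + tau * m%:~R); rewrite (_ : y + _ - (x + _) = y - x); last by ring.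
    by rewrite !(period_int m _ (@Comega_periodic f)); apply.
  have t := hn x 0 xI; rewrite normr0 lexx setIT in t; have {}t := t isT.
  have [d [r' [c [H1 [r'0 c0 _ t1 [H1d HE]]]]]] := gd x%:C (strip_real x).
  have inb y : `|y - x| < r -> cball (x +i* 0) r y%:C.
    by move=> yx; rewrite /cball /mkset -[x +i* 0]/(x%:C) -rmorphB normc_real.
  have bx : cball (x +i* 0) r x%:C by apply: inb; rewrite subrr normr0.
  have xC : x +i* 0 = x%:C by [].
  have lip y : `|y - x| < r -> `|f y - f x| <= n%:R * `|y - x|.
    move=> /inb yx; have [_ h _] := t y%:C y%:C x%:C yx yx bx.
    by rewrite !continuation_real -!rmorphB !normc_real in h.
  have quo s : `|s| < r' -> `|f (x + s) - f x - complex.Re d * s| <= c * s ^+ 2.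
    move=> sr; have b1 : cball x%:C r' (x + s)%:C.
      by rewrite /cball /mkset -rmorphB addrC addKr normc_real.
    have b0 : cball x%:C r' x%:C by rewrite /cball /mkset subrr normc0.
    have [_ h _] := t1 _ _ _ b1 b1 b0.
    have := HE (x + s)%:C; rewrite !continuation_real -!rmorphB (_ : x + s - x = s); last by ring.
    move=> /(congr1 (@complex.Re R)) hE.
    have E : f (x + s) - f x = s * complex.Re (H1 (x + s)%:C).
      by rewrite -[LHS]/(complex.Re (f (x + s) - f x)%:C) hE; case: (H1 _) => u v /=; ring.
    have -> : f (x + s) - f x - complex.Re d * s = s * (complex.Re (H1 (x + s)%:C - H1 x%:C)).
      by rewrite E H1d; case: (H1 _) => u v; case: (d) => u' v' /=; ring.
    rewrite normrM -[s ^+ 2]real_normK ?num_real// mulrC expr2 mulrA ler_wpM2r//.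
    have Rn (w : R[i]) : `|complex.Re w| <= normc w.
      by case: w => u v /=; rewrite -[X in X <= _]sqrtr_sqr ler_wsqrtr// lerDl sqr_ge0.
    apply: le_trans (Rn _) (le_trans h _).
    by rewrite -rmorphB (_ : x + s - x = s) ?normc_real//; ring.
  have lim (A b : R) : (forall s, 0 < s -> s < r -> s < r' -> A <= b * s) -> A <= 0.
    move=> h; apply/ler_addgt0Pr => e e0; rewrite add0r.
    have b1 : 0 < `|b| + 1 by rewrite ltr_wpDl.
    pose s := Num.min (Num.min (r / 2) (r' / 2)) (e / (`|b| + 1)).
    have s0 : 0 < s by rewrite !lt_min !divr_gt0.
    apply: le_trans (h s s0 _ _) _.
    - apply: le_lt_trans (_ : r / 2 < _); last by move: r0; lra.
      by rewrite !ge_min lexx.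
    - apply: le_lt_trans (_ : r' / 2 < _); last by move: r'0; lra.
      by rewrite !ge_min lexx !orbT.
    apply: le_trans (_ : (`|b| + 1) * s <= _).
      by rewrite ler_wpM2r ?(ltW s0)// (le_trans (ler_norm _))// lerDl.
    by rewrite mulrC -ler_pdivlMr// ge_min lexx orbT.
  exists (complex.Re d); split.
    rewrite -subr_le0; apply: (lim _ c) => s s0 sr sr'.
    have h1 := lip (x + s); rewrite addrC addKr gtr0_norm// in h1; have {}h1 := h1 sr.
    have h2 := quo s; rewrite gtr0_norm// in h2; have {}h2 := h2 sr'.
    have h3 : `|complex.Re d| * s <= n%:R * s + c * s ^+ 2.
      rewrite -[s in leLHS]gtr0_norm// -normrM.
      have -> : complex.Re d * s = (f (x + s) - f x) - (f (x + s) - f x - complex.Re d * s) by ring.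
      by apply: le_trans (ler_normB _ _) _; rewrite lerD.
    by rewrite -(ler_pM2r s0) mulrBl -mulrA -expr2 lerBlDl.
  move=> y yx; split; last exact: lip.
  rewrite -subr_le0; apply: (lim _ (n%:R * `|y - x| + c * `|y - x|)) => s s0 sr sr'.
  have bs : cball (x +i* 0) r (x + s)%:C by apply: inb; rewrite addrC addKr gtr0_norm.
  have [_ _] := t _ _ _ (inb y yx) bs bx.
  rewrite /second_difference !continuation_real -!rmorphB -!rmorphM -rmorphB !normc_real.
  rewrite (_ : x + s - x = s); last by ring.
  rewrite (gtr0_norm s0) => h1.
  have h2 := quo s; rewrite gtr0_norm// in h2; have {}h2 := h2 sr'.
  rewrite -(ler_pM2r s0) mulrBl.
  have h3 : `|f y - f x - complex.Re d * (y - x)| * s <=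
      n%:R * `|y - (x + s)| * `|y - x| * s + c * s ^+ 2 * `|y - x|.
    rewrite -[s in leLHS]gtr0_norm// -normrM.
    rewrite (_ : _ * s = ((f y - f x) * s - (f (x + s) - f x) * (y - x)) +
      (f (x + s) - f x - complex.Re d * s) * (y - x)); last by ring.
    by apply: le_trans (ler_normD _ _) _; rewrite lerD// normrM ler_wpM2r.
  have h4 : `|y - (x + s)| <= `|y - x| + s.
    by rewrite opprD addrA; apply: le_trans (ler_normB _ _) _; rewrite (gtr0_norm s0).
  have h5 : n%:R * `|y - (x + s)| * `|y - x| * s <= n%:R * (`|y - x| + s) * `|y - x| * s.
    by do 2!(rewrite ler_wpM2r ?(ltW s0)//); rewrite ler_wpM2l.
  rewrite lerBlDr; apply: le_trans h3 (le_trans (lerD h5 (lexx _)) _).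
  by rewrite -[(y - x) ^+ 2]real_normK ?num_real// le_eqVlt; apply/orP; left; apply/eqP; ring.
have /choice[d hd] := loc.
have N1 : 0 < n.+1%:R :> R by rewrite ltr0n.
(* For |y - x| >= 1 / (n + 1) the estimates follow from |f| <= B and |D| <= n at the cost of factors
   n + 1; the last summand pays for the linear term. *)
exists d, (n%:R + 2 * B * n.+1%:R), (n%:R + (2 * B * n.+1%:R ^+ 2 + n%:R * n.+1%:R)) => x y.
have [dn near] := hd x.
have B0 : 0 <= B by exact: normr_ge0.
have n0 : 0 <= n%:R :> R by [].
have B2 : 0 <= 2 * B * n.+1%:R by rewrite !mulr_ge0.
split; last by rewrite (le_trans dn)// lerDl.
  have [yr|ry] := ltP `|y - x| r.
    have [h _] := near y yr; apply: le_trans h _; rewrite ler_wpM2r ?sqr_ge0// lerDl.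
    by rewrite addr_ge0 ?mulr_ge0.
  have u1 : 1 <= n.+1%:R * `|y - x| by rewrite -ler_pdivrMl// mulr1.
  apply: le_trans (ler_normB _ _) _.
  apply: le_trans (_ : 2 * B + n%:R * `|y - x| <= _).
    apply: lerD; last by rewrite normrM ler_wpM2r.
    by apply: le_trans (ler_normB _ _) _; rewrite mulr_natl mulr2n lerD ?Comega_le.
  rewrite -[(y - x) ^+ 2]real_normK ?num_real//; set t := `|y - x| in u1 *.
  have t0 : 0 <= t by exact: normr_ge0.
  have h1 : 2 * B * 1 <= 2 * B * (n.+1%:R * t) ^+ 2.
    by rewrite ler_wpM2l ?mulr_ge0// expr_ge1// mulr_ge0.
  have h2 : n%:R * t * 1 <= n%:R * t * (n.+1%:R * t) by rewrite ler_wpM2l// mulr_ge0.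
  have h3 : 0 <= n%:R * t ^+ 2 by rewrite mulr_ge0// sqr_ge0.
  by move: h1 h2 h3; rewrite exprMn; lra.
have [yr|ry] := ltP `|y - x| r.
  by have [_ h] := near y yr; apply: le_trans h _; rewrite ler_wpM2r// lerDl.
have u1 : 1 <= n.+1%:R * `|y - x| by rewrite -ler_pdivrMl// mulr1.
apply: le_trans (_ : 2 * B <= _).
  by apply: le_trans (ler_normB _ _) _; rewrite mulr_natl mulr2n lerD ?Comega_le.
have h1 : 2 * B * 1 <= 2 * B * (n.+1%:R * `|y - x|) by rewrite ler_wpM2l ?mulr_ge0.
by have := mulr_ge0 n0 (normr_ge0 (y - x)); move: h1; lra.
Qed.

Definition coef (M m : nat) (h : R -> R) : R[i] :=
  M%:R^-1 * \sum_(j < M) (h (tau * (j%:R / M%:R)))%:C * cis (- (m%:R * (tau * (j%:R / M%:R)))).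

Lemma coefE M m f : coef M m f = twisted_average (F f) M m 0.
Proof.
rewrite /coef /twisted_average; congr (_ * _); apply: eq_bigr => j _.
by rewrite add0r /twisted continuation_real wave_real mulNr.
Qed.

Lemma coef_lin M m (a : R) (g h : R -> R) :
  coef M m (fun x => a * g x + h x) = a%:C * coef M m g + coef M m h.
Proof.
rewrite /coef mulrCA -mulrDr [X in _ * (X + _)]mulr_sumr -big_split; congr (_ * _).
apply: eq_bigr => j _ /=; set u := g _; set v := h _.
have -> : (a * u + v)%:C = a%:C * u%:C + v%:C by rewrite rmorphD rmorphM.
by ring.
Qed.

Let c0 : R := 1 - expR (- delta%:num / 2).
Let d0 : 0 < delta%:num :> R. Proof. by []. Qed.

Let c0_gt0 : 0 < c0.
Proof. by rewrite subr_gt0 -expR0 ltr_expR mulNr oppr_lt0 divr_gt0. Qed.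

(** The estimates hold on lines inside the strip. Their bounds are explicit functions of eta, so eta
    = delta is reached without values on the boundary. *)
Let left_limit (h : R -> R) b : {for delta%:num, continuous h} ->
  (forall eta, delta%:num / 2 <= eta < delta%:num -> h eta <= b) -> h delta%:num <= b.
Proof.
move=> ch hb; rewrite leNgt; apply/negP => bh.
have e0 : 0 < h delta%:num - b by rewrite subr_gt0.
have /cvgrPdist_lt/(_ _ e0)/nbhs_ballP[r /= r0 hr] := ch.
pose eta := delta%:num - Num.min (r / 2) (delta%:num / 2).
have m0 : 0 < Num.min (r / 2) (delta%:num / 2) by rewrite lt_min !divr_gt0.
have m1 : Num.min (r / 2) (delta%:num / 2) <= r / 2 by rewrite ge_min lexx.
have m2 : Num.min (r / 2) (delta%:num / 2) <= delta%:num / 2 by rewrite ge_min lexx orbT.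
have h1 : h eta <= b by apply: hb; rewrite /eta; move: m0 m2; lra.
have := hr eta; rewrite /ball /= /eta opprB addrCA subrr addr0 gtr0_norm// => /(_ _)/wrap[].
  by move: m1 r0; lra.
by rewrite ltr_norml -/eta; move: h1; lra.
Qed.

(** For 2 m <= M the aliasing term e^((m - M) eta) is at most e^(- m eta), the size of the main
    term. *)
Lemma coef_bound M m f : (0 < M)%N -> (m.*2 <= M)%N ->
  expR (m%:R * delta%:num) * normc (coef M m f) <= (1 + 4 / c0) * `|f|.
Proof.
move=> M0 mM; rewrite coefE; have [aF _] := the_continuationP f.
have f0 := normr_ge0 f; have K0 : 0 <= 4 / c0 * `|f| by rewrite mulr_ge0// divr_ge0// ltW.
have key eta : delta%:num / 2 <= eta < delta%:num ->
    expR (m%:R * eta) * normc (twisted_average (F f) M m 0) <= (1 + 4 / c0) * `|f|.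
  move=> etaI; have eta0 : 0 < eta by case/andP: etaI => h _; apply: lt_le_trans h; rewrite divr_gt0.
  set a := normc _.
  have h1 : a <= expR (- m%:R * eta) * `|f| + 4 / c0 * `|f| * expR (- M%:R * eta) * expR (m%:R * eta).
    apply/ler_addgt0Pr => e e0.
    have [L0 hL] := twisted_average_bound d0 aF (@continuation_period f) (@Comega_norm_ge f) m M0 etaI e0.
    have L1 : (L0 <= L0.+1 * M)%N by rewrite (leq_trans (leqnSn L0))// leq_pmulr.
    have L2 : (0 < L0.+1 * M)%N by rewrite muln_gt0.
    apply: le_trans (hL _ L1 L2 (dvdn_mull _ (dvdnn M))) _.
    rewrite !lerD2r ler_wpM2l ?expR_ge0//.
    set L := (L0.+1 * M)%N in L2 *.
    apply: (normc_mean_le (u := fun k => F f (grid L (- eta) k) *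
      cis (- (m%:R * (tau * ((k%:R + 2^-1) / L%:R))))) L2) => k _.
    rewrite normcM normc_cis mulr1; apply: Comega_norm_ge.
    by rewrite /strip /= normrN gtr0_norm//; case/andP: etaI.
  rewrite mulrC -ler_pdivlMr ?expR_gt0//; apply: le_trans h1 _.
  have E : (expR (m%:R * eta))^-1 = expR (- m%:R * eta) by rewrite mulNr expRN.
  have h2 : expR (- M%:R * eta) * expR (m%:R * eta) <= expR (- m%:R * eta).
    rewrite -expRD ler_expR.
    have : m.*2%:R * eta <= M%:R * eta by rewrite ler_wpM2r ?(ltW eta0)// ler_nat.
    by rewrite -addnn natrD; lra.
  by have := ler_wpM2l K0 h2; rewrite E !mulrA; lra.
apply: (left_limit (h := fun eta => expR (m%:R * eta) * normc (twisted_average (F f) M m 0))) key.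
apply: differentiable_continuous; apply/derivable1_diffP.
by apply: ex_derive.
Qed.

(** [phi q eta] is the weighted coefficient less the aliasing error and a slack delta - eta that
    vanishes in the limit; it is at most the modulus of a grid coefficient of frequency j (q + 1).
    As it may be negative, [psi] squares its positive part. Bessel's inequality bounds the sum over
    q independently of eta, so at eta = delta the series converges and its terms tend to 0. *)
Lemma coef_cvg N j f : (0 < j <= N)%N -> forall e, 0 < e -> exists Q0, forall q, (Q0 <= q)%N ->
  expR ((j * q.+1)%:R * delta%:num) * normc (coef (N.*2.+1 * q.+1) (j * q.+1) f) <= e.
Proof.
move=> /andP[j0 jN] e e0; have [aF _] := the_continuationP f.
pose M q := (N.*2.+1 * q.+1)%N; pose m q := (j * q.+1)%N.
pose a q := normc (coef (M q) (m q) f); pose K := 4 / c0 * `|f|.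
have K0 : 0 <= K by rewrite mulr_ge0 ?divr_ge0 ?(ltW c0_gt0).
pose phi q eta := expR ((m q)%:R * eta) *
  (a q - K * expR (- (M q)%:R * eta) * expR ((m q)%:R * eta) - (delta%:num - eta)).
pose psi (x : R) := ((x + `|x|) / 2) ^+ 2.
have M0 q : (0 < M q)%N by rewrite muln_gt0.
have mM q : (m q < M q)%N by rewrite ltn_pmul2r// ltnS -addnn (leq_trans jN)// leq_addr.
have psi_le x y : x <= y -> 0 <= y -> psi x <= y ^+ 2.
  move=> xy y0; rewrite /psi lerXn2r// ?nnegrE//.
    by have := lerNnormlW (lexx `|x|); lra.
  have [x0|x0] := leP 0 x; first by rewrite ger0_norm//; lra.
  by rewrite ltr0_norm//; lra.
have step1 Q eta : delta%:num / 2 <= eta < delta%:num ->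
    \sum_(q < Q) psi (phi q eta) <= `|f| ^+ 2.
  move=> etaI; have ed : 0 < delta%:num - eta by rewrite subr_gt0; case/andP: etaI.
  have etad : eta < delta%:num by rewrite -subr_gt0.
  have eta0 : 0 < eta by case/andP: etaI => h _; apply: lt_le_trans h; rewrite divr_gt0.
  have /choice[L0 hL0] := fun q => twisted_average_bound d0 aF
    (@continuation_period f) (@Comega_norm_ge f) (m q) (M0 q) etaI ed.
  (* One grid for all q below Q: a common multiple of the [M q] beyond all thresholds [L0 q]. *)
  pose L := ((\sum_(q < Q) L0 q).+1 * \prod_(q < Q) M q)%N.
  have P0 : (0 < \prod_(q < Q) M q)%N by apply: prodn_gt0 => q; exact: M0.
  have Lp : (0 < L)%N by rewrite muln_gt0.
  have LL0 (q : 'I_Q) : (L0 q <= L)%N.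
    apply: leq_trans (_ : (\sum_(q < Q) L0 q).+1 <= _)%N; last by rewrite leq_pmulr.
    by rewrite (bigD1 q)//= leqW// leq_addr.
  have LM (q : 'I_Q) : (M q %| L)%N by rewrite dvdn_mull// (bigD1 q)//= dvdn_mulr.
  pose v k := F f (grid L (- eta) k).
  pose d q := L%:R^-1 * \sum_(k < L) v k * cis (- ((m q)%:R * (tau * ((k%:R + 2^-1) / L%:R)))).
  apply: le_trans (_ : \sum_(q < Q) normc (d q) ^+ 2 <= _); last first.
    apply: bessel => // [q1 q2 _ _ /eqP|q qQ|k _].
    - by rewrite /m eqn_pmul2l// eqSS => /eqP.
    - apply: leq_trans (mM q) _; apply: dvdn_leq => //; exact: (LM (Ordinal qQ)).
    - by apply: Comega_norm_ge; rewrite /strip /= normrN gtr0_norm.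
  apply: ler_sum => q _; apply: psi_le; last exact: normc_ge0.
  have := hL0 q L (LL0 q) Lp (LM q); rewrite -coefE -/(a q) -/(d q) -/c0 -/K => h.
  rewrite /phi -ler_pdivlMl ?expR_gt0// -expRN -(mulNr (m q)%:R).
  by move: h; lra.
have cphi q : {for delta%:num, continuous (phi q : R -> R^o)}.
  apply: differentiable_continuous; apply/derivable1_diffP.
  by apply: ex_derive.
have step2 Q : \sum_(q < Q) psi (phi q delta%:num) <= `|f| ^+ 2.
  apply: (left_limit (h := fun eta => \sum_(q < Q) psi (phi q eta))) => [|eta]; last exact: step1.
  suff sc : \sum_(q < Q) psi (phi q eta) @[eta --> (delta%:num : R)] -->
      (\sum_(q < Q) psi (phi q delta%:num) : R^o) by exact: sc.
  elim: Q => [|Q IH].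
    by rewrite big_ord0; under eq_fun do rewrite big_ord0; exact: cvg_cst.
  under eq_fun do rewrite big_ord_recr; rewrite big_ord_recr /=.
  apply: (@cvgD _ R^o); first exact: IH.
  have h : (phi Q eta + `|phi Q eta|) / 2 @[eta --> (delta%:num : R)] -->
      (phi Q delta%:num + `|phi Q delta%:num|) / 2.
    by apply: cvgM; [apply: cvgD; [exact: cphi|apply: cvg_norm; exact: cphi]|exact: cvg_cst].
  by rewrite /psi expr2; under eq_fun do rewrite expr2; apply: cvgM.
have psi0 : psi (phi q delta%:num) @[q --> \oo] --> 0.
  apply: cvg_series_cvg_0; apply: nondecreasing_is_cvgn.
    apply/nondecreasing_seqP => n; rewrite /series /= big_nat_recr//= lerDl.
    exact: sqr_ge0.
  by exists (`|f| ^+ 2) => _ [n _ <-]; rewrite /series /= big_mkord.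
have e2 : 0 < (e / 2) ^+ 2 by rewrite exprn_gt0// divr_gt0.
have /cvgrPdist_lt/(_ _ e2)[Q0 _ hQ0] := psi0.
(* The second summand brings the aliasing term, at most K e^(- (q + 1) delta) because 2 j + 1 <= 2 N
   + 1, below e / 2. *)
exists (Q0 + (Num.truncn (K / (e / 2 * delta%:num))).+1)%N => q Qq.
have := hQ0 q (leq_trans (leq_addr _ _) Qq).
rewrite sub0r normrN ger0_norm ?sqr_ge0// => hq.
have x_lt : phi q delta%:num < e / 2.
  have : (phi q delta%:num + `|phi q delta%:num|) / 2 < e / 2.
    rewrite ltNge; apply/negP => h; move: hq; rewrite /psi ltNge => /negP; apply.
    have e20 : 0 <= e / 2 by rewrite divr_ge0// ltW.
    by apply: lerXn2r => //; rewrite nnegrE//; exact: le_trans h.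
  by have := ler_norm (phi q delta%:num); lra.
rewrite -/(M q) -/(m q) -/(a q).
have -> : expR ((m q)%:R * delta%:num) * a q = phi q delta%:num +
   K * (expR ((m q)%:R * delta%:num) * expR (- (M q)%:R * delta%:num) * expR ((m q)%:R * delta%:num)).
  by rewrite /phi subrr subr0; ring.
rewrite (splitr e) lerD ?(ltW x_lt)//.
have h1 : expR ((m q)%:R * delta%:num) * expR (- (M q)%:R * delta%:num) *
    expR ((m q)%:R * delta%:num) <= expR (- (q.+1%:R * delta%:num)).
  rewrite -!expRD ler_expR.
  have : ((m q).*2 + q.+1)%:R * delta%:num <= (M q)%:R * delta%:num.
    rewrite ler_wpM2r// ler_nat /m /M doubleMl -mulSnr leq_pmul2r// ltnS.
    by rewrite leq_double.
  by rewrite natrD -addnn natrD; lra.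
have dq : 0 < q.+1%:R * delta%:num by rewrite mulr_gt0.
apply: le_trans (ler_wpM2l K0 h1) _.
rewrite expRN ler_pdivrMr ?expR_gt0//.
apply: le_trans (_ : e / 2 * (q.+1%:R * delta%:num) <= _); last first.
  by rewrite ler_wpM2l ?divr_ge0 ?(ltW e0)// (le_trans _ (expR_ge1Dx _))// lerDr.
rewrite mulrCA -ler_pdivrMr ?mulr_gt0 ?divr_gt0//.
apply: le_trans (ltW (truncnS_gt _)) _; rewrite ler_nat.
by apply: leqW; exact: leq_trans (leq_addl _ _) Qq.
Qed.

End ComegaFourier.

(** * Trigonometric interpolation of rotation averages *)

Section Interpolation.
Context {R : realType}.
Local Open Scope complex_scope.
Local Notation tau := (pi *+ 2 : R).

(** The real part of a geometric sum over 2 N + 1 terms: pairing j with 2 N + 1 - j leaves only j =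
    0, which accounts for the - 1. *)
Lemma dirichlet_kernel N (d : int) :
  \sum_(j < N) 2 * cos (tau * d%:~R / N.*2.+1%:R * j.+1%:R) =
  (if (N.*2.+1%:Z %| d)%Z then N.*2.+1%:R else 0) - 1 :> R.
Proof.
pose n := N.*2.+1; have nR : n%:R != 0 :> R by rewrite pnatr_eq0.
pose c k := cos (tau * d%:~R / n%:R * k%:R) : R.
have sc : \sum_(k < n) c k = if (n%:Z %| d)%Z then n%:R else 0.
  have := congr1 (@complex.Re R) (sum_cis d (ltn0Sn N.*2)); rewrite -/n.
  have ReS (m : nat) (u : nat -> R[i]) : complex.Re (\sum_(k < m) u k) = \sum_(k < m) complex.Re (u k).
    elim: m => [|m IH]; first by rewrite !big_ord0.
    by rewrite !big_ord_recr /= -IH; case: (\sum_(k < m) _) => a b; case: (u m).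
  rewrite (ReS n (fun k => cis (tau * d%:~R / n%:R * k%:R))) => ->.
  by case: ifP => // _; rewrite -(rmorph_nat (real_complex R)).
have cs j : (j < N)%N -> c (N + (N - j.+1)).+1 = c j.+1.
  move=> jN; rewrite /c.
  have -> : (N + (N - j.+1)).+1%:R = n%:R - j.+1%:R :> R.
    rewrite -natrB; last by rewrite /n -addnn ltnW// ltnS (leq_trans jN)// leq_addr.
    congr (_%:R); rewrite /n -addnn; lia.
  rewrite mulrBr divfK// addrC -cosN opprD opprK.
  set y := tau * _ / _ * _; have -> : y - tau * d%:~R = y + tau * (- d)%:~R.
    by rewrite mulrNz mulrN.
  exact: (period_int _ _ (@cosD2pi R)).
move: sc; rewrite big_ord_recl {1}/c mulr0 cos0.
rewrite -[\sum_(i < N.*2) _]/(\sum_(i < N.*2) c i.+1) => sc.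
have E : \sum_(i < N.*2) c i.+1 = \sum_(j < N) 2 * c j.+1.
  rewrite -addnn big_split_ord /= [X in _ + X](reindex_inj rev_ord_inj) /= -big_split /=.
  by apply: eq_bigr => j _; rewrite cs ?ltn_ord// mulr_natl mulr2n.
rewrite -[LHS]/(\sum_(j < N) 2 * c j.+1) -E -sc; ring.
Qed.

Lemma sum_blocks (n q : nat) (u : nat -> R) :
  \sum_(k < q * n) u k = \sum_(l < q) \sum_(r < n) u (l * n + r)%N.
Proof.
elim: q => [|q IH]; first by rewrite !big_ord0.
by rewrite big_ord_recr -IH /= mulSn addnC big_split_ord.
Qed.

(** The Dirichlet kernel selects, among the M nodes, those congruent to i modulo 2 N + 1, which are
    the q rotates of z. The frequency 0 is left out of the sum, hence the mean on the right. *)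
Lemma interpolation N q (h : R -> R) i : (0 < q)%N -> (i < N.*2.+1)%N ->
  let M := (N.*2.+1 * q)%N in let z : R := tau * (i%:R / M%:R) in
  \sum_(j < N) 2 * complex.Re (coef M (j.+1 * q) h * cis ((j.+1 * q)%:R * z)) =
  rotation_average q h z - M%:R^-1 * \sum_(k < M) h (tau * (k%:R / M%:R)).
Proof.
move=> q0 iN M z; pose n := N.*2.+1; pose x (k : nat) : R := tau * (k%:R / M%:R).
have nR : n%:R != 0 :> R by rewrite pnatr_eq0.
have qR : q%:R != 0 :> R by rewrite pnatr_eq0 -lt0n.
have ME : M%:R = n%:R * q%:R :> R by rewrite natrM.
have ReS (m : nat) (u : nat -> R[i]) : complex.Re (\sum_(k < m) u k) = \sum_(k < m) complex.Re (u k).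
  elim: m => [|m IH]; first by rewrite !big_ord0.
  by rewrite !big_ord_recr /= -IH; case: (\sum_(k < m) _) => a b; case: (u m).
have ReZ (a : R) (w : R[i]) : complex.Re (a%:C * w) = a * complex.Re w.
  by case: w => u v /=; ring.
have term j : 2 * complex.Re (coef M (j.+1 * q) h * cis ((j.+1 * q)%:R * z)) =
    M%:R^-1 * \sum_(k < M) h (x k) * (2 * cos (tau * (i%:Z - k%:Z)%:~R / n%:R * j.+1%:R)).
  have -> : coef M (j.+1 * q) h * cis ((j.+1 * q)%:R * z) =
     (M%:R^-1)%:C * \sum_(k < M) (h (x k))%:C * cis (tau * (i%:Z - k%:Z)%:~R / n%:R * j.+1%:R).
    rewrite /coef -mulrA; congr (_ * _); first by rewrite fmorphV rmorph_nat.
    rewrite mulr_suml; apply: eq_bigr => k _; rewrite -mulrA -cisD; congr (_ * cis _).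
    by rewrite intrB -!pmulrn /z ME natrM; field; rewrite qR nR.
  rewrite ReZ (ReS M (fun k => (h (x k))%:C * cis (tau * (i%:Z - k%:Z)%:~R / n%:R * j.+1%:R))).
  rewrite mulrCA mulr_sumr; congr (_ * _); apply: eq_bigr => k _.
  by rewrite ReZ mulrCA.
under eq_bigr => j _ do rewrite term.
rewrite -mulr_sumr exchange_big /=.
under eq_bigr => k _ do rewrite -mulr_sumr dirichlet_kernel mulrBr mulr1.
rewrite sumrB mulrBr; congr (_ - _).
pose U k := h (x k) * (if (n%:Z %| i%:Z - k%:Z)%Z then n%:R else 0).
have SB : \sum_(k < M) U k = \sum_(l < q) \sum_(r < n) U (l * n + r)%N.
  by rewrite -sum_blocks mulnC.
rewrite -[X in _ * X = _]/(\sum_(k < M) U k) SB /U.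
under eq_bigr => l _.
  rewrite (bigD1 (Ordinal iN))//= big1 ?addr0 => [|r ri]; last first.
    rewrite ifF ?mulr0//; apply/negP => /dvdzP[e E]; move/eqP: ri; apply; apply/val_inj => /=.
    have rn : (r < n)%N by [].
    move: E; rewrite PoszD opprD addrA => E.
    have {}E : i%:Z - r%:Z = (e + l%:Z) * n%:Z by rewrite mulrDl -PoszM -/n in E *; rewrite -E; ring.
    move: (e + l%:Z) E => {}e E; rewrite -/n in iN.
    case: e E => [[|m]|m].
    - by rewrite mul0r => /eqP; rewrite subr_eq0 => /eqP[->].
    - rewrite -PoszM mulSn; lia.
    - rewrite NegzE mulNr -PoszM mulSn; lia.
  rewrite ifT; last first.
    apply/dvdzP; exists (- l%:Z); rewrite PoszD PoszM -/n; ring.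
  over.
rewrite -mulr_suml mulrC -mulrA /rotation_average [RHS]mulrC.
have -> : n%:R / M%:R = q%:R^-1 :> R by rewrite ME; field; rewrite qR nR.
congr (_ * _); apply: eq_bigr => l _; congr h.
by rewrite /x /z mulnC natrD natrM ME -/n; field; rewrite qR nR.
Qed.

End Interpolation.

(** * The analytic case *)

Section ComegaOperators.
Context {R : realType} (delta : {posnum R}).
Local Open Scope complex_scope.
Local Notation C := (R[i]^o).
Local Notation tau := (pi *+ 2 : R).
Local Notation D := (strip delta%:num).
Implicit Types (f g : Comega delta) (c : R[i]).

(** The conjugate coefficient makes the function real on the real axis; the factor [1] matches the
    form of [wave_analytic]. *)
Definition trig_continuation (m : nat) c : R[i] -> C :=
  fun z => c * (1 * wave m%:R z) + conjc c * wave (- m%:R) z.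

Lemma trig_continuationP (m : nat) c :
  continuation delta (fun x => 2 * complex.Re (c * cis (m%:R * x))) (trig_continuation m c).
Proof.
split; first exact: (@analytic_lin R D c _ _ (@wave_analytic R D 1 m%:R)
  (@wave_analytic R D (conjc c) (- m%:R))).
move=> x; rewrite /trig_continuation mul1r !wave_real mulNr cosN sinN /cis.
by case: c => a b; apply/eqP; rewrite eq_complex /=; apply/andP; split; apply/eqP; ring.
Qed.

Lemma trig_bound (m : nat) c z : D z ->
  normc (trig_continuation m c z) <= 2 * normc c * expR (m%:R * delta%:num).
Proof.
rewrite /strip /= => Dz.
have w (a : R) : `|a| = m%:R -> normc (wave a z) <= expR (m%:R * delta%:num).
  move=> am; rewrite normc_wave ler_expR; apply: le_trans (ler_norm _) _.
  by rewrite normrM normrN am ler_wpM2l// ltW.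
apply: le_trans (le_normcD _ _) _; rewrite mul1r (normcM c) (normcM (conjc c)).
have -> : normc (conjc c) = normc c by case: c => a b; rewrite /= sqrrN.
rewrite -mulrA mulr_natl mulr2n; apply: lerD; apply: ler_wpM2l; rewrite ?normc_ge0//.
  by apply: w; rewrite normr_nat.
by apply: w; rewrite normrN normr_nat.
Qed.

Lemma trig_subproof (m : nat) c :
  (fun x => 2 * complex.Re (c * cis (m%:R * x)) : R^o) \in @Comega_set R delta.
Proof.
rewrite inE; split=> [x|].
  have -> : m%:R * (x + tau) = m%:R * x + tau * (m%:Z)%:~R by rewrite -pmulrn; ring.
  by rewrite cisD cis_int mulr1.
exists (trig_continuation m c); first exact: trig_continuationP.
by exists (2 * normc c * expR (m%:R * delta%:num)) => z Dz; exact: trig_bound.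
Qed.

Definition trig m c : Comega delta := MkComega (trig_subproof m c).

Lemma trig_norm m c : `|trig m c| <= 2 * normc c * expR (m%:R * delta%:num).
Proof.
apply: sup_norm_le => [|z Dz]; first by rewrite !mulr_ge0 ?normc_ge0 ?expR_ge0.
by rewrite (the_continuationE (trig_continuationP m c) Dz); exact: trig_bound.
Qed.

Lemma trig_lin m (a : R) c c' : trig m (a%:C * c + c') = a *: trig m c + trig m c'.
Proof.
apply/val_inj/funext => x.
change (2 * complex.Re ((a%:C * c + c') * cis (m%:R * x)) =
  a * (2 * complex.Re (c * cis (m%:R * x))) + 2 * complex.Re (c' * cis (m%:R * x))).
by case: c c' (cis _) => [c1 c2] [c3 c4] [u v] /=; ring.
Qed.

Definition interpolant N q f : Comega delta :=
  \sum_(j < N) trig (j.+1 * q) (coef (N.*2.+1 * q) (j.+1 * q) f).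

Lemma interpolant_lin N q (a : R) f g :
  interpolant N q (a *: f + g) = a *: interpolant N q f + interpolant N q g.
Proof.
rewrite /interpolant scaler_sumr -big_split; apply: eq_bigr => j _ /=.
by rewrite -trig_lin -coef_lin.
Qed.

Lemma ComegaD_val f g x : (f + g) x = f x + g x. Proof. by []. Qed.

Lemma interpolantE N q f x : interpolant N q f x =
  \sum_(j < N) 2 * complex.Re (coef (N.*2.+1 * q) (j.+1 * q) f * cis ((j.+1 * q)%:R * x)).
Proof.
rewrite /interpolant; move: (coef _) => u; elim: N => [|k IH]; first by rewrite !big_ord0.
by rewrite !big_ord_recr ComegaD_val IH.
Qed.

Lemma interpolant_norm N q f : `|interpolant N q f| <=
  \sum_(j < N) 2 * (expR ((j.+1 * q)%:R * delta%:num) *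
    normc (coef (N.*2.+1 * q) (j.+1 * q) f)).
Proof.
apply: le_trans (ler_norm_sum _ _ _) _; apply: ler_sum => j _.
by apply: le_trans (trig_norm _ _) _; rewrite le_eqVlt; apply/orP; left; apply/eqP; ring.
Qed.

Lemma interpolant_bound N : exists c : R, forall q f, `|interpolant N q f| <= c * `|f|.
Proof.
pose K : R := 1 + 4 / (1 - expR (- delta%:num / 2)).
(* For q = 0 there are no nodes: the coefficients are empty sums and the interpolant is 0. *)
exists (N%:R * (2 * K)) => q f; case: q => [|q].
  have -> : interpolant N 0 f = 0.
    rewrite /interpolant big1// => j _.
    have -> : coef (N.*2.+1 * 0) (j.+1 * 0) f = 0 by rewrite !muln0 /coef big_ord0 mulr0.
    apply/val_inj/funext => x.
    by change (2 * complex.Re (0 * cis ((j.+1 * 0)%:R * x)) = 0); rewrite mul0r mulr0.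
  have K0 : 0 <= 1 - expR (- delta%:num / 2).
    by rewrite subr_ge0 -[leRHS]expR0 ler_expR mulNr oppr_le0 divr_ge0.
  by rewrite normr0 !mulr_ge0// addr_ge0// divr_ge0.
apply: le_trans (interpolant_norm _ _ _) _.
apply: le_trans (_ : \sum_(j < N) (2 * K * `|f|) <= _); last first.
  by rewrite sumr_const card_ord -[_ *+ N]mulr_natl mulrA.
apply: ler_sum => j _; rewrite -mulrA ler_pM2l//; apply: coef_bound.
  by rewrite muln_gt0.
by rewrite doubleMl leq_pmul2r// doubleS ltnS ltn_double.
Qed.

Lemma interpolant_cvg N f : interpolant N q f @[q --> \oo] --> (0 : Comega delta).
Proof.
apply/cvgrPdist_le => e e0.
have N1 : 0 < N%:R * 2 + 1 :> R by rewrite ltr_wpDl.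
have e1 : 0 < e / (N%:R * 2 + 1) by rewrite divr_gt0.
have one (j : 'I_N) : \forall q \near \oo, expR ((j.+1 * q)%:R * delta%:num) *
    normc (coef (N.*2.+1 * q) (j.+1 * q) f) <= e / (N%:R * 2 + 1).
  have [|Q0 hQ] := @coef_cvg R delta N j.+1 f _ _ e1; first by rewrite ltn_ord.
  by exists Q0.+1 => // -[//|q] /= Qq; exact: hQ.
have all : \forall q \near \oo, forall j : 'I_N, expR ((j.+1 * q)%:R * delta%:num) *
    normc (coef (N.*2.+1 * q) (j.+1 * q) f) <= e / (N%:R * 2 + 1).
  by apply: filter_forall => j; exact: one.
apply: filterS all => q allq; rewrite sub0r normrN.
apply: le_trans (interpolant_norm _ _ _) _.
apply: le_trans (_ : \sum_(j < N) (2 * (e / (N%:R * 2 + 1))) <= _).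
  by apply: ler_sum => j _; rewrite ler_pM2l.
rewrite sumr_const card_ord -[_ *+ N]mulr_natl mulrA mulrA ler_pdivrMr// mulrC.
by rewrite ler_pM2l// lerDl.
Qed.

End ComegaOperators.

Lemma Comega_generic (R : realType) (b l : nat) (delta : {posnum R}) :
  Baire_generic [set f : Cl_family b l (Comega delta) |
    forall t : 'rV[R]_b, cube t -> infinite_infinitesimal_cyclicity (f t)].
Proof.
apply: (@Baire_generic_cyclicity R b l (Comega delta) (fun f => f : R -> R)) => //.
- exact: Comega_le.
- move=> f; apply: oscillation_cyclicity.
  + exact: Comega_periodic.
  + exact: Comega_taylor1.
  + by exists `|f| => x; exact: Comega_le.
move=> K K0; pose N := K.*2; have [c hc] := interpolant_bound delta N.
exists (interpolant N), c, (fun q => trig delta (N * q) (2^-1)).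
split=> [q a f g|q f|f|q q0].
- exact: interpolant_lin.
- exact: hc.
- exact: interpolant_cvg.
exists (fun i => pi *+ 2 * (i%:R / (N.*2.+1 * q)%:R)), (cos (pi / N.*2.+1%:R * N%:R)).
split=> [|f e e0]; first exact: cos_grid_gt0.
(* At the nodes the interpolant cancels A_q f up to the mean of [f] over all M nodes, which becomes
   the level. *)
exists ((N.*2.+1 * q)%:R^-1 * \sum_(k < N.*2.+1 * q) f (pi *+ 2 * (k%:R / (N.*2.+1 * q)%:R))).
apply: oscillates_grid => // i iN.
set z := _ * _.
have qR0 : 0 < q%:R :> R by rewrite ltr0n.
have cisq (m : nat) (x : R) : cis ((m * q)%:R * (x + pi *+ 2 / q%:R)) = cis ((m * q)%:R * x).
  have -> : (m * q)%:R * (x + pi *+ 2 / q%:R) = (m * q)%:R * x + pi *+ 2 * (m%:Z)%:~R :> R.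
    by rewrite -pmulrn natrM; field; rewrite gt_eqF.
  by rewrite cisD cis_int mulr1.
have Tq x : interpolant N q f (x + pi *+ 2 / q%:R) = interpolant N q f x.
  by rewrite !interpolantE; apply: eq_bigr => j _; rewrite cisq.
have pq x : trig delta (N * q) 2^-1 (x + pi *+ 2 / q%:R) = trig delta (N * q) 2^-1 x.
  by apply: (congr1 (fun c => 2 * complex.Re (2^-1%C * c))); exact: cisq.
have -> : rotation_average q (f - interpolant N q f + e *: trig delta (N * q) 2^-1) z =
    rotation_average q f z - rotation_average q (interpolant N q f) z +
    e * rotation_average q (trig delta (N * q) 2^-1) z.
  rewrite /rotation_average -mulrBr [e * _]mulrCA -mulrDr; congr (_ * _).
  by rewrite -sumrB mulr_sumr -big_split; apply: eq_bigr.
rewrite (rotation_average_id _ q0 Tq) (rotation_average_id _ q0 pq).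
have i2N : (i < N.*2.+1)%N by rewrite ltnS -addnn (leq_trans iN)// leq_addr.
rewrite (interpolantE N q f) (@interpolation R N q f i q0 i2N) -/z.
rewrite opprB addrA addrAC subrr add0r; congr (_ + e * _).
have -> : (2^-1 : R[i]%C) = (2^-1)%:C%C by rewrite fmorphV rmorph_nat.
by rewrite /= /cis /= mul0r subr0 mulrA divff ?mul1r.
Qed.

Theorem theorem2 (R : realType) (b l : nat) (hb : (1 <= b)%N) :
  (forall k : nat, (2 <= k)%N ->
     Baire_generic [set f : Cl_family b l (Ck R k) |
       forall t : 'rV[R]_b, cube t -> infinite_infinitesimal_cyclicity (f t)])
  /\
  (forall delta : {posnum R},
     Baire_generic [set f : Cl_family b l (Comega delta) |
       forall t : 'rV[R]_b, cube t -> infinite_infinitesimal_cyclicity (f t)]).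
Proof.
split=> [k k2|delta]; [exact: Ck_generic|exact: Comega_generic].
Qed.
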